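(* Let $G$ be a unipotent algebraic $\mathbb{Z}$-group, $p$ a prime, and $n$ the length of a Mal'cev basis of $G(\mathbb{Z})$. For $M=(m_{ij})\in T_n(\mathbb{Q}_p)$ let $f(M):=\prod_{i=1}^n m_{11}\cdots m_{ii}$. Then $$\zeta_{G,p}(s) = \frac{1}{(1-p^{-1})^{2n}}\int_{(A,B)\in\mathfrak{U}_p} |f(A)f(B)|_p^{-1}\,\left|\det(B)^2\det(A)^{-1}\right|_p^{s}\,d\nu.$$
   Context: A unipotent algebraic $\mathbb{Z}$-group is a unipotent algebraic group $G$ defined over $\mathbb{Z}$. It is regarded as embedded as a closed subgroup of a group of lower-triangular unipotent matrices (Kolchin's theorem), and $G(R)$ denotes its group of $R$-points. For subgroups $A,B$ of a common group, $\mathrm{c}(A,B) := [A:A\cap B]\,[B:A\cap B]$. $\mathcal{L}(G)$ is the set of arithmetic lattices in $G$, i.e. subgroups of $G(\mathbb{R})$ commensurable with $G(\mathbb{Z})$ (finite $\mathrm{c}$); all of them lie in $G(\mathbb{Q})$. $\mathcal{L}_m(G)$ is the set of $\Delta\in\mathcal{L}(G)$ with $\mathrm{c}(\Delta,G(\mathbb{Z}))=m$. The local commensurability zeta function is $\zeta_{G,p}(s):=\sum_{k=0}^\infty |\mathcal{L}_{p^k}(G)|\,p^{-ks}$. A bar or superscript ${}^-$ denotes closure in $G(\mathbb{Q}_p)$. For real $s$ both sides of the claimed identity involve only nonnegative quantities and may be read in $[0,\infty]$. Fix a Mal'cev basis $(x_1,\dots,x_n)$ of $G(\mathbb{Z})$: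 $1<\langle x_1\rangle<\langle x_1,x_2\rangle<\dots<\langle x_1,\dots,x_n\rangle=G(\mathbb{Z})$ is a central series with infinite cyclic successive quotients. Elements of $G(\mathbb{Q}_p)$ are identified with $p$-adic words $\mathbf{x}(\mathbf{a})=x_1^{a_1}\cdots x_n^{a_n}$, $\mathbf{a}\in\mathbb{Q}_p^n$. Let $G_i=\langle x_1^{r_1},\dots,x_i^{r_i}: r_1,\dots,r_i\in\mathbb{Q}_p\rangle$. For a closed subgroup $H\le G(\mathbb{Q}_p)$, an $n$-tuple $(h_1,\dots,h_n)$ of elements of $H$ is a good basis for $H$ if $\langle h_1,\dots,h_i\rangle^-=H\cap G_i$ for each $i=1,\dots,n$. $T_n(R)$ is the set of lower-triangular $n\times n$ matrices over $R$. For $\Delta\in\mathcal{L}(G)$, $\mathfrak{U}(\Delta)$ is the set of pairs $(A,B)$ with $A\in T_n(\mathbb{Q}_p)$, $B\in T_n(\mathbb{Z}_p)$, with rows $a_i$ and $b_i$ respectively, such that $(\mathbf{x}(a_1),\dots,\mathbf{x}(a_n))$ is a good basis for $\overline{\Delta}$ and $(\mathbf{x}(b_1),\dots,\mathbf{x}(b_n))$ is a good basis for $\overline{\Delta}\cap G(\mathbb{Z}_p)$. Put $\mathfrak{U}_p:=\bigcup_{k=0}^\infty\bigcup_{\Delta\in\mathcal{L}_{p^k}(G)}\mathfrak{U}(\Delta)$. $\nu$ denotes Haar measure on $T_n(\mathbb{Q}_p)\times T_n(\mathbb{Q}_p)\cong\mathbb{Q}_p^{n(n+1)}$ (matrix entries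 as coordinates), normalized so that $T_n(\mathbb{Z}_p)\times T_n(\mathbb{Z}_p)$ has measure $1$. *)

(* Defs.v *)
From HB Require Import structures.
From mathcomp Require Import all_boot all_order all_algebra.
From mathcomp Require Import all_classical all_reals all_analysis.
From mathcomp Require mpoly.
Import (canonicals) mpoly.

Set Implicit Arguments.
Unset Strict Implicit.
Unset Printing Implicit Defensive.

Import Order.TTheory GRing.Theory Num.Theory.

Local Open Scope classical_set_scope.
Local Open Scope ring_scope.

Definition rat_padic_abs (R : realType) (p : nat) (q : rat) : R :=
  if q == 0 then 0
  else p%:R ^ ((logn p `|denq q|%N)%:Z - (logn p `|numq q|%N)%:Z).

(* A model of the field Q_p: a field, complete for an absolute value that
   restricts to the p-adic absolute value on its prime field Q, in which Q is
   dense.  For p prime this determines the valued field up to a unique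
   isomorphism. *)
Record padicField (R : realType) (p : nat) := PadicField {
  padic_field :> fieldType;
  padic_absval : padic_field -> R;
  padic_absval_eq0 : forall a, padic_absval a = 0 -> a = 0;
  padic_absvalM : forall a b,
    padic_absval (a * b) = padic_absval a * padic_absval b;
  padic_absvalD : forall a b,
    padic_absval (a + b) <= padic_absval a + padic_absval b;
  padic_absval_rat : forall q : rat,
    padic_absval (ratr q) = rat_padic_abs R p q;
  padic_complete : forall u : nat -> padic_field,
    (forall e : R, 0 < e -> exists N : nat, forall i j : nat,
       (N <= i)%N -> (N <= j)%N -> padic_absval (u i - u j) < e) ->
    exists l, forall e : R, 0 < e -> exists N : nat, forall i : nat,
       (N <= i)%N -> padic_absval (u i - l) < e;
  padic_dense_rat : forall a (e : R), 0 < e ->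
    exists q : rat, padic_absval (a - ratr q) < e
}.

(* The carrier of a model of Q_p, on which the metric topology is declared. *)
Definition padic (R : realType) (p : nat) (K : padicField R p) : Type :=
  padic_field K.

Section PadicMetric.
Variables (R : realType) (p : nat) (K : padicField R p).

HB.instance Definition _ := GRing.Field.on (padic K).

Definition padic_abs : padic K -> R := @padic_absval R p K.

Definition padic_dist (a b : padic K) : R := padic_abs (a - b).

Lemma padic_abs0 : padic_abs 0 = 0.
Proof.
have := padic_absval_rat K 0; rewrite /rat_padic_abs eqxx => <-.
by rewrite /padic_abs; congr padic_absval; exact/esym/(ratr_int _ 0).
Qed.

Lemma padic_abs1 : padic_abs 1 = 1.
Proof.
have := padic_absval_rat K 1.
rewrite /rat_padic_abs oner_eq0 !logn1 expr0z => <-.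
by rewrite /padic_abs; congr padic_absval; exact/esym/(ratr_int _ 1).
Qed.

Lemma padic_absN a : padic_abs (- a) = padic_abs a.
Proof.
have := padic_absval_rat K (-1).
rewrite /rat_padic_abs oppr_eq0 oner_eq0 !logn1 expr0z => h.
rewrite -mulN1r /padic_abs padic_absvalM -[RHS]mul1r; congr (_ * _).
by rewrite -h; congr padic_absval; exact/esym/(ratr_int _ (-1)).
Qed.

Lemma padic_distxx a : padic_dist a a = 0.
Proof. by rewrite /padic_dist subrr padic_abs0. Qed.

Lemma padic_dist_eq0 a b : padic_dist a b = 0 -> a = b.
Proof. by move=> /padic_absval_eq0 /eqP; rewrite subr_eq0 => /eqP. Qed.

Lemma padic_distC a b : padic_dist a b = padic_dist b a.
Proof. by rewrite /padic_dist -padic_absN opprB. Qed.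

Lemma padic_dist_triangle b a c :
  padic_dist a c <= padic_dist a b + padic_dist b c.
Proof.
rewrite /padic_dist (_ : a - c = (a - b) + (b - c)) ?padic_absvalD//.
by rewrite addrA subrK.
Qed.

HB.instance Definition _ := isMetric.Build R (padic K)
  padic_distxx padic_dist_eq0 padic_distC padic_dist_triangle.
HB.instance Definition _ := isPointed.Build (padic K) 0.

Definition padic_int : set (padic K) := [set a | padic_abs a <= 1].

End PadicMetric.

Section Subgroups.
Variable A : unitRingType.
Implicit Types H S : set A.

(* H is a subgroup of the group of units of A. *)
Definition subgroup H : Prop :=
  [/\ H `<=` [set g | g \is a GRing.unit], H 1,
      (forall g h, H g -> H h -> H (g * h)) & (forall g, H g -> H g^-1)].

Definition generated_subgroup S : set A := smallest subgroup S.

Definition left_cosets H S : set (set A) :=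
  [set [set g * h | h in S] | g in H].

(* For S a normal subgroup of H: the class of g freely generates H / S. *)
Definition infinite_cyclic_quotient H S : Prop :=
  exists2 g, H g & forall h, H h -> exists! k : int, S (g ^ (- k) * h).

Definition subgroup_index (R : realType) H S : \bar R :=
  counting (left_cosets H S).

Definition commensurability_index (R : realType) H S : \bar R :=
  (subgroup_index R H (H `&` S) * subgroup_index R S (H `&` S))%E.

End Subgroups.

(* Lower-triangular unipotent matrices over S satisfying the equations E, whose
   variables stand for the matrix entries. *)
Definition unitri_zeros (m : nat) (E : seq (mpoly.mpoly (m.+1 * m.+1) int))
    (S : comNzRingType) : set 'M[S]_m.+1 :=
  [set g | [/\ is_trig_mx g, (forall i, g i i = 1) &
     forall P, P \in E ->
       mpoly.mmap (intr : int -> S) (fun k => mxvec g 0 k) P = 0]].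

(* A closed subset of the lower-triangular unipotent matrices, cut out by
   polynomials over Z, whose points form a group over every field of
   characteristic 0.  Nothing is required in positive characteristic: the
   equations may be those of any algebraic group defined over Z in the classical
   sense, and group schemes over Z are covered as well. *)
Record unipotentZGroup (m : nat) := UnipotentZGroup {
  zequations : seq (mpoly.mpoly (m.+1 * m.+1) int);
  zequations_group : forall F : fieldType, [pchar F] =i pred0 ->
    subgroup (@unitri_zeros m zequations F)
}.

Definition points (m : nat) (G : unipotentZGroup m) (S : comNzRingType) :
  set 'M[S]_m.+1 := @unitri_zeros m (zequations G) S.

Arguments points {m} G S _.

Section MalcevBasis.
Variables (m : nat) (G : unipotentZGroup m).
Variables (n : nat) (x : 'I_n -> 'M[int]_m.+1).

Definition malcev_term (i : nat) : set 'M[int]_m.+1 :=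
  generated_subgroup [set x j | j in [set j : 'I_n | (j < i)%N]].

Definition malcev_basis : Prop :=
  [/\ malcev_term n = points G int,
      (forall (i : 'I_n) g h, points G int g -> malcev_term i.+1 h ->
         malcev_term i (g^-1 * h^-1 * g * h)) &
      (forall i : 'I_n,
         infinite_cyclic_quotient (malcev_term i.+1) (malcev_term i))].

End MalcevBasis.

Section Lattices.
Variables (R : realType) (m : nat) (G : unipotentZGroup m).

Definition integral_points : set 'M[R]_m.+1 :=
  [set map_mx intr g | g in points G int].

Definition arithmetic_lattices : set (set 'M[R]_m.+1) :=
  [set D | [/\ subgroup D, D `<=` points G R &
     (commensurability_index R D integral_points < +oo)%E]].

Definition lattices_of_index (k : nat) : set (set 'M[R]_m.+1) :=
  [set D | arithmetic_lattices D /\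
     commensurability_index R D integral_points = k%:R%:E].

Definition local_zeta (p : nat) (s : R) : \bar R :=
  (\sum_(0 <= k <oo)
     counting (lattices_of_index (p ^ k)) * (p%:R `^ (- (k%:R * s)))%:E)%E.

End Lattices.

Arguments lattices_of_index R {m} G k _.

(* g ^ a for g unipotent of size m.+1, by the (finite) binomial series. *)
Definition unipotent_pow (K : fieldType) (m : nat) (g : 'M[K]_m.+1) (a : K) :
    'M[K]_m.+1 :=
  \sum_(k < m.+1) ((\prod_(i < k) (a - i%:R)) / (k`!)%:R) *: (g - 1) ^+ k.

Section LowerTriangular.
Variables (K : fieldType) (n : nat).

Record trigmx := Trigmx { trigval : 'M[K]_n; trigvalP : is_trig_mx trigval }.

HB.instance Definition _ := [isSub for trigval].
HB.instance Definition _ := [Choice of trigmx by <:].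

Lemma is_trig_mx_zmod_closed : zmod_closed (@is_trig_mx K n n).
Proof.
split=> [|A B]; rewrite /in_mem /=; first exact: mx0_is_trig.
move=> /is_trig_mxP hA /is_trig_mxP hB; apply/is_trig_mxP => i j ij.
by rewrite !mxE hA // hB // subr0.
Qed.

HB.instance Definition _ :=
  GRing.isZmodClosed.Build 'M[K]_n (@is_trig_mx K n n) is_trig_mx_zmod_closed.
HB.instance Definition _ := [SubChoice_isSubZmodule of trigmx by <:].
HB.instance Definition _ := isPointed.Build trigmx 0.

End LowerTriangular.

Section PadicSide.
Variables (R : realType) (p : nat) (K : padicField R p).

HB.instance Definition _ (n : nat) :=
  Topological.copy (trigmx (padic K) n)
    (initial_topology (@trigval (padic K) n)).

Definition trigpair (n : nat) := (trigmx (padic K) n * trigmx (padic K) n)%type.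

Definition trigpair_borel (n : nat) := g_sigma_algebraType (@open (trigpair n)).

Definition trig_integral (n : nat) (A : trigmx (padic K) n) : Prop :=
  forall i j, padic_int (trigval A i j).

Definition normalized_haar (n : nat)
    (nu : {measure set (trigpair_borel n) -> \bar R}) : Prop :=
  (forall (t : trigpair n) (X : set (trigpair_borel n)), measurable X ->
     nu [set (t + y : trigpair n) | y in X] = nu X) /\
  nu [set AB : trigpair n | trig_integral AB.1 /\ trig_integral AB.2] = 1%E.

Section GoodBases.
Variables (m : nat) (G : unipotentZGroup m).

Definition padic_closure (S : set 'M[padic K]_m.+1) : set 'M[padic K]_m.+1 :=
  points G (padic K) `&` closure S.

Definition padic_integral_points : set 'M[padic K]_m.+1 :=
  [set g | points G (padic K) g /\ forall i j, padic_int (g i j)].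

Variables (n : nat) (x : 'I_n -> 'M[int]_m.+1).

Definition malcev_pow (i : 'I_n) (a : padic K) : 'M[padic K]_m.+1 :=
  unipotent_pow (map_mx intr (x i)) a.

Definition padic_word (a : 'rV[padic K]_n) : 'M[padic K]_m.+1 :=
  \prod_(i < n) malcev_pow i (a 0 i).

Definition malcev_flag (i : nat) : set 'M[padic K]_m.+1 :=
  generated_subgroup [set g | exists j : 'I_n, exists r : padic K,
    (j < i)%N /\ g = malcev_pow j r].

Definition good_basis (H : set 'M[padic K]_m.+1)
    (h : 'I_n -> 'M[padic K]_m.+1) : Prop :=
  (forall i, H (h i)) /\
  forall i : 'I_n,
    padic_closure
      (generated_subgroup [set h j | j in [set j : 'I_n | (j <= i)%N]]) =
    H `&` malcev_flag i.+1.

(* The closure in G(Q_p) of a set D of rational points of G(R). *)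
Definition lattice_closure (D : set 'M[R]_m.+1) : set 'M[padic K]_m.+1 :=
  padic_closure
    [set map_mx ratr g | g in [set g : 'M[rat]_m.+1 | D (map_mx ratr g)]].

Definition good_pairs (D : set 'M[R]_m.+1) : set (trigpair n) :=
  [set AB | [/\ trig_integral AB.2,
     good_basis (lattice_closure D)
       (fun i => padic_word (row i (trigval AB.1))) &
     good_basis (lattice_closure D `&` padic_integral_points)
       (fun i => padic_word (row i (trigval AB.2)))]].

Definition all_good_pairs : set (trigpair n) :=
  \bigcup_(k in [set: nat]) \bigcup_(D in lattices_of_index R G (p ^ k))
    good_pairs D.

End GoodBases.

Definition diag_weight (n : nat) (M : trigmx (padic K) n) : padic K :=
  \prod_(i < n) \prod_(j < n | (j <= i)%N) trigval M j j.

End PadicSide.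

Arguments all_good_pairs {R p} K {m} G {n} x _.

(* Main.v *)
(* A lattice D of G of index p^k is a group of rational matrices, and it is
   recovered from its closure D^- in G(Q_p).  Along the flag of the Mal'cev basis,
   D^- and its intersection with G(Z_p) have images p^(e_i) Z_p and p^(e'_i) Z_p
   in the successive quotients, and multiplicativity of the index gives
   sum_i (2 e'_i - e_i) = k.  A pair (A, B) of triangular matrices belongs to U(D)
   if and only if the words of the rows of A and B lie in these two groups and
   |a_ii| = p^(-e_i), |b_ii| = p^(-e'_i).  When the later entries of a row are
   fixed, the admissible values of an entry form a coset of p^(e_j) Z_p, so a
   measure-preserving shear, one entry at a time, turns U(D) into a product of
   balls and spheres: its measure is (1 - 1/p)^(2n) |f(A) f(B)|.  On U(D) the
   integrand is the constant |f(A) f(B)|^(-1) p^(-ks), so each lattice contributes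
   (1 - 1/p)^(2n) p^(-ks), and the sets U(D) are disjoint.

   Mal'cev coordinates are controlled over any field of characteristic 0 by the
   logarithm, defined as the linear coefficient of the polynomial a |-> g^a:
   identities between such polynomials need only be checked at natural a. *)

Require Import Defs.
From HB Require Import structures.
From mathcomp Require Import all_boot all_order all_algebra.
From mathcomp Require Import all_classical all_reals all_analysis.
From mathcomp Require Import measurable_realfun.
From mathcomp Require Import ring lra zify.

Set Implicit Arguments.
Unset Strict Implicit.
Unset Printing Implicit Defensive.

Import Order.TTheory GRing.Theory Num.Theory.

Local Open Scope classical_set_scope.
Local Open Scope ring_scope.

(** * Polynomial families of matrices *)

(** The hypotheses on a Mal'cev basis concern integral matrices only: they do not say that the words
    with exponents in a field form a group, or that exponents are unique. Both facts come from
    linear functionals [c i] on matrices with value 1 at the logarithm of the [i]-th generator and 0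
    at the earlier ones. They exist over Q because a linear dependence between the logarithms would
    put a positive power of a generator into the preceding term of the integral series; they pass to
    Q_p entry by entry. Coordinates are then polynomial in the matrix entries, hence continuous. A
    lattice can be recovered from its closure because the index p^k forces [g ^+ (p ^ k)] to be
    integral, so the entries of [g] lie in Z[1/p], which meets Z_p in Z. As the intersection with
    G(Z) need not be normal, this power statement is not Lagrange's theorem and is proved down the
    flag. Finiteness of the set of lattices of given index is never established: every U(D) is open,
    so arbitrary unions are measurable, and both sides are compared in [0, +oo]. *)

Section PolynomialFamilies.
Variables (F : fieldType) (N : nat).
Hypothesis charF : [pchar F] =i pred0.
Notation M := 'M[F]_N.+1.

Lemma poly_natr_eq0 (q : {poly F}) :
  (forall k : nat, q.[k%:R] = 0) -> q = 0.
Proof.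
move=> h; apply/eqP; apply: contraT => q0.
have := @max_poly_roots F q (mkseq (fun k => k%:R) (size q)) q0.
rewrite size_mkseq ltnn => -> //.
- by apply/allP => _ /mapP[k _ ->]; rewrite /root h.
- rewrite map_inj_uniq ?iota_uniq // => a b.
  wlog ab : a b / (a <= b)%N.
    by move=> w; case/orP: (leq_total a b) => [/w//|/w w' /esym/w'].
  move=> /esym/eqP; rewrite -subr_eq0 -natrB // ((pcharf0P F).1 charF) subn_eq0.
  by move=> ba; apply/eqP; rewrite eqn_leq ab ba.
Qed.

(* [A + B t] is the 1-jet of [f] at the origin. *)
Definition pjet (f : F -> M) (A B : M) : Prop :=
  exists P : 'M[{poly F}]_N.+1,
    [/\ forall a, f a = map_mx (horner_eval a) P,
        A = map_mx (coefp 0) P & B = map_mx (coefp 1) P].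

Definition polyfam (f : F -> M) := exists A B, pjet f A B.

Lemma pjet_polyfam f A B : pjet f A B -> polyfam f.
Proof. by exists A, B. Qed.

Lemma pjet0 f A B : pjet f A B -> f 0 = A.
Proof.
move=> [P [-> -> _]]; apply/matrixP => i j; rewrite !mxE.
by rewrite /horner_eval horner_coef0.
Qed.

Lemma pjet_eq f g A B : f =1 g -> pjet f A B -> pjet g A B.
Proof. by move=> fg [P [hP ? ?]]; exists P; split=> // a; rewrite -fg. Qed.

Lemma pjet_const A : pjet (fun=> A) A 0.
Proof.
exists (map_mx polyC A); split=> [a||]; apply/matrixP => i j; rewrite !mxE.
- by rewrite /horner_eval hornerC.
- by rewrite /= coefC.
- by rewrite /= coefC.
Qed.

Lemma pjetD f g A B A' B' :
  pjet f A B -> pjet g A' B' -> pjet (fun a => f a + g a) (A + A') (B + B').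
Proof.
move=> [P [hP -> ->]] [Q [hQ -> ->]]; exists (P + Q); split=> [a||].
- by rewrite hP hQ map_mxD.
- by apply/matrixP => i j; rewrite !mxE /= coefD.
- by apply/matrixP => i j; rewrite !mxE /= coefD.
Qed.

Lemma pjetM f g A B A' B' :
  pjet f A B -> pjet g A' B' ->
  pjet (fun a => f a * g a) (A * A') (A * B' + B * A').
Proof.
move=> [P [hP -> ->]] [Q [hQ -> ->]]; exists (P * Q); split=> [a||].
- by rewrite hP hQ -!mulmxE map_mxM.
- apply/matrixP => i j; rewrite !mxE /= coef_sum; apply: eq_bigr => k _.
  by rewrite !mxE /= coefM big_ord_recl big_ord0 addr0.
- apply/matrixP => i j; rewrite !mxE /= coef_sum -big_split /=.
  apply: eq_bigr => k _.
  by rewrite !mxE /= coefM !big_ord_recl big_ord0 addr0.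
Qed.

Lemma pjetZ (q : {poly F}) f A B :
  pjet f A B -> pjet (fun a => q.[a] *: f a) (q`_0 *: A) (q`_0 *: B + q`_1 *: A).
Proof.
move=> [P [hP -> ->]]; exists (q *: P); split=> [a||].
- rewrite hP; apply/matrixP => i j; rewrite !mxE /horner_eval.
  by rewrite hornerM.
- apply/matrixP => i j; rewrite !mxE /=.
  by rewrite coefM big_ord_recl big_ord0 addr0.
- apply/matrixP => i j; rewrite !mxE /=.
  by rewrite coefM !big_ord_recl big_ord0 addr0.
Qed.

Lemma pjet_sum (I : Type) (r : seq I) (f : I -> F -> M) A B :
  (forall i, pjet (f i) (A i) (B i)) ->
  pjet (fun a => \sum_(i <- r) f i a) (\sum_(i <- r) A i) (\sum_(i <- r) B i).
Proof.
move=> h; elim: r => [|i r IH].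
  by rewrite !big_nil; apply: pjet_eq (pjet_const 0) => a; rewrite big_nil.
rewrite !big_cons; apply: pjet_eq (pjetD (h i) IH) => a.
by rewrite big_cons.
Qed.

Lemma pjet_comp_scale (c : F) f A B :
  pjet f A B -> pjet (fun a => f (c * a)) A (c *: B).
Proof.
move=> [P [hP -> ->]].
exists (map_mx (comp_poly (c *: 'X)) P); split=> [a||].
- rewrite hP; apply/matrixP => i j; rewrite !mxE /horner_eval.
  by rewrite horner_comp !hornerE.
- apply/matrixP => i j; rewrite !mxE /= -!horner_coef0 horner_comp !hornerE.
  by rewrite ?mulr0.
- apply/matrixP => i j; rewrite !mxE /=.
  have h (q : {poly F}) : q`_1 = (q^`()).[0] by rewrite horner_coef0 coef_deriv.
  rewrite !h deriv_comp hornerM horner_comp derivZ derivX !hornerZ hornerX mulr0.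
  by rewrite hornerC mulr1 mulrC.
Qed.

Lemma pjet_shift (b : F) f : polyfam f -> exists B, pjet (fun a => f (b + a)) (f b) B.
Proof.
move=> [A [B [P [hP _ _]]]].
pose Q := map_mx (comp_poly (b%:P + 'X)) P.
have fQ a : f (b + a) = map_mx (horner_eval a) Q.
  rewrite hP; apply/matrixP => i j; rewrite !mxE /horner_eval.
  by rewrite horner_comp !hornerE.
exists (map_mx (coefp 1) Q), Q; split=> //.
rewrite -[b in LHS]addr0 fQ.
by apply/matrixP => i j; rewrite !mxE /= -horner_coef0.
Qed.

Lemma pjet_uniq f A B A' B' : pjet f A B -> pjet f A' B' -> A = A' /\ B = B'.
Proof.
move=> [P [hP -> ->]] [Q [hQ -> ->]].
suff -> : P = Q by [].
apply/matrixP => i j; apply/eqP; rewrite -subr_eq0; apply/eqP.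
apply: poly_natr_eq0 => k; rewrite hornerD hornerN.
have := hP k%:R; rewrite hQ => /matrixP/(_ i j); rewrite !mxE /horner_eval => ->.
by rewrite subrr.
Qed.

Lemma polyfam_const A : polyfam (fun=> A).
Proof. exact: pjet_polyfam (pjet_const A). Qed.

Lemma polyfamM f g : polyfam f -> polyfam g -> polyfam (fun a => f a * g a).
Proof.
by move=> [A [B h]] [A' [B' h']]; exact: pjet_polyfam (pjetM h h').
Qed.

Lemma polyfamX f k : polyfam f -> polyfam (fun a => f a ^+ k).
Proof.
move=> hf; elim: k => [|k IH].
  by have [A [B h]] := polyfam_const 1; exists A, B; apply: pjet_eq h.
have [A [B h]] := polyfamM hf IH; exists A, B.
by apply: pjet_eq h => a; rewrite exprS.
Qed.

Lemma polyfam_eq f g : f =1 g -> polyfam f -> polyfam g.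
Proof. by move=> fg [A [B h]]; exists A, B; apply: pjet_eq h. Qed.

Lemma polyfamZ (q : {poly F}) f : polyfam f -> polyfam (fun a => q.[a] *: f a).
Proof. by move=> [A [B h]]; exact: pjet_polyfam (pjetZ q h). Qed.

Lemma polyfamB f g : polyfam f -> polyfam g -> polyfam (fun a => f a - g a).
Proof.
move=> [A [B h]] [A' [B' h']].
have := pjetD h (pjetZ ((-1)%:P) h'); move/pjet_polyfam; apply: polyfam_eq => a.
by rewrite hornerC scaleN1r.
Qed.

Lemma polyfam_sum (I : Type) (r : seq I) (f : I -> F -> M) :
  (forall i, polyfam (f i)) -> polyfam (fun a => \sum_(i <- r) f i a).
Proof.
move=> h; elim: r => [|i r IH].
  by apply: polyfam_eq (polyfam_const 0) => a; rewrite big_nil.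
have [A [B hi]] := h i; have [A' [B' hr]] := IH.
exists (A + A'), (B + B'); apply: pjet_eq (pjetD hi hr) => a.
by rewrite big_cons.
Qed.

Lemma polyfam_eqP f g : polyfam f -> polyfam g ->
  (forall k : nat, f k%:R = g k%:R) -> f =1 g.
Proof.
move=> [_ [_ [P [hP _ _]]]] [_ [_ [Q [hQ _ _]]]] fg a.
rewrite hP hQ; congr map_mx; apply/matrixP => i j.
apply/eqP; rewrite -subr_eq0; apply/eqP; apply: poly_natr_eq0 => k.
have := fg k; rewrite hP hQ hornerD hornerN => /matrixP/(_ i j).
by rewrite !mxE /horner_eval => ->; rewrite subrr.
Qed.

(** The product of the polynomial matrix with [C] is a row of polynomials vanishing at all natural
    numbers, hence zero; so its values and its coefficients of degree 1 vanish as well. *)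
Lemma polyfam_ker f (r : nat) (C : 'M[F]_(N.+1 * N.+1, r)) A B : pjet f A B ->
  (forall k : nat, mxvec (f k%:R) *m C = 0) ->
  mxvec B *m C = 0 /\ forall a, mxvec (f a) *m C = 0.
Proof.
move=> [P [hP _ ->]] h.
pose w := mxvec P *m map_mx polyC C.
have hw a : map_mx (horner_eval a) w = mxvec (f a) *m C.
  rewrite map_mxM map_mxvec -hP -map_mx_comp map_mx_id // => c /=.
  by rewrite /horner_eval hornerC.
have w0 : w = 0.
  apply/rowP => j; rewrite [RHS]mxE; apply: poly_natr_eq0 => k.
  by have := h k; rewrite -hw => /rowP/(_ j); rewrite !mxE.
split=> [|a]; last by rewrite -hw w0 map_mx0.
rewrite -map_mxvec; apply/rowP => j.
have := congr1 (map_mx (coefp 1)) w0 => /rowP/(_ j).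
rewrite map_mx0 => <-; rewrite [LHS]mxE [RHS]mxE /w mxE.
rewrite /= coef_sum; apply: eq_bigr => k _.
by rewrite [in RHS]mxE coefMC mxE.
Qed.

(** The bridge from groups to logarithms: what holds for integer powers of group elements passes to
    the tangent vector at 0. Membership in a subspace is tested by the cokernel, which reduces it to
    [polyfam_ker]. *)
Lemma polyfam_linear f (r : nat) (H : 'M[F]_(r, N.+1 * N.+1)) A B : pjet f A B ->
  (forall k : nat, (mxvec (f k%:R) <= H)%MS) ->
  (mxvec B <= H)%MS /\ forall a, (mxvec (f a) <= H)%MS.
Proof.
move=> hf h; have [k|hB ha] := @polyfam_ker f _ (cokermx H) A B hf.
  by have := h k; rewrite submxE => /eqP.
by split=> [|a]; rewrite submxE ?hB ?ha.
Qed.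

(** The hypothesis says that the derivative vanishes at every point, since the linear term of the
    jet of the shifted family at [b] is the derivative at [b]. In characteristic 0 a polynomial with
    zero derivative is constant. *)
Lemma polyfam_deriv0 f :
  (forall b B, pjet (fun a => f (b + a)) (f b) B -> B = 0) ->
  polyfam f -> forall a, f a = f 0.
Proof.
move=> h hf a; have [_ [_ [P [hP _ _]]]] := hf.
rewrite !hP; apply/matrixP => i j; rewrite !mxE /horner_eval.
have d0 : (P i j)^`() = 0.
  apply: poly_natr_eq0 => k.
  pose Q := map_mx (comp_poly (k%:R%:P + 'X)) P.
  have hQ : pjet (fun a => f (k%:R + a)) (f k%:R) (map_mx (coefp 1) Q).
    exists Q; split=> // [b|].
      rewrite hP; apply/matrixP => i' j'; rewrite !mxE /horner_eval.
      by rewrite horner_comp !hornerE.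
    rewrite hP; apply/matrixP => i' j'; rewrite !mxE /= -horner_coef0.
    by rewrite horner_comp !hornerE /horner_eval ?addr0.
  have /matrixP/(_ i j) := h _ _ hQ; rewrite !mxE /=.
  have e (q : {poly F}) : q`_1 = (q^`()).[0] by rewrite horner_coef0 coef_deriv.
  rewrite e deriv_comp hornerM horner_comp !hornerE derivD derivC derivX.
  by rewrite !hornerE ?addr0 ?mulr1.
rewrite horner_coef0; have -> : P i j = ((P i j)`_0)%:P; last by rewrite hornerC coefC.
apply/polyP => -[|k]; rewrite coefC //=.
have := congr1 (fun q : {poly F} => q`_k) d0; rewrite coef0 coef_deriv.
move=> /eqP; rewrite -mulr_natr mulf_eq0 => /orP[/eqP//|].
by rewrite ((pcharf0P F).1 charF).
Qed.

End PolynomialFamilies.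

Definition unip (R : comNzRingType) (N : nat) (g : 'M[R]_N.+1) : Prop :=
  is_trig_mx g /\ forall i, g i i = 1.

Section Unitriangular.
Variables (R : comNzRingType) (N : nat).
Notation M := 'M[R]_N.+1.
Implicit Types X Y g h : M.

Definition strict_lower X := forall i j : 'I_N.+1, (i <= j)%N -> X i j = 0.

Lemma strict_lowerP g : unip g <-> strict_lower (g - 1).
Proof.
split=> [[/is_trig_mxP gt g1] i j ij|h].
  rewrite !mxE; case: eqVneq ij => [->|ne] ij; first by rewrite g1 subrr.
  by rewrite gt ?subrr // ltn_neqAle ij andbT.
split=> [|i].
  apply/is_trig_mxP => i j ij; have := h i j (ltnW ij).
  rewrite !mxE (_ : (i == j) = false) ?subr0 //.
  by apply/eqP => e; rewrite e ltnn in ij.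
by have := h i i (leqnn _); rewrite !mxE eqxx => /eqP; rewrite subr_eq0 => /eqP.
Qed.

Lemma strict_lowerD X Y : strict_lower X -> strict_lower Y -> strict_lower (X + Y).
Proof. by move=> hX hY i j ij; rewrite mxE hX // hY // addr0. Qed.

Lemma strict_lowerM X Y : strict_lower X -> strict_lower Y -> strict_lower (X * Y).
Proof.
move=> hX hY i j ij; rewrite -mulmxE mxE big1 // => k _.
have [ik|ki] := leqP i k; first by rewrite hX ?mul0r.
by rewrite hY ?mulr0 //; apply: leq_trans (ltnW ki) ij.
Qed.

Lemma strict_lower0 : strict_lower 0.
Proof. by move=> i j _; rewrite mxE. Qed.

Lemma strict_lowerZ a X : strict_lower X -> strict_lower (a *: X).
Proof. by move=> hX i j ij; rewrite mxE hX ?mulr0. Qed.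

Lemma strict_lowerX X k : strict_lower X -> strict_lower (X ^+ k.+1).
Proof.
move=> hX; elim: k => [|k IH]; first by rewrite expr1.
by rewrite exprS; apply: strict_lowerM.
Qed.

Lemma strict_lower_sum (I : Type) (r : seq I) (P : pred I) (f : I -> M) :
  (forall i, P i -> strict_lower (f i)) -> strict_lower (\sum_(i <- r | P i) f i).
Proof.
by move=> h; apply: big_ind => //; [exact: strict_lower0|exact: strict_lowerD].
Qed.

Lemma strict_lower_nilp X k : strict_lower X -> (N < k)%N -> X ^+ k = 0.
Proof.
move=> hX; suff h l : forall i j : 'I_N.+1, (i < j + l)%N -> (X ^+ l) i j = 0.
  move=> Nk; apply/matrixP => i j; rewrite h ?mxE //.
  by apply: leq_trans (leq_addl _ _); apply: leq_trans (ltn_ord i) Nk.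
elim: l => [|l IH] i j ij.
  rewrite expr0 !mxE (_ : (i == j) = false) //.
  by apply/eqP => e; rewrite e addn0 ltnn in ij.
rewrite exprS -mulmxE mxE big1 // => r _.
have [ir|ri] := leqP i r; first by rewrite hX ?mul0r.
by rewrite IH ?mulr0 //; lia.
Qed.

Lemma unip1 : unip (1 : M).
Proof. by apply/strict_lowerP; rewrite subrr; exact: strict_lower0. Qed.

Lemma unipM g h : unip g -> unip h -> unip (g * h).
Proof.
move=> /strict_lowerP hg /strict_lowerP hh; apply/strict_lowerP.
have -> : g * h - 1 = (g - 1) * (h - 1) + ((g - 1) + (h - 1)).
  by rewrite mulrBl mulrBr mulr1 mul1r [g - 1 + _]addrC addrA subrK addrA subrK.
by apply: strict_lowerD; [exact: strict_lowerM|exact: strict_lowerD].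
Qed.

Lemma unipX g k : unip g -> unip (g ^+ k).
Proof.
move=> hg; elim: k => [|k IH]; first exact: unip1.
by rewrite exprS; exact: unipM.
Qed.

End Unitriangular.

Lemma unip_unit (R : comUnitRingType) (N : nat) (g : 'M[R]_N.+1) :
  unip g -> g \is a GRing.unit.
Proof.
move=> [gt g1]; rewrite -[_ \is a _]/(g \in unitmx) unitmxE det_trig //.
by rewrite big1 ?unitr1.
Qed.

Lemma unip_map (R S : comNzRingType) (f : {rmorphism R -> S}) (N : nat)
  (g : 'M[R]_N.+1) : unip g -> unip (map_mx f g).
Proof.
move=> [/is_trig_mxP gt g1]; split=> [|i]; last by rewrite mxE g1 rmorph1.
by apply/is_trig_mxP => i j ij; rewrite mxE gt ?rmorph0.
Qed.

Lemma sum_ord_trunc (V : nmodType) (f : nat -> V) (a b : nat) :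
  (forall i, (a <= i)%N -> f i = 0) -> (forall i, (b <= i)%N -> f i = 0) ->
  \sum_(i < a) f i = \sum_(i < b) f i.
Proof.
wlog ab : a b / (a <= b)%N.
  by move=> w ha hb; case/orP: (leq_total a b) => /w h; [|apply/esym]; exact: h.
move=> ha _; rewrite -!(big_mkord xpredT f) (big_cat_nat (leq0n a) ab) //=.
rewrite [X in _ = _ + X]big1_seq ?addr0 // => i /=.
by rewrite mem_index_iota => /andP[ai _]; exact: ha.
Qed.

(** * Powers and logarithms of unipotent matrices *)

Section UnipotentPowers.
Variables (F : fieldType) (N : nat).
Hypothesis charF : [pchar F] =i pred0.
Notation M := 'M[F]_N.+1.
Implicit Types g h u : M.

Let natr0 k : (k%:R == 0 :> F) = (k == 0)%N := (pcharf0P F).1 charF k.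

Definition binomial_poly (l : nat) : {poly F} :=
  (l`!%:R)^-1 *: \prod_(i < l) ('X - i%:R%:P).

Lemma horner_binomial_poly l a :
  (binomial_poly l).[a] = (\prod_(i < l) (a - i%:R)) / l`!%:R.
Proof.
rewrite hornerZ mulrC horner_prod; congr (_ / _).
by apply: eq_bigr => i _; rewrite !hornerE.
Qed.

Lemma binomial_poly_nat l k : (binomial_poly l).[k%:R] = 'C(k, l)%:R.
Proof.
have l0 : l`!%:R != 0 :> F by rewrite natr0 -lt0n fact_gt0.
apply: (mulIf l0); rewrite -natrM bin_ffact horner_binomial_poly mulfVK //.
have [lk|kl] := leqP l k.
  rewrite ffact_prod natr_prod; apply: eq_bigr => i _.
  by rewrite natrB // (leq_trans _ lk) // ltnW.
rewrite ffact_small //; apply/eqP/prodf_eq0.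
by exists (Ordinal kl) => //; rewrite subrr.
Qed.

(* One term more than needed, so that the linear term is present when [N = 0]. *)
Definition ulog g : M := \sum_(l < N.+2) (binomial_poly l)`_1 *: (g - 1) ^+ l.

Lemma unipotent_powE g a : unip g ->
  unipotent_pow g a = \sum_(l < N.+2) (binomial_poly l).[a] *: (g - 1) ^+ l.
Proof.
move=> /strict_lowerP hg; rewrite big_ord_recr /= strict_lower_nilp // scaler0.
by rewrite addr0; apply: eq_bigr => l _; rewrite horner_binomial_poly.
Qed.

Lemma unipotent_pow_nat g k : unip g -> unipotent_pow g k%:R = g ^+ k.
Proof.
move=> hg; rewrite unipotent_powE //.
(* Both truncations are harmless: beyond the matrix size the power of [g - 1] vanishes, beyond [k]
   the binomial coefficient does. What remains is the binomial theorem for [(g - 1) + 1]. *)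
rewrite (@sum_ord_trunc _ (fun l => (binomial_poly l).[k%:R] *: (g - 1) ^+ l)
  N.+2 k.+1).
- rewrite -{2}[g](subrK 1) exprD1n; apply: eq_bigr => l _.
  by rewrite binomial_poly_nat scaler_nat.
- move=> i Ni; rewrite strict_lower_nilp ?scaler0 //; first exact/strict_lowerP.
  by apply: leq_trans Ni.
- by move=> i ki; rewrite binomial_poly_nat bin_small ?scale0r.
Qed.

Lemma unipotent_pow0 g : unip g -> unipotent_pow g 0 = 1.
Proof. by move=> hg; rewrite -[0]/(0%:R) unipotent_pow_nat ?expr0. Qed.

Lemma unipotent_pow1 g : unip g -> unipotent_pow g 1 = g.
Proof. by move=> hg; rewrite -[1]/(1%:R) unipotent_pow_nat ?expr1. Qed.

Lemma pjet_upow g : unip g -> pjet (unipotent_pow g) 1 (ulog g).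
Proof.
move=> hg.
have h : pjet (unipotent_pow g) (\sum_(l < N.+2) (binomial_poly l)`_0 *: (g - 1) ^+ l)
    (ulog g).
  have := @pjet_sum F N _ (index_enum 'I_N.+2)
    (fun l a => (binomial_poly l).[a] *: (g - 1) ^+ l) _ _
    (fun l => pjetZ (binomial_poly l) (pjet_const ((g - 1) ^+ l))).
  under [X in pjet _ _ X]eq_bigr do rewrite scaler0 add0r.
  by apply: pjet_eq => a; rewrite unipotent_powE.
by have := pjet0 h; rewrite unipotent_pow0 // => ->.
Qed.

Lemma polyfam_upow g : unip g -> polyfam (unipotent_pow g).
Proof. by move=> hg; exact: pjet_polyfam (pjet_upow hg). Qed.

Lemma polyfam_upow_scale g c : unip g -> polyfam (fun a => unipotent_pow g (c * a)).
Proof. by move=> hg; exact: pjet_polyfam (pjet_comp_scale c (pjet_upow hg)). Qed.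

Lemma polyfam_shift (f : F -> M) b : polyfam f -> polyfam (fun a => f (b + a)).
Proof. by move=> hf; have [B hB] := pjet_shift b hf; exists (f b), B. Qed.

(** The identity is polynomial in each exponent separately. It is extended from natural numbers to
    the field first in the second exponent, with the first one natural, and then in the first. *)
Lemma unipotent_powD g a b : unip g ->
  unipotent_pow g (a + b) = unipotent_pow g a * unipotent_pow g b.
Proof.
move=> hg; have hp := polyfam_upow hg.
have h1 (k : nat) c : unipotent_pow g (k%:R + c) = unipotent_pow g k%:R * unipotent_pow g c.
  apply: (@polyfam_eqP _ _ charF (fun c => unipotent_pow g (k%:R + c))
    (fun c => unipotent_pow g k%:R * unipotent_pow g c)).
  - exact: polyfam_shift.
  - exact: polyfamM (polyfam_const _) hp.
  - by move=> l /=; rewrite -natrD !unipotent_pow_nat // exprD.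
apply: (@polyfam_eqP _ _ charF (fun a => unipotent_pow g (a + b))
  (fun a => unipotent_pow g a * unipotent_pow g b)).
- by apply: polyfam_eq (polyfam_shift b hp) => c; rewrite addrC.
- exact: polyfamM hp (polyfam_const _).
- by move=> k /=; rewrite h1.
Qed.

Lemma unipotent_powN g a : unip g ->
  unipotent_pow g (- a) = (unipotent_pow g a)^-1.
Proof.
move=> hg; have e : unipotent_pow g a * unipotent_pow g (- a) = 1.
  by rewrite -unipotent_powD // subrr unipotent_pow0.
have [u _] : unipotent_pow g a \is a GRing.unit /\ True.
  split=> //; apply/unitrP; exists (unipotent_pow g (- a)); split=> //.
  by rewrite -unipotent_powD // addNr unipotent_pow0.
by rewrite -[LHS](mulKr u) e mulr1.
Qed.

Lemma unip_upow g a : unip g -> unip (unipotent_pow g a).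
Proof.
move=> hg; apply/strict_lowerP; rewrite unipotent_powE // big_ord_recl.
have -> : binomial_poly 0 = 1 by rewrite /binomial_poly big_ord0 fact0 invr1 scale1r.
rewrite hornerC scale1r expr0 addrAC subrr add0r.
apply: strict_lower_sum => l _; apply: strict_lowerZ; apply: strict_lowerX.
exact/strict_lowerP.
Qed.

Lemma unipV g : unip g -> unip g^-1.
Proof.
by move=> hg; rewrite -{1}(unipotent_pow1 hg) -unipotent_powN //; exact: unip_upow.
Qed.

Lemma unipotent_pow_scale g a (k : nat) : unip g ->
  unipotent_pow g (a * k%:R) = unipotent_pow g a ^+ k.
Proof.
move=> hg; elim: k => [|k IH]; first by rewrite mulr0 unipotent_pow0.
by rewrite -natr1 mulrDr mulr1 unipotent_powD // IH exprSr.
Qed.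

Lemma unipotent_powM g a b : unip g ->
  unipotent_pow g (a * b) = unipotent_pow (unipotent_pow g a) b.
Proof.
move=> hg; apply: (@polyfam_eqP _ _ charF (fun b => unipotent_pow g (a * b))
  (unipotent_pow (unipotent_pow g a))).
- exact: polyfam_upow_scale.
- exact/polyfam_upow/unip_upow.
- move=> k /=; rewrite unipotent_pow_scale // unipotent_pow_nat //.
  exact: unip_upow.
Qed.

Lemma conjrX u g (k : nat) : u \is a GRing.unit ->
  (u * g * u^-1) ^+ k = u * g ^+ k * u^-1.
Proof.
move=> hu; elim: k => [|k IH]; first by rewrite !expr0 mulr1 mulrV.
by rewrite !exprS IH !mulrA mulrVK // -!mulrA.
Qed.

Lemma unipJ u g : unip u -> unip g -> unip (u * g * u^-1).
Proof. by move=> hu hg; apply: unipM (unipV hu); exact: unipM. Qed.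

Lemma unipotent_powJ u g a : unip u -> unip g ->
  unipotent_pow (u * g * u^-1) a = u * unipotent_pow g a * u^-1.
Proof.
move=> hu hg; apply: (@polyfam_eqP _ _ charF (unipotent_pow (u * g * u^-1))
  (fun a => u * unipotent_pow g a * u^-1)).
- exact/polyfam_upow/unipJ.
- by apply: polyfamM (polyfam_const _); apply: polyfamM (polyfam_const _) _;
     exact: polyfam_upow.
- move=> k /=; rewrite !unipotent_pow_nat ?conjrX //; first exact: unip_unit.
  exact: unipJ.
Qed.

Lemma polyfam_ulog (f : F -> M) : polyfam f -> polyfam (fun b => ulog (f b)).
Proof.
move=> hf; apply: polyfam_sum => l.
have := polyfamZ ((binomial_poly l)`_1)%:P (polyfamX l (polyfamB hf (polyfam_const 1))).
by apply: polyfam_eq => b; rewrite hornerC.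
Qed.

(** To first order at the identity only the term of degree 1 of the logarithm contributes, and its
    coefficient is 1. Thus the tangent vector of a curve through 1 can be computed after taking
    logarithms. *)
Lemma pjet_ulog (f : F -> M) B : pjet f 1 B -> pjet (fun a => ulog (f a)) 0 B.
Proof.
move=> hf.
have h1 : pjet (fun a => f a - 1) 0 B.
  by have := pjetD hf (pjet_const (- 1)); rewrite subrr addr0.
have hX l : pjet (fun a => (f a - 1) ^+ l) (0 ^+ l) (if l == 1%N then B else 0).
  elim: l => [|l IH]; first by have := pjet_const (1 : M); apply: pjet_eq.
  have := pjetM h1 IH; rewrite -exprS mul0r add0r.
  have -> : B * 0 ^+ l = if l.+1 == 1%N then B else 0.
    by case: l {IH} => [|l]; rewrite ?expr0 ?mulr1 // expr0n mulr0.
  by apply: pjet_eq => a; rewrite exprS.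
have := @pjet_sum F N _ (index_enum 'I_N.+2) _ _ _
  (fun l : 'I_N.+2 => pjetZ (((binomial_poly l)`_1)%:P) (hX l)).
have -> : \sum_(l < N.+2) ((binomial_poly l)`_1)%:P`_0 *: 0 ^+ l = 0 :> M.
  rewrite big_ord_recl big1 ?addr0 => [|l _]; last by rewrite expr0n scaler0.
  rewrite coefC /= /binomial_poly big_ord0 fact0 invr1 scale1r coefC /=.
  by rewrite scale0r.
have -> : \sum_(l < N.+2) (((binomial_poly l)`_1)%:P`_0 *: (if l == 1%N :> nat then B else 0) +
    ((binomial_poly l)`_1)%:P`_1 *: 0 ^+ l) = B.
  rewrite !big_ord_recl big1 => [|l _]; last first.
    by rewrite scaler0 coefC /= scale0r addr0.
  rewrite /= !coefC /= !scale0r scaler0 addr0 add0r addr0 addr0.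
  rewrite /binomial_poly big_ord_recl big_ord0 mulr1 subr0 factS fact0 muln1 invr1 scale1r.
  by rewrite coefX scale1r.
by apply: pjet_eq => a; rewrite /ulog; apply: eq_bigr => l _; rewrite hornerC.
Qed.

(** The curve with value [unipotent_pow g (a * b)] at [b] has two descriptions, as a rescaled curve
    and as the powers of [unipotent_pow g a]; their linear terms coincide. *)
Lemma ulog_upow g a : unip g -> ulog (unipotent_pow g a) = a *: ulog g.
Proof.
move=> hg; have h1 := pjet_upow (unip_upow a hg).
have h2 := pjet_comp_scale a (pjet_upow hg).
have := pjet_eq (fun b => unipotent_powM a b hg) h2.
by move=> h3; have [_] := pjet_uniq charF h1 h3.
Qed.

(** The curve g^a h^(-a) has zero derivative at 0 when the logarithms agree. Its shift by [b] is g^b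
    times the curve times h^(-b), so the derivative is zero everywhere and the curve is constantly
    1. *)
Lemma ulog_inj g h : unip g -> unip h -> ulog g = ulog h -> g = h.
Proof.
move=> hg hh e.
pose f a := unipotent_pow g a * unipotent_pow h (- a).
have jN : pjet (fun a => unipotent_pow h (- a)) 1 (- ulog h).
  have := pjet_comp_scale (-1) (pjet_upow hh); rewrite scaleN1r.
  by apply: pjet_eq => a; rewrite mulN1r.
have jf : pjet f 1 0.
  by have := pjetM (pjet_upow hg) jN; rewrite !mul1r mulr1 e addNr.
have hf : forall a, f a = f 0.
  apply: polyfam_deriv0 => //; last exact: pjet_polyfam jf.
  move=> b B hB.
  have := pjetM (pjetM (pjet_const (unipotent_pow g b)) jf)
                (pjet_const (unipotent_pow h (- b))).
  rewrite !(mulr0, mul0r, addr0, mulr1) => /(pjet_eq (g := fun a => f (b + a))) h0.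
  have {}h0 := h0 _; have [|_ //] := pjet_uniq charF hB (h0 _).
  move=> a; rewrite /f unipotent_powD // opprD [- b + _]addrC unipotent_powD //.
  by rewrite !mulrA.
have := hf 1; rewrite (pjet0 jf) /f unipotent_powN // !unipotent_pow1 // => eg.
by rewrite -[g](mulrVK (unip_unit hh)) eg mul1r.
Qed.

End UnipotentPowers.

Lemma map_unipotent_pow (F F' : fieldType) (f : {rmorphism F -> F'}) (N : nat)
    (g : 'M[F]_N.+1) (a : F) :
  map_mx f (unipotent_pow g a) = unipotent_pow (map_mx f g) (f a).
Proof.
rewrite /unipotent_pow raddf_sum; apply: eq_bigr => k _.
rewrite /= map_mxZ rmorphXn rmorphB rmorph1 fmorph_div rmorph_nat rmorph_prod.
congr (_ / _ *: _); apply: eq_bigr => i _.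
by rewrite rmorphB rmorph_nat.
Qed.

Lemma map_ulog (F F' : fieldType) (f : {rmorphism F -> F'}) (N : nat)
    (g : 'M[F]_N.+1) :
  map_mx f (ulog g) = ulog (map_mx f g).
Proof.
rewrite /ulog raddf_sum; apply: eq_bigr => k _.
rewrite /= map_mxZ rmorphXn rmorphB rmorph1 -coef_map; congr (_`__ *: _).
rewrite /binomial_poly map_polyZ fmorphV rmorph_nat rmorph_prod.
by under eq_bigr do rewrite rmorphB /= map_polyX map_polyC /= rmorph_nat.
Qed.

(** * Mal'cev coordinates along a flag *)

Section SubgroupFacts.
Variable A : unitRingType.
Implicit Types H S : set A.

Lemma subgroup_unit H g : subgroup H -> H g -> g \is a GRing.unit.
Proof. by case=> h _ _ _ /h. Qed.

Lemma subgroup1 H : subgroup H -> H 1.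
Proof. by case. Qed.

Lemma subgroupM H g h : subgroup H -> H g -> H h -> H (g * h).
Proof. by case=> _ _ + _ => h1; exact: h1. Qed.

Lemma subgroupV H g : subgroup H -> H g -> H g^-1.
Proof. by case=> _ _ _; exact. Qed.

Lemma subgroupX H g (k : nat) : subgroup H -> H g -> H (g ^+ k).
Proof.
move=> sH hg; elim: k => [|k IH]; first by rewrite expr0; exact: subgroup1.
by rewrite exprS; exact: subgroupM.
Qed.

Lemma subgroupXz H g (k : int) : subgroup H -> H g -> H (g ^ k).
Proof.
move=> sH hg; case: k => k; first exact: subgroupX.
by apply: subgroupV => //; exact: subgroupX.
Qed.

Lemma generated_sub H S : subgroup H -> S `<=` H -> generated_subgroup S `<=` H.
Proof. by move=> sH SH g; exact. Qed.

Lemma sub_generated S : S `<=` generated_subgroup S.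
Proof. by move=> g Sg B [_]; exact. Qed.

Lemma subgroup_generated S : S `<=` [set g | g \is a GRing.unit] ->
  subgroup (generated_subgroup S).
Proof.
move=> hS; have sU : subgroup [set g : A | g \is a GRing.unit].
  split=> //=; first exact: unitr1.
  - by move=> g h /= hg hh; rewrite unitrMl.
  - by move=> g; rewrite unitrV.
split.
- exact: generated_sub.
- by move=> B [sB _]; exact: subgroup1.
- by move=> g h hg hh B hB; case: (hB) => sB _; apply: subgroupM => //;
    [exact: hg|exact: hh].
- by move=> g hg B hB; case: (hB) => sB _; apply: subgroupV => //; exact: hg.
Qed.

(** Modulo the subgroup [H], which [w] normalises, [g * w] and [w] are the same element, so their
    powers agree modulo [H]. *)
Lemma norm_pow H g w (k : nat) : subgroup H -> w \is a GRing.unit ->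
  (forall h, H h -> H (w * h * w^-1)) -> H g -> H ((g * w) ^+ k * w ^- k).
Proof.
move=> sH uw nw hg; elim: k => [|k IH].
  by rewrite !expr0 invr1 mulr1; exact: subgroup1.
have -> : (g * w) ^+ k.+1 * w ^- k.+1 = g * (w * ((g * w) ^+ k * w ^- k) * w^-1).
  rewrite exprS [w ^+ k.+1]exprS invrM ?unitrX //.
  by rewrite -!mulrA.
by apply: subgroupM => //; exact: nw.
Qed.

End SubgroupFacts.

Section Flag.
Variables (F : fieldType) (N : nat).
Hypothesis charF : [pchar F] =i pred0.
Notation M := 'M[F]_N.+1.
Variables (n : nat) (y : nat -> M).
Hypothesis y_unip : forall i, unip (y i).
Hypothesis y_comm : forall i j, (i < n)%N -> (j < n)%N ->
  generated_subgroup [set y k | k in [set k | (k < i)%N]]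
    (y j * y i * (y j)^-1 * (y i)^-1).

Definition ypow i a := unipotent_pow (y i) a.
Definition word i (a : nat -> F) : M := \prod_(0 <= j < i) ypow j (a j).
(** The flag is a set of words rather than a generated subgroup, so that coordinates are available
    from the start; closure under products is proved in [flag_inv]. *)
Definition flag i : set M := [set g | exists a, g = word i a].

Lemma word0 a : word 0 a = 1.
Proof. by rewrite /word big_nil. Qed.

Lemma wordS i a : word i.+1 a = word i a * ypow i (a i).
Proof. by rewrite /word big_nat_recr. Qed.

Lemma eq_word i a b : (forall j, (j < i)%N -> a j = b j) -> word i a = word i b.
Proof.
by move=> h; apply: eq_big_nat => j /andP[_ ji]; rewrite h.
Qed.

Lemma unip_ypow i a : unip (ypow i a).
Proof. exact: unip_upow. Qed.

Lemma ypow_unit i a : ypow i a \is a GRing.unit.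
Proof. exact/unip_unit/unip_ypow. Qed.

Lemma ypowV i a : (ypow i a)^-1 = ypow i (- a).
Proof. by rewrite /ypow unipotent_powN. Qed.

Lemma ypowD i a b : ypow i (a + b) = ypow i a * ypow i b.
Proof. by rewrite /ypow unipotent_powD. Qed.

Lemma ypow0 i : ypow i 0 = 1.
Proof. by rewrite /ypow unipotent_pow0. Qed.

Lemma ypow1 i : ypow i 1 = y i.
Proof. by rewrite /ypow unipotent_pow1. Qed.

Lemma word_zero i a : (forall j, (j < i)%N -> a j = 0) -> word i a = 1.
Proof.
by move=> h; rewrite (eq_word (b := fun=> 0)) // /word big1 // => j _; exact: ypow0.
Qed.

Lemma word_pad i k a : (i <= k)%N ->
  word i a = word k (fun l => if (l < i)%N then a l else 0).
Proof.
move=> ik; rewrite /word (big_cat_nat (leq0n i) ik) /=.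
rewrite [X in _ = _ * X]big1_seq ?mulr1 => [|l /=].
  by apply: eq_big_nat => l /andP[_ ->].
by rewrite mem_index_iota => /andP[il _]; rewrite ltnNge il; exact: ypow0.
Qed.

Lemma unip_word i a : unip (word i a).
Proof.
elim: i => [|i IH]; first by rewrite word0; exact: unip1.
by rewrite wordS; apply: unipM => //; exact: unip_ypow.
Qed.

Lemma flag_unip i g : flag i g -> unip g.
Proof. by case=> a ->; exact: unip_word. Qed.

Lemma flag_word i a : flag i (word i a).
Proof. by exists a. Qed.

Lemma flagSP i g : flag i.+1 g <-> exists h a, flag i h /\ g = h * ypow i a.
Proof.
split=> [[a ->]|[_ [b [[a ->] ->]]]].
  by exists (word i a), (a i); split; [exists a|rewrite wordS].
exists (fun j => if j == i then b else a j); rewrite wordS eqxx.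
by congr (_ * _); apply: eq_word => j ji; rewrite ltn_eqF.
Qed.

Lemma flag_widen i k g : (i <= k)%N -> flag i g -> flag k g.
Proof.
elim: k => [|k IH]; first by rewrite leqn0 => /eqP ->.
rewrite leq_eqVlt ltnS => /orP[/eqP <- //|ik] hg; apply/flagSP.
by exists g, 0; rewrite ypow0 mulr1; split=> //; exact: IH.
Qed.

Variables (r : nat) (c : nat -> 'cV[F]_(N.+1 * N.+1)).
Hypothesis rn : (r <= n)%N.
Hypothesis c_diag : forall i, (i < r)%N -> mxvec (ulog (y i)) *m c i = 1%:M.
Hypothesis c_low : forall i j, (i < r)%N -> (j < i)%N ->
  mxvec (ulog (y j)) *m c i = 0.

(** The [i]-th Mal'cev coordinate on [flag i.+1], as a linear functional of the logarithm. The
    functionals are assumed only below a level [r]: over the rationals they are built one at a time,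
    and the theory at level [r] is what yields the next one. *)
Definition phi i g : F := (mxvec (ulog g) *m c i) 0 0.
Definition logspan i : 'M[F]_(i, N.+1 * N.+1) := \matrix_(j < i) mxvec (ulog (y j)).

Lemma sub_logspan i j : (j < i)%N -> (mxvec (ulog (y j)) <= logspan i)%MS.
Proof.
move=> ji; have -> : mxvec (ulog (y j)) = row (Ordinal ji) (logspan i) by rewrite rowK.
exact: row_sub.
Qed.

Lemma logspan_widen i k : (i <= k)%N -> (logspan i <= logspan k)%MS.
Proof.
move=> ik; apply/row_subP => j; rewrite rowK; apply: sub_logspan.
exact: leq_trans (ltn_ord j) ik.
Qed.

Lemma logspan_c i (v : 'rV_(N.+1 * N.+1)) : (i < r)%N ->
  (v <= logspan i)%MS -> v *m c i = 0.
Proof.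
move=> ir /submxP[D ->]; rewrite -mulmxA (_ : logspan i *m c i = 0) ?mulmx0 //.
by apply/row_matrixP => j; rewrite row_mul rowK c_low ?row0.
Qed.

(** The four properties support each other and are proved by one induction. Stability under
    polynomial families replaces Zariski closedness: it extends to all exponents what is known for
    natural ones. The inclusion of logarithms in [logspan i] is what makes [phi i] vanish on
    [flag i]. *)
Definition flag_inv i :=
  [/\ subgroup (flag i),
      forall f, polyfam f -> (forall k : nat, flag i (f k%:R)) -> forall a, flag i (f a),
      forall g, flag i g -> (mxvec (ulog g) <= logspan i)%MS &
      forall j b g, (j < n)%N -> flag i g -> flag i (ypow j b * g * (ypow j b)^-1)].

Lemma flag_generated i : subgroup (flag i) ->
  generated_subgroup [set y k | k in [set k | (k < i)%N]] `<=` flag i.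
Proof.
move=> sH; apply: generated_sub => // _ [k /= ki <-].
apply: (@flag_widen k.+1) => //; apply/flagSP; exists 1, 1.
by rewrite ypow1 mul1r; split=> //; exists (fun=> 0); rewrite /word big1 // => j _; rewrite ypow0.
Qed.

Lemma polyfam_ypowN i : polyfam (fun a => ypow i (- a)).
Proof.
have := polyfam_upow_scale charF (-1) (y_unip i); apply: polyfam_eq => a.
by rewrite mulN1r.
Qed.

(** The hypothesis on commutators concerns exponents 1 only. Normality gives natural exponents for
    [y j], a polynomial family gives all of them; then [norm_pow] and a second polynomial family do
    the same for the exponent of [y i]. *)
Lemma flag_inv_comm i : flag_inv i -> (i < n)%N -> forall j a b, (j < n)%N ->
  flag i (ypow j b * ypow i a * (ypow j b)^-1 * (ypow i a)^-1).
Proof.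
move=> [sH pH _ nH] hi j a b hj.
have uy k : y k \is a GRing.unit by rewrite -ypow1 ypow_unit.
have h1 (k : nat) : flag i (y j ^+ k * y i * y j ^- k * (y i)^-1).
  elim: k => [|k IH].
    by rewrite expr0 invr1 mul1r mulr1 mulrV //; exact: subgroup1.
  have -> : y j ^+ k.+1 * y i * y j ^- k.+1 * (y i)^-1 =
     (ypow j 1 * (y j ^+ k * y i * y j ^- k * (y i)^-1) * (ypow j 1)^-1) *
     (y j * y i * (y j)^-1 * (y i)^-1).
    rewrite ypow1 [in LHS]exprS invrM ?unitrX //.
    by rewrite !mulrA !mulrVK.
  apply: subgroupM => //; first exact: nH.
  by apply: flag_generated => //; exact: y_comm.
have h2 : forall b, flag i (ypow j b * y i * (ypow j b)^-1 * (y i)^-1).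
  apply: pH => [|k]; last by rewrite /ypow unipotent_pow_nat.
  apply: polyfamM (polyfam_const _); apply: polyfamM.
    by apply: polyfamM (polyfam_const _); exact: polyfam_upow.
  by have := polyfam_ypowN j; apply: polyfam_eq => a'; rewrite ypowV.
set v := ypow j b * y i * (ypow j b)^-1.
have uv : unip v by apply: unipJ => //; exact: unip_ypow.
have h3 : forall a, flag i (unipotent_pow v a * ypow i (- a)).
  apply: pH => [|k].
    by apply: polyfamM (polyfam_ypowN i); exact: polyfam_upow.
  rewrite -ypowV /ypow !unipotent_pow_nat //.
  have -> : v = v * (y i)^-1 * y i by rewrite mulrVK.
  apply: norm_pow => //; last exact: h2.
  by move=> h hh; rewrite -ypow1; exact: nH.
by have := h3 a; rewrite unipotent_powJ // -?ypowV //; exact: unip_ypow.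
Qed.

(** With [u = g * ypow i b], the curve u^a y_i^(-ba) lies in [flag i] at natural [a] by [norm_pow],
    and its tangent vector at 0 is the difference of logarithms in the statement. *)
Lemma flag_inv_ulog i g b : flag_inv i -> (i < n)%N -> flag i g ->
  (mxvec (ulog (g * ypow i b) - b *: ulog (y i)) <= logspan i)%MS.
Proof.
move=> [sH pH lH nH] hi hg; set u := g * ypow i b.
have uu : unip u by apply: unipM; [exact: flag_unip hg|exact: unip_ypow].
pose f a := unipotent_pow u a * ypow i (- b * a).
have jf : pjet f 1 (ulog u - b *: ulog (y i)).
  have := pjetM (pjet_upow charF uu) (pjet_comp_scale (- b) (pjet_upow charF (y_unip i))).
  by rewrite !mul1r mulr1 scaleNr addrC.
have hf (k : nat) : flag i (f k%:R).
  rewrite /f mulNr -ypowV /ypow unipotent_pow_scale // unipotent_pow_nat // -/(ypow i b).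
  apply: norm_pow => //; first exact: ypow_unit.
  by move=> h hh; exact: nH.
by case: (polyfam_linear charF (pjet_ulog jf) (fun k => lH _ (hf k))).
Qed.

Lemma phi_ypow i g b : flag_inv i -> (i < r)%N -> flag i g -> phi i (g * ypow i b) = b.
Proof.
move=> iH ir hg; have hn := leq_trans ir rn.
have /(logspan_c ir) := flag_inv_ulog b iH hn hg.
rewrite linearB linearZ mulmxBl -scalemxAl (c_diag ir) => /eqP.
rewrite subr_eq0 => /eqP e; rewrite /phi e.
by rewrite !mxE mulr1.
Qed.

Lemma polyfam_phi i (f : F -> M) : polyfam f ->
  exists q : {poly F}, forall a, phi i (f a) = q.[a].
Proof.
move=> /polyfam_ulog[A [B [P [hP _ _]]]].
exists ((mxvec P *m map_mx polyC (c i)) 0 0) => a.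
rewrite /phi hP -map_mxvec !mxE -[RHS]/(horner_eval a _) rmorph_sum.
apply: eq_bigr => k _.
by rewrite rmorphM /= !mxE /horner_eval hornerC.
Qed.

Lemma polyfam_ypow_poly i (q : {poly F}) : polyfam (fun a => ypow i q.[a]).
Proof.
have h : polyfam (fun a => \sum_(l < N.+2) ((binomial_poly F l) \Po q).[a] *: (y i - 1) ^+ l).
  by apply: polyfam_sum => l; apply: polyfamZ; exact: polyfam_const.
apply: polyfam_eq h => a; rewrite /ypow unipotent_powE //.
by apply: eq_bigr => l _; rewrite horner_comp.
Qed.

Lemma flag_inv0 : flag_inv 0.
Proof.
have h1 g : flag 0 g -> g = 1 by case=> a ->; rewrite word0.
have h1' : flag 0 1 by exists (fun=> 0); rewrite word0.
split.
- split=> //.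
  + by move=> g /h1 -> /=; exact: unitr1.
  + by move=> g h /h1 -> /h1 ->; rewrite mulr1.
  + by move=> g /h1 ->; rewrite invr1.
- move=> f hf hk a; rewrite (_ : f a = 1) //.
  by apply: (@polyfam_eqP _ _ charF f (fun=> 1)) => // [|k];
    [exact: polyfam_const|rewrite (h1 _ (hk k))].
- move=> g /h1 ->; have -> : ulog 1 = 0 :> M.
    by have := ulog_upow charF 0 (unip1 F N); rewrite scale0r unipotent_pow0 //; exact: unip1.
  by rewrite raddf0 sub0mx.
- by move=> j b g hj /h1 ->; rewrite mulr1 mulrV // ypow_unit.
Qed.

Lemma flag_invS i : flag_inv i -> (i < r)%N -> flag_inv i.+1.
Proof.
move=> iH ir; have hn := leq_trans ir rn; have [sH pH lH nH] := iH.
split.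
- split.
  + by move=> g /flag_unip /unip_unit.
  + by apply: (@flag_widen i) => //; exact: subgroup1.
  + move=> _ _ /flagSP[g [a [hg ->]]] /flagSP[h [b [hh ->]]]; apply/flagSP.
    exists (g * (ypow i a * h * (ypow i a)^-1)), (a + b); split.
      by apply: subgroupM => //; exact: nH.
    by rewrite ypowD !mulrA mulrVK // ypow_unit.
  + move=> _ /flagSP[g [a [hg ->]]]; apply/flagSP.
    exists (ypow i (- a) * g^-1 * (ypow i (- a))^-1), (- a); split.
      by apply: nH => //; exact: subgroupV.
    rewrite mulrVK ?ypow_unit // invrM ?ypowV ?ypow_unit //.
    exact: subgroup_unit hg.
(* The top coordinate of the family is a polynomial [q]. Multiplying by y_i to the power [- q] moves
   the values at natural numbers into [flag i], where the induction hypothesis applies. *)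
- move=> f hf hk a; have [q hq] := polyfam_phi i hf.
  have h1 : forall a, flag i (f a * ypow i ((- q).[a])).
    apply: pH => [|k]; first exact: polyfamM (polyfam_ypow_poly _ _).
    have /flagSP[g [b [hg e]]] := hk k.
    by rewrite hornerN -hq e phi_ypow // -ypowV mulrK // ypow_unit.
  apply/flagSP; exists (f a * ypow i ((- q).[a])), q.[a]; split=> //.
  by rewrite hornerN -ypowV mulrVK // ypow_unit.
- move=> _ /flagSP[g [b [hg ->]]].
  have h := submx_trans (flag_inv_ulog b iH hn hg) (logspan_widen (leqnSn i)).
  rewrite -[ulog _](subrK (b *: ulog (y i))) raddfD /= addmx_sub //.
  by rewrite linearZ /= scalemx_sub // sub_logspan.
- move=> j b _ hj /flagSP[g [a [hg ->]]]; apply/flagSP.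
  exists ((ypow j b * g * (ypow j b)^-1) *
          (ypow j b * ypow i a * (ypow j b)^-1 * (ypow i a)^-1)), a; split.
    by apply: subgroupM => //; [exact: nH|exact: flag_inv_comm].
  by rewrite !mulrA !mulrVK ?ypow_unit.
Qed.

Lemma flag_invP i : (i <= r)%N -> flag_inv i.
Proof.
elim: i => [|i IH] ir; first exact: flag_inv0.
by apply: flag_invS => //; apply: IH; exact: ltnW.
Qed.

Lemma subgroup_flag i : (i <= r)%N -> subgroup (flag i).
Proof. by case/flag_invP. Qed.

Lemma flag_polyfam i f : (i <= r)%N -> polyfam f ->
  (forall k : nat, flag i (f k%:R)) -> forall a, flag i (f a).
Proof. by case/flag_invP => _ h _ _; exact: h. Qed.

Lemma flag_upow i g a : (i <= r)%N -> flag i g -> flag i (unipotent_pow g a).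
Proof.
move=> ir hg; apply: flag_polyfam => //; first exact/polyfam_upow/flag_unip/hg.
move=> k; rewrite unipotent_pow_nat //; last exact: flag_unip hg.
by apply: subgroupX => //; exact: subgroup_flag.
Qed.

Lemma phi_upow i g a : unip g -> phi i (unipotent_pow g a) = a * phi i g.
Proof.
move=> hg; rewrite /phi ulog_upow // linearZ /= -scalemxAl.
by rewrite mxE.
Qed.

Lemma phi_mulr i g b : (i < r)%N -> flag i g -> phi i (g * ypow i b) = b.
Proof. by move=> ir; apply: phi_ypow => //; apply: flag_invP; exact: ltnW. Qed.

Lemma phi_flag i g : (i < r)%N -> flag i g -> phi i g = 0.
Proof. by move=> ir hg; rewrite -[g]mulr1 -(ypow0 i) phi_mulr. Qed.

Lemma flagS_phi i g : (i < r)%N -> flag i.+1 g -> flag i (g * ypow i (- phi i g)).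
Proof.
by move=> ir /flagSP[h [b [hh ->]]]; rewrite phi_mulr // -ypowV mulrK // ypow_unit.
Qed.

Lemma flag_phi0 i g : (i < r)%N -> flag i.+1 g -> phi i g = 0 -> flag i g.
Proof. by move=> ir /(flagS_phi ir) + e; rewrite e oppr0 ypow0 mulr1. Qed.

Lemma flag_normal i j b g : (i <= r)%N -> (j < n)%N -> flag i g ->
  flag i (ypow j b * g * (ypow j b)^-1).
Proof. by case/flag_invP => _ _ _ h hj; exact: h. Qed.

Lemma phiM i g h : (i < r)%N -> flag i.+1 g -> flag i.+1 h ->
  phi i (g * h) = phi i g + phi i h.
Proof.
move=> ir /flagSP[g' [a [hg ->]]] /flagSP[h' [b [hh ->]]].
have sH := subgroup_flag (ltnW ir).
have -> : g' * ypow i a * (h' * ypow i b) =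
    (g' * (ypow i a * h' * (ypow i a)^-1)) * ypow i (a + b).
  by rewrite ypowD !mulrA mulrVK // ypow_unit.
rewrite !phi_mulr //; apply: subgroupM => //; apply: flag_normal => //.
  exact: ltnW.
exact: leq_trans ir rn.
Qed.

Lemma phiV i g : (i < r)%N -> flag i.+1 g -> phi i g^-1 = - phi i g.
Proof.
move=> ir hg; have sH := subgroup_flag ir.
apply/eqP; rewrite -addr_eq0 -phiM //; last exact: subgroupV.
rewrite mulVr ?(subgroup_unit sH) // phi_flag //.
by apply: subgroup1; exact/subgroup_flag/ltnW.
Qed.

(** Conjugation is carried out one factor of the word [g] at a time; each factor changes [h] by an
    element of [flag i], because the generators commute modulo the flag. *)
Lemma flag_conj i k g h : (i < r)%N -> (k <= r)%N -> flag k g -> flag i.+1 h ->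
  flag i.+1 (g * h * g^-1) /\ phi i (g * h * g^-1) = phi i h.
Proof.
move=> ir + [a ->]; elim: k h => [|k IH] h kr hh.
  by rewrite word0 mul1r invr1 mulr1.
have hkn : (k < n)%N by exact: leq_trans kr rn.
rewrite wordS invrM ?ypow_unit //; last exact/unip_unit/unip_word.
have -> : word k a * ypow k (a k) * h * ((ypow k (a k))^-1 * (word k a)^-1) =
  word k a * (ypow k (a k) * h * (ypow k (a k))^-1) * (word k a)^-1.
  by rewrite !mulrA.
have [h1 h2] := IH (ypow k (a k) * h * (ypow k (a k))^-1) (ltnW kr) (flag_normal _ ir hkn hh).
split=> //; rewrite h2; have /flagSP[h' [b [hh' ->]]] := hh.
have -> : ypow k (a k) * (h' * ypow i b) * (ypow k (a k))^-1 =
  (ypow k (a k) * h' * (ypow k (a k))^-1) *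
  (ypow k (a k) * ypow i b * (ypow k (a k))^-1 * (ypow i b)^-1) * ypow i b.
  by rewrite !mulrA !mulrVK ?ypow_unit.
have hn := leq_trans ir rn; have sH := subgroup_flag (ltnW ir).
rewrite !phi_mulr //; apply: subgroupM => //; first exact: (flag_normal _ (ltnW ir)).
by apply: flag_inv_comm => //; exact/flag_invP/ltnW.
Qed.

Fixpoint coords i g : nat -> F :=
  if i is i'.+1 then
    fun j => if j == i' then phi i' g else coords i' (g * ypow i' (- phi i' g)) j
  else fun=> 0.

Lemma coordsK i g : (i <= r)%N -> flag i g -> word i (coords i g) = g.
Proof.
elim: i g => [|i IH] g ir hg; first by case: hg => a ->; rewrite !word0.
have e : g = g * ypow i (- phi i g) * ypow i (phi i g).
  by rewrite -ypowV mulrVK // ypow_unit.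
rewrite wordS /= eqxx [RHS]e; congr (_ * _).
rewrite -[RHS]IH ?(ltnW ir) //; last exact: flagS_phi.
by apply: eq_word => j ji; rewrite ltn_eqF.
Qed.

Lemma wordK i a j : (i <= r)%N -> (j < i)%N -> coords i (word i a) j = a j.
Proof.
elim: i => [//|i IH] ir; rewrite ltnS leq_eqVlt wordS /=.
have e : phi i (word i a * ypow i (a i)) = a i by rewrite phi_mulr //; exists a.
case: eqVneq => [-> _|_ /= ji]; first by rewrite e.
by rewrite e -ypowV mulrK ?ypow_unit // IH // ltnW.
Qed.

Lemma coords_poly i f j : polyfam f -> exists q : {poly F}, forall a, coords i (f a) j = q.[a].
Proof.
elim: i f => [|i IH] f hf /=; first by exists 0 => a; rewrite horner0.
have [q hq] := polyfam_phi i hf.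
case: eqP => _; first by exists q.
have := IH (fun a => f a * ypow i (- q).[a]) (polyfamM hf (polyfam_ypow_poly _ _)).
by case=> q' hq'; exists q' => a; rewrite -hq' hornerN hq.
Qed.

(** With [word_divr] this describes the words of a group whose coordinates above [j] are prescribed:
    they differ by left factors in [flag j.+1], and such a factor translates the [j]-th coordinate
    by its [phi j]. *)
Lemma word_mull j k a d : (j < k)%N -> (k <= r)%N -> flag j.+1 d ->
  exists b, [/\ d * word k a = word k b, b j = a j + phi j d &
                forall l, (j < l)%N -> b l = a l].
Proof.
move=> jk kr hd; have jr := leq_trans jk kr; have sH := subgroup_flag jr.
have h : flag j.+1 (d * word j.+1 a) by apply: subgroupM => //; exists a.
pose b l := if (l <= j)%N then coords j.+1 (d * word j.+1 a) l else a l.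
exists b; split=> [||l jl]; last by rewrite /b leqNgt jl.
  rewrite /word !(big_cat_nat (leq0n j.+1) jk) /= mulrA -!/(word _ _).
  rewrite -{1}(coordsK jr h); congr (_ * _).
    by apply: eq_word => l lj; rewrite /b -ltnS lj.
  by apply: eq_big_nat => l /andP[jl _]; rewrite /b leqNgt jl.
rewrite /b leqnn /= eqxx phiM //; last by exists a.
by rewrite wordS phi_mulr // 1?addrC //; exists a.
Qed.

Lemma word_divr j k a b : (j < k)%N -> (k <= r)%N ->
  (forall l, (j < l)%N -> a l = b l) ->
  flag j.+1 (word k a * (word k b)^-1) /\
  phi j (word k a * (word k b)^-1) = a j - b j.
Proof.
move=> jk kr ab; have jr := leq_trans jk kr; have sH := subgroup_flag jr.
have -> : word k a * (word k b)^-1 = word j.+1 a * (word j.+1 b)^-1.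
  rewrite /word !(big_cat_nat (leq0n j.+1) jk) /= -!/(word _ _).
  set t := \prod_(j.+1 <= i < k) ypow i (a i).
  have -> : \prod_(j.+1 <= i < k) ypow i (b i) = t.
    by apply: eq_big_nat => l /andP[jl _]; rewrite ab.
  have ut : t \is a GRing.unit by apply: rpred_prod => i _; exact: ypow_unit.
  rewrite invrM ?(unip_unit (unip_word _ _)) //.
  by rewrite !mulrA mulrK.
have h a' : flag j.+1 (word j.+1 a') by exists a'.
split; first by apply: subgroupM => //; exact: subgroupV.
rewrite phiM ?phiV //; last exact: subgroupV.
by rewrite !wordS !phi_mulr //; [exists b|exists a].
Qed.

Lemma flag_conj_stable i k g h : (i <= r)%N -> (k <= r)%N -> flag k g -> flag i h ->
  flag i (g * h * g^-1).
Proof.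
case: i => [|i] ir kr hg hh; last by case: (flag_conj ir kr hg hh).
have -> : h = 1 by case: hh => a ->; rewrite word0.
by rewrite mulr1 mulrV ?(unip_unit (flag_unip hg)) //; exact: subgroup1 (subgroup_flag ir).
Qed.

Lemma flag_comm i k g z : (i < r)%N -> (k <= r)%N -> flag k g -> flag i.+1 z ->
  flag i (z * g * z^-1 * g^-1).
Proof.
move=> ir kr hg hz; have sH := subgroup_flag ir.
have [h1 h2] := flag_conj ir kr hg (subgroupV sH hz).
have -> : z * g * z^-1 * g^-1 = z * (g * z^-1 * g^-1) by rewrite !mulrA.
apply: flag_phi0 => //; first exact: subgroupM.
by rewrite phiM // h2 phiV // subrr.
Qed.

Lemma logspan_proj j (v : 'rV_(N.+1 * N.+1)) : (j < r)%N -> (v <= logspan j.+1)%MS ->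
  (v - (v *m c j) 0 0 *: mxvec (ulog (y j)) <= logspan j)%MS.
Proof.
move=> jr /submxP[D ->]; rewrite [D *m _]mulmx_sum_row big_ord_recr /= rowK /=.
set s := \sum_i _; have hs : (s <= logspan j)%MS.
  by apply: summx_sub => i _; rewrite scalemx_sub // rowK; exact: (sub_logspan (ltn_ord i)).
rewrite mulmxDl (logspan_c jr hs) add0r -scalemxAl c_diag // !mxE mulr1.
by rewrite addrK.
Qed.

(* The correction removes the coordinates of the logarithm one at a time, from
   the top of the flag down. *)
Lemma ulog_surj i g : (i <= r)%N -> unip g ->
  (mxvec (ulog g) <= logspan i)%MS -> flag i g.
Proof.
move=> ir ug hg.
suff h d : (d <= i)%N -> exists w, flag i w /\
    (mxvec (ulog w - ulog g) <= logspan (i - d))%MS.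
  have [w [hw]] := h i (leqnn i); rewrite subnn => h0.
  suff <- : w = g by [].
  apply: (ulog_inj charF (flag_unip hw) ug); apply/eqP; rewrite -subr_eq0.
  apply/eqP; apply: (can_inj mxvecK); rewrite raddf0; apply/eqP.
  by have := mxrankS h0; rewrite -mxrank_eq0 => /leq_trans/(_ (rank_leq_row _)); rewrite leqn0.
have sH := subgroup_flag ir.
elim: d => [|d IH] di.
  exists 1; rewrite subn0; split; first exact: subgroup1.
  have [_ _ lH _] := flag_invP ir.
  rewrite raddfB /= addmx_sub // ?eqmx_opp //.
  by apply: lH; exact: subgroup1.
have [w [hw hwg]] := IH (ltnW di).
set j := (i - d.+1)%N; have ej : (i - d = j.+1)%N by rewrite /j; lia.
have ji : (j < i)%N by rewrite -ej; lia.
have jr : (j < r)%N by exact: leq_trans ji ir.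
rewrite ej in hwg.
have [b bE] : exists b, - b = (mxvec (ulog w - ulog g) *m c j) 0 0.
  by exists (- (mxvec (ulog w - ulog g) *m c j) 0 0); rewrite opprK.
have sHj := subgroup_flag (ltnW jr).
have yj a : flag j.+1 (ypow j a).
  by apply/flagSP; exists 1, a; rewrite mul1r; split=> //; exact: subgroup1.
have uw := flag_unip hw.
exists (w * ypow j b); split; first by apply: subgroupM => //; exact: flag_widen (yj b).
(* The Baker-Campbell-Hausdorff formula to first order: the logarithm of the product is the sum of
   the logarithms up to [logspan j]. The error is the tangent vector of a curve inside [flag j]. *)
have key : (mxvec (ulog (w * ypow j b) - b *: ulog (y j) - ulog w) <= logspan j)%MS.
  pose f a := unipotent_pow (w * ypow j b) a * ypow j (- b * a) * unipotent_pow w (- a).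
  have u2 : unip (w * ypow j b) by apply: unipM => //; exact: unip_ypow.
  have jN : pjet (fun a => unipotent_pow w (- a)) 1 (- ulog w).
    have := pjet_comp_scale (-1) (pjet_upow charF uw); rewrite scaleN1r.
    by apply: pjet_eq => a; rewrite mulN1r.
  have jf : pjet f 1 (ulog (w * ypow j b) - b *: ulog (y j) - ulog w).
    have := pjetM (pjetM (pjet_upow charF u2)
       (pjet_comp_scale (- b) (pjet_upow charF (y_unip j)))) jN.
    rewrite !mul1r !mulr1 scaleNr.
    by congr pjet; rewrite addrC; congr (_ - _); rewrite addrC.
  (* At a natural number [k] the curve is (wz)^k z^(-k) w^(-k). Passing from [k] to [k.+1]
     multiplies it by a conjugate of the commutator of z^k and w, which lies in [flag j]. *)
  have hf (k : nat) : flag j (f k%:R).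
    rewrite /f mulNr -ypowV [ypow j (b * k%:R)]/ypow unipotent_pow_scale // unipotent_powN //.
    rewrite !unipotent_pow_nat // -/(ypow j b); set z := ypow j b.
    have uz : z \is a GRing.unit by exact: ypow_unit.
    have uw' := unip_unit uw.
    elim: k => [|k IHk]; first by rewrite !expr0 !invr1 !mulr1; exact: subgroup1.
    have -> : (w * z) ^+ k.+1 * z ^- k.+1 * w ^- k.+1 =
       ((w * z) ^+ k * z ^- k * w ^- k) *
       (w ^+ k * (z ^+ k * w * z ^- k * w^-1) * w ^- k).
      rewrite !mulrA mulrVK ?unitrX // mulrVK ?unitrX //.
      by rewrite !exprSr !invrM ?unitrX // !mulrA mulrK.
    apply: subgroupM => //; apply: (@flag_conj_stable j i) => //.
    - exact: ltnW.
    - exact: subgroupX.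
    - apply: (flag_comm jr ir hw); apply: subgroupX (yj b).
      exact: subgroup_flag.
  have [_ _ lH _] := flag_invP (ltnW jr).
  by case: (polyfam_linear charF (pjet_ulog jf) (fun k => lH _ (hf k))).
have := addmx_sub key (logspan_proj jr hwg); rewrite -bE scaleNr opprK.
congr (_ <= _)%MS; rewrite -linearZ -!linearD; congr mxvec.
by rewrite addrA [X in X + _]addrA subrK addrAC subrK.
Qed.

End Flag.

(** * Mal'cev bases of G(Z) and independence of their logarithms *)

Lemma unipotent_powz (F : fieldType) (N : nat) (charF : [pchar F] =i pred0)
  (g : 'M[F]_N.+1) (k : int) : unip g -> unipotent_pow g k%:~R = g ^ k.
Proof.
move=> hg; case: k => k; first by rewrite -[RHS]/(g ^+ k) -unipotent_pow_nat.
by rewrite NegzE mulrNz unipotent_powN // unipotent_pow_nat.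
Qed.

Lemma generated_map (A B : unitRingType) (f : {rmorphism A -> B}) (S : set A) (T : set B) :
  S `<=` [set g | g \is a GRing.unit] -> subgroup T -> (forall g, S g -> T (f g)) ->
  forall g, generated_subgroup S g -> T (f g).
Proof.
move=> hS sT ST g hg.
suff : [set h : A | h \is a GRing.unit /\ T (f h)] g by case.
apply: (generated_sub _ _ hg) => [|h Sh]; last by split; [exact: hS|exact: ST].
split=> [h []//|||].
- by split; [exact: unitr1|rewrite rmorph1; exact: subgroup1].
- by move=> h k [uh Th] [uk Tk]; split; [rewrite unitrMl|rewrite rmorphM; exact: subgroupM].
- by move=> h [uh Th]; split; [rewrite unitrV|rewrite rmorphV //; exact: subgroupV].
Qed.

(** [D] is the product of the denominators of the coefficients. Without constant term, each monomial
    contains a factor [D], which clears the denominator of its coefficient. *)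
Lemma poly_rat_int (q : {poly rat}) : q.[0] = 0 ->
  exists2 D : nat, (0 < D)%N & forall k : int, q.[(D%:Z * k)%:~R] \is a Num.int.
Proof.
move=> q0; pose D := (\prod_(i < size q) `|denq q`_i|)%N.
have D0 : (0 < D)%N by rewrite prodn_gt0 // => i; rewrite absz_gt0 denq_neq0.
exists D => // k; rewrite horner_coef rpred_sum // => -[i iq] _ /=.
case: i iq => [|i] iq; first by rewrite -horner_coef0 q0 mul0r rpred0.
rewrite exprS {1}intrM [q`__ * _]mulrA [q`__ * _]mulrA rpredM ?rpredX ?intr_int //.
rewrite rpredM ?intr_int //.
rewrite /D (bigD1 (Ordinal iq)) //= PoszM intrM mulrA rpredM ?intr_int //.
rewrite abszE ger0_norm ?denq_ge0 // -{1}[q`__]divq_num_den mulfVK ?intr_int //.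
by rewrite intr_eq0 denq_neq0.
Qed.

Section IntegralMalcev.
Variables (m : nat) (G : unipotentZGroup m) (n : nat) (x : 'I_n -> 'M[int]_m.+1).
Hypothesis hx : malcev_basis G x.

(** Indexing by [nat], with default 1 beyond [n], lets words and flags be cut at any level without
    casts between ordinals. *)
Definition xn (i : nat) : 'M[int]_m.+1 := oapp x 1 (insub i).

Lemma xnE (i : 'I_n) : xn i = x i.
Proof. by rewrite /xn valK. Qed.

Lemma points_unip (S : comNzRingType) g : points G S g -> unip g.
Proof. by case. Qed.

Lemma malcev_term_full : malcev_term x n = points G int.
Proof. by case: hx. Qed.

Lemma x_points j : points G int (x j).
Proof.
by rewrite -malcev_term_full; apply: sub_generated; exists j => //=.
Qed.

Lemma unip_xn i : unip (xn i).
Proof.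
rewrite /xn; case: insubP => [j _ _|_] /=; first exact/points_unip/x_points.
exact: unip1.
Qed.

Lemma x_unit : forall i, [set x j | j in [set j : 'I_n | (j < i)%N]] `<=`
  [set g | g \is a GRing.unit].
Proof. by move=> i _ [j _ <-]; exact/unip_unit/points_unip/x_points. Qed.

Lemma subgroup_malcev_term i : subgroup (malcev_term x i).
Proof. exact/subgroup_generated/x_unit. Qed.

Lemma malcev_term_widen i k : (i <= k)%N -> malcev_term x i `<=` malcev_term x k.
Proof.
move=> ik; apply: generated_sub; first exact: subgroup_malcev_term.
move=> _ [j /= ji <-]; apply: sub_generated; exists j => //=.
exact: leq_trans ji ik.
Qed.

Lemma xn_malcev_term i k : (i < k)%N -> (i < n)%N -> malcev_term x k (xn i).
Proof.
move=> ik hi; rewrite /xn (insubT (fun i => (i < n)%N) hi) /=.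
by apply: sub_generated; exists (Ordinal hi).
Qed.

Lemma points_int_subgroup : subgroup (points G int).
Proof. by rewrite -malcev_term_full; exact: subgroup_malcev_term. Qed.

Lemma xn_points i : points G int (xn i).
Proof.
rewrite /xn; case: insubP => [j _ _|_] /=; first exact: x_points.
exact: subgroup1 points_int_subgroup.
Qed.

Lemma malcev_term_comm i g h : (i < n)%N -> points G int g -> malcev_term x i.+1 h ->
  malcev_term x i (g^-1 * h^-1 * g * h).
Proof. by move=> hi; case: hx => _ + _ => /(_ (Ordinal hi)); exact. Qed.

Lemma malcev_term0 g : malcev_term x 0 g -> g = 1.
Proof.
suff h : malcev_term x 0 `<=` [set 1] by move=> /h.
apply: generated_sub; last by move=> h [j].
split=> //=; first by move=> _ ->; exact: unitr1.
- by move=> _ _ -> ->; rewrite mulr1.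
- by move=> _ ->; rewrite invr1.
Qed.

Lemma malcev_term_normal i g h : (i <= n)%N -> points G int g -> malcev_term x i h ->
  malcev_term x i (g * h * g^-1).
Proof.
case: i => [|i] hi hg hh.
  rewrite (malcev_term0 hh) mulr1 mulrV; last exact/unip_unit/points_unip/hg.
  by apply: subgroup1; exact: subgroup_malcev_term.
have sT := subgroup_malcev_term i.+1.
have ug := unip_unit (points_unip hg).
have hgV : points G int g^-1 by apply: subgroupV => //; exact: points_int_subgroup.
have := malcev_term_comm hi hgV (subgroupV sT hh).
rewrite !invrK => /(malcev_term_widen (leqnSn i)) h1.
by have := subgroupM sT h1 hh; rewrite mulrVK // (subgroup_unit sT hh).
Qed.

Lemma malcev_termS i h : (i < n)%N -> malcev_term x i.+1 h ->
  exists k : int, malcev_term x i (h * xn i ^ (- k)).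
Proof.
move=> hi; have sT := subgroup_malcev_term i.
have ux := unip_unit (unip_xn i).
have hp := subgroupXz _ points_int_subgroup (xn_points i).
have [hfull _ _] := hx.
apply: (generated_sub (H := [set h | exists k : int, malcev_term x i (h * xn i ^ (- k))])); last first.
  move=> _ [j /= + <-]; rewrite ltnS leq_eqVlt => /orP[/eqP e|ji]; last first.
    by exists 0; rewrite oppr0 expr0z mulr1; apply: sub_generated; exists j.
  exists 1; rewrite -xnE e exprN1 mulrV //.
  exact: subgroup1.
split=> /=.
- move=> g [k hk]; have := subgroup_unit sT hk.
  by rewrite unitrMl // unitrXz.
- by exists 0; rewrite oppr0 expr0z mulr1; exact: subgroup1.
- move=> g h' [k hk] [l hl]; exists (k + l).
  have -> : g * h' * xn i ^ (- (k + l)) =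
    g * xn i ^ (- k) * (xn i ^ k * (h' * xn i ^ (- l)) * (xn i ^ k)^-1).
    rewrite opprD addrC exprzDr // invr_expz !mulrA; congr (_ * _ * _ * _).
    by rewrite -[RHS]mulrA -exprzDr // addNr expr0z mulr1.
  exact: (subgroupM sT hk (malcev_term_normal (ltnW hi) (hp k) hl)).
- move=> g [k hk]; exists (- k).
  have -> : g^-1 * xn i ^ (- - k) = xn i ^ (- k) * (g * xn i ^ (- k))^-1 * (xn i ^ (- k))^-1.
    have ug : g \is a GRing.unit by have := subgroup_unit sT hk; rewrite unitrMl // unitrXz.
    rewrite invrM ?unitrXz // !invr_expz opprK !mulrA -exprzDr // addNr expr0z mul1r.
    by [].
  exact: (malcev_term_normal (ltnW hi) (hp (- k)) (subgroupV sT hk)).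
Qed.

(** The definition of a Mal'cev basis provides some generator [g] of the infinite cyclic quotient,
    not necessarily the basis element. But [g] is a power of [xn i] modulo the term, so if the
    [N]-th power of [xn i] is trivial there, so is that of [g]; then 0 and [N] are both exponents of
    1, and uniqueness forces [N = 0]. *)
Lemma malcev_term_torsion i (N : nat) : (i < n)%N ->
  malcev_term x i (xn i ^+ N) -> N = 0%N.
Proof.
move=> hi hN; have sT := subgroup_malcev_term i.
have [_ _ /(_ (Ordinal hi))[g gS hg]] := hx.
have [k hk] := malcev_termS hi gS.
have ux := unip_unit (unip_xn i).
have sT' := subgroup_malcev_term i.+1; have ug := subgroup_unit sT' gS.
have npow (l : nat) : malcev_term x i (g ^+ l * (xn i ^ k) ^- l).
  have {1}-> : g = g * xn i ^ (- k) * xn i ^ k by rewrite -mulrA -exprzDr // addNr expr0z mulr1.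
  apply: (norm_pow l sT) hk; first by rewrite unitrXz.
  move=> h; apply: (malcev_term_normal (ltnW hi)).
  exact: subgroupXz points_int_subgroup (xn_points i).
have hgN : malcev_term x i (g ^+ N).
  have -> : g ^+ N = g ^+ N * (xn i ^ k) ^- N * (xn i ^+ N) ^ k.
    have -> : (xn i ^ k) ^+ N = (xn i ^+ N) ^ k.
      by rewrite -[LHS]/((xn i ^ k) ^ (N : int)) exprzAC.
    by rewrite mulrVK // unitrXz // unitrX.
  exact: (subgroupM sT (npow N) (subgroupXz k sT hN)).
have [k0 [_ uniq]] := hg 1 (subgroup1 sT').
have e0 : k0 = 0 by apply: uniq; rewrite oppr0 expr0z mulr1; exact: subgroup1.
have eN : k0 = N.
  by apply: uniq; rewrite mulr1 -invr_expz; exact: (subgroupV sT hgN).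
by move: eN; rewrite e0 => -[].
Qed.

Section OverField.
Variables (F : fieldType).
Hypothesis charF : [pchar F] =i pred0.

Definition xF i : 'M[F]_m.+1 := map_mx intr (xn i).

Lemma unip_xF i : unip (xF i).
Proof. exact/unip_map/unip_xn. Qed.

Lemma xF_comm i j : (i < n)%N -> (j < n)%N ->
  generated_subgroup [set xF k | k in [set k | (k < i)%N]]
    (xF j * xF i * (xF j)^-1 * (xF i)^-1).
Proof.
move=> hi hj; have ux k := unip_unit (unip_xn k).
have sub k : malcev_term x k (xn k) -> True by [].
have hV k : points G int (xn k)^-1 by apply: subgroupV (xn_points k); exact: points_int_subgroup.
have := malcev_term_comm hi (hV j) (subgroupV (subgroup_malcev_term _) (xn_malcev_term (ltnSn i) hi)).
rewrite !invrK.
move=> /(generated_map (f := map_mx (intr : int -> F)) (@x_unit i)) h.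
have := h (generated_subgroup [set xF k | k in [set k | (k < i)%N]]).
rewrite !rmorphM /= !rmorphV //; apply.
  by apply: subgroup_generated => _ [k _ <-]; exact/unip_unit/unip_xF.
move=> _ [k /= ki <-]; apply: sub_generated; exists (val k) => //.
by rewrite /xF xnE.
Qed.

Lemma xpow_int i (k : int) : ypow xF i k%:~R = map_mx intr (xn i ^ k).
Proof.
rewrite /ypow unipotent_powz //; last exact: unip_xF.
by rewrite (rmorphXz (map_mx (intr : int -> F))) //; exact/unip_unit/unip_xn.
Qed.

Lemma word_int i (k : nat -> int) : (i <= n)%N ->
  exists2 g, malcev_term x i g & word xF i (fun j => (k j)%:~R) = map_mx intr g.
Proof.
elim: i => [|i IH] hi.
  exists 1; first exact: subgroup1 (subgroup_malcev_term 0).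
  by rewrite word0 map_mx1.
have [g hg e] := IH (ltnW hi); exists (g * xn i ^ (k i)).
  have sT := subgroup_malcev_term i.+1.
  apply: (subgroupM sT (malcev_term_widen (leqnSn i) hg)).
  exact: subgroupXz (xn_malcev_term (ltnSn i) hi).
by rewrite wordS e xpow_int -mulmxE -map_mxM.
Qed.

Lemma malcev_term_word i g : (i <= n)%N -> malcev_term x i g ->
  exists k : nat -> int, map_mx intr g = word xF i (fun j => (k j)%:~R).
Proof.
elim: i g => [|i IH] g hi hg.
  by exists (fun=> 0); rewrite word0 (malcev_term0 hg) map_mx1.
have [l hl] := malcev_termS hi hg; have [k ek] := IH _ (ltnW hi) hl.
have ux := unip_unit (unip_xn i).
exists (fun j => if j == i then l else k j); rewrite wordS eqxx.
have -> : word xF i (fun j => (if j == i then l else k j)%:~R) =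
          word xF i (fun j => (k j)%:~R).
  by apply: eq_word => j ji; rewrite ltn_eqF.
rewrite -ek xpow_int -mulmxE -map_mxM; congr map_mx.
by rewrite mulmxE -mulrA -exprzDr // addNr expr0z mulr1.
Qed.

End OverField.

Lemma char_rat : [pchar rat] =i pred0.
Proof. exact: pchar_num. Qed.

Lemma map_intr_inj (F : fieldType) (charF : [pchar F] =i pred0) (a b : 'M[int]_m.+1) :
  map_mx (intr : int -> F) a = map_mx intr b -> a = b.
Proof.
move=> /matrixP ab; apply/matrixP => i j; have := ab i j; rewrite !mxE => /eqP.
rewrite -subr_eq0 -intrB => /eqP e; apply/eqP; rewrite -subr_eq0; move: e.
have n0 k : (k%:R == 0 :> F) = (k == 0)%N := (pcharf0P F).1 charF k.
case: (_ - _) => k /eqP; first by rewrite -[_%:~R]/(k%:R) n0.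
by rewrite NegzE mulrNz oppr_eq0 -[_%:~R]/(k.+1%:R) n0.
Qed.

(** By induction on [r]. If the next logarithm were a combination of the previous ones, [ulog_surj]
    would make the next generator a rational word in them. The coordinates of its powers are
    polynomials vanishing at 0, so some positive power is an integral word, against
    [malcev_term_torsion]. *)
Lemma rat_functionals r : (r <= n)%N -> exists c : nat -> 'cV[rat]_(m.+1 * m.+1),
  (forall i, (i < r)%N -> mxvec (ulog (xF rat i)) *m c i = 1%:M) /\
  (forall i j, (i < r)%N -> (j < i)%N -> mxvec (ulog (xF rat j)) *m c i = 0).
Proof.
elim: r => [|r IH] rn; first by exists (fun=> 0).
have [c [c1 c2]] := IH (ltnW rn).
have ux := unip_xF rat; have cx := @xF_comm rat.
pose X := mxvec (ulog (xF rat r)).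
case: (boolP (X <= logspan (xF rat) r)%MS) => hX.
  exfalso; have rn' := ltnW rn.
  have fr := ulog_surj char_rat ux cx rn' c1 c2 (leqnn r) (ux r) hX.
  pose q j := projT1 (cid (coords_poly ux c r j (polyfam_upow char_rat (ux r)))).
  have hq j a : coords (xF rat) c r (unipotent_pow (xF rat r) a) j = (q j).[a].
    by rewrite /q; case: cid => ? /=.
  have w1 : word (xF rat) r (fun=> 0) = 1.
    exact: (word_zero char_rat ux).
  have q0 j : (j < r)%N -> (q j).[0] = 0.
    move=> jr; rewrite -hq (unipotent_pow0 char_rat (ux r)) -w1.
    by rewrite (wordK char_rat ux cx rn' c1 c2).
  have [D D0 hD] : exists2 D : nat, (0 < D)%N & forall j, (j < r)%N ->
      (q j).[D%:R] \is a Num.int.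
    (* Integrality is required at all multiples of [D], because that is what survives when [D] is
       multiplied by the factor needed for the next coordinate. *)
    have : forall k, (k <= r)%N -> exists2 D : nat, (0 < D)%N & forall j, (j < k)%N ->
      forall l : int, (q j).[(D%:Z * l)%:~R] \is a Num.int.
      elim=> [|k IHk] kr; first by exists 1%N.
      have [D D0 hD] := IHk (ltnW kr); have [D' D'0 hD'] := poly_rat_int (q0 k kr).
      exists (D * D')%N; first by rewrite muln_gt0 D0.
      move=> j; rewrite ltnS leq_eqVlt => /orP[/eqP ->|jk] l.
        by rewrite PoszM [D%:Z * _]mulrC -mulrA; exact: hD'.
      by rewrite PoszM -mulrA; exact: hD.
    case/(_ r (leqnn r)) => D D0 hD; exists D => // j jr.
    by have := hD j jr 1; rewrite mulr1.
  have hf := flag_upow char_rat ux cx rn' c1 c2 D%:R (leqnn r) fr.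
  pose k j := Num.floor (q j).[D%:R].
  have [g hg eg] := word_int char_rat k rn'.
  have := coordsK char_rat ux cx rn' c1 c2 (leqnn r) hf.
  have -> : word (xF rat) r (coords (xF rat) c r (unipotent_pow (xF rat r) D%:R)) =
     word (xF rat) r (fun j => (k j)%:~R).
    by apply: eq_word => j jr; rewrite hq /k floorK // hD.
  rewrite eg (unipotent_pow_nat char_rat _ (ux r)) /xF -(rmorphXn (map_mx (intr : int -> rat))).
  move=> /(map_intr_inj char_rat) e; rewrite e in hg.
  by have := malcev_term_torsion rn hg; move: D0; case: (D).
(* A column of the cokernel of the previous logarithms kills all of them; one that does not kill [X]
   is chosen and scaled to the value 1 there. *)
have /rV0Pn[l hl] : X *m cokermx (logspan (xF rat) r) != 0 by rewrite -submxE.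
pose v : 'cV[rat]_(m.+1 * m.+1) :=
  ((X *m cokermx (logspan (xF rat) r)) 0 l)^-1 *: col l (cokermx (logspan (xF rat) r)).
have vE (u : 'rV[rat]_(m.+1 * m.+1)) : u *m v =
    ((X *m cokermx (logspan (xF rat) r)) 0 l)^-1 *: col l (u *m cokermx (logspan (xF rat) r)).
  have cM (C : 'M[rat]_(m.+1 * m.+1)) : u *m col l C = col l (u *m C).
    by apply/colP => i; rewrite ![RHS]mxE [LHS]mxE; apply: eq_bigr => j _; rewrite mxE.
  by rewrite /v -scalemxAr cM.
exists (fun i => if i == r then v else c i); split=> i.
  rewrite ltnS leq_eqVlt; case: eqVneq => [-> _|_ /= ir]; last exact: c1.
  rewrite vE -/X; move: hl; set w := X *m _ => hl.
  by apply/matrixP => a b; rewrite !ord1 [LHS]mxE [X in _ * X]mxE [RHS]mxE eqxx mulVf.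
move=> j; rewrite ltnS leq_eqVlt; case: eqVneq => [-> _|_ /= ir]; last exact: c2.
move=> jr; rewrite vE.
have := sub_logspan (xF rat) jr; rewrite submxE => /eqP ->.
by rewrite col0 scaler0.
Qed.

End IntegralMalcev.

(** * The p-adic absolute value *)

Section RatrCharZero.
Variable F : fieldType.
Hypothesis charF : [pchar F] =i pred0.

(* The library makes [ratr] a ring morphism only into ordered fields. *)
Definition ratr0 of [pchar F] =i pred0 : rat -> F := ratr.

Let natr0 k : (k%:R == 0 :> F) = (k == 0)%N := (pcharf0P F).1 charF k.

Let intr0 (z : int) : (z%:~R == 0 :> F) = (z == 0).
Proof.
case: z => k; first by rewrite -[_%:~R]/(k%:R) natr0.
by rewrite NegzE mulrNz oppr_eq0 -[_%:~R]/(k.+1%:R) natr0 oppr_eq0.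
Qed.

Let ratrE a b : b != 0 -> ratr (a%:~R / b%:~R : rat) = a%:~R / b%:~R :> F.
Proof.
move=> b0; rewrite /ratr; set q : rat := (a%:~R / b%:~R : rat).
have bq : (b%:~R != 0 :> rat) by rewrite intr_eq0.
have e : (numq q) * b = a * denq q.
  apply/eqP; rewrite -(eqr_int rat) !intrM; apply/eqP.
  have dq : (denq q)%:~R != 0 :> rat by rewrite intr_eq0 denq_neq0.
  apply: (mulIf (invr_neq0 dq)); rewrite mulfK // mulrAC divq_num_den.
  by rewrite /q mulfVK.
have dF : (denq q)%:~R != 0 :> F by rewrite intr0 denq_neq0.
have bF : b%:~R != 0 :> F by rewrite intr0.
apply: (mulIf dF); rewrite mulfVK // mulrAC; apply: (mulIf bF).
by rewrite mulfVK // -!intrM e.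
Qed.

Lemma ratr0_is_zmod_morphism : zmod_morphism (ratr0 charF).
Proof.
move=> a b; rewrite /ratr0.
have da : (denq a)%:~R != 0 :> rat by rewrite intr_eq0 denq_neq0.
have db : (denq b)%:~R != 0 :> rat by rewrite intr_eq0 denq_neq0.
have daF : (denq a)%:~R != 0 :> F by rewrite intr0 denq_neq0.
have dbF : (denq b)%:~R != 0 :> F by rewrite intr0 denq_neq0.
have -> : a - b = (numq a * denq b + - numq b * denq a)%:~R / (denq a * denq b)%:~R.
  rewrite -{1}[a]divq_num_den -{1}[b]divq_num_den -mulNr addf_div //.
  by rewrite intrD !intrM mulrNz.
rewrite ratrE ?mulf_neq0 ?denq_neq0 //.
have -> : ratr a - ratr b = (numq a)%:~R / (denq a)%:~R + (- numq b)%:~R / (denq b)%:~R :> F.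
  by rewrite mulrNz mulNr.
by rewrite addf_div // intrD !intrM.
Qed.

Lemma ratr0_is_monoid_morphism : monoid_morphism (ratr0 charF).
Proof.
rewrite /ratr0; split=> [|a b]; first by rewrite (ratr_int F 1).
have -> : a * b = (numq a * numq b)%:~R / (denq a * denq b)%:~R.
  by rewrite -{1}[a]divq_num_den -{1}[b]divq_num_den mulf_div !intrM.
by rewrite ratrE ?mulf_neq0 ?denq_neq0 // /ratr mulf_div !intrM.
Qed.

HB.instance Definition _ := GRing.isZmodMorphism.Build rat F (ratr0 charF)
  ratr0_is_zmod_morphism.
HB.instance Definition _ := GRing.isMonoidMorphism.Build rat F (ratr0 charF)
  ratr0_is_monoid_morphism.

End RatrCharZero.

Section PadicAbs.
Variables (R : realType) (p : nat) (K : padicField R p).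
Hypothesis pp : prime p.
Implicit Types a b : padic K.
Notation abs := (@padic_abs R p K).

Lemma padic_absM a b : abs (a * b) = abs a * abs b.
Proof. exact: padic_absvalM. Qed.

Lemma padic_abs_eq0 a : (abs a == 0) = (a == 0).
Proof.
apply/eqP/eqP => [|->]; [exact: padic_absval_eq0|exact: padic_abs0].
Qed.

Lemma padic_abs_ge0 a : 0 <= abs a.
Proof.
have : abs (a - a) <= abs a + abs (- a) by exact: padic_absvalD.
by rewrite subrr padic_abs0 padic_absN; lra.
Qed.

Lemma padic_abs_gt0 a : (0 < abs a) = (a != 0).
Proof. by rewrite lt_def padic_abs_eq0 padic_abs_ge0 andbT. Qed.

Lemma padic_absV a : abs a^-1 = (abs a)^-1.
Proof.
have [->|a0] := eqVneq a 0; first by rewrite invr0 padic_abs0 invr0.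
have h : abs a != 0 by rewrite padic_abs_eq0.
by apply: (mulIf h); rewrite -padic_absM !mulVf // padic_abs1.
Qed.

Lemma padic_absX a k : abs (a ^+ k) = abs a ^+ k.
Proof.
elim: k => [|k IH]; first by rewrite !expr0 padic_abs1.
by rewrite !exprS padic_absM IH.
Qed.

Lemma padic_abs_prod (I : Type) (r : seq I) (P : pred I) (f : I -> padic K) :
  abs (\prod_(i <- r | P i) f i) = \prod_(i <- r | P i) abs (f i).
Proof. by apply: (big_morph abs padic_absM); exact: padic_abs1. Qed.

Let p0 : (0 : R) < p%:R.
Proof. by rewrite ltr0n prime_gt0. Qed.

Let p1 : (1 : R) < p%:R.
Proof. by rewrite ltr1n prime_gt1. Qed.

Lemma padic_abs_int (z : int) : z != 0 ->
  abs z%:~R = p%:R ^- logn p `|z|%N.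
Proof.
move=> z0; have := padic_absval_rat K z%:~R.
rewrite ratr_int /rat_padic_abs intr_eq0 (negPf z0) numq_int denq_int logn1.
by rewrite add0r => h; rewrite -[LHS]/(padic_absval _) h -invr_expz.
Qed.

Lemma padic_abs_int_le1 (z : int) : abs z%:~R <= 1.
Proof.
have [->|z0] := eqVneq z 0; first by rewrite padic_abs0.
by rewrite padic_abs_int // invf_le1 ?exprn_gt0 // exprn_ege1 // ltW.
Qed.

Lemma padic_abs_p : abs p%:R = p%:R^-1.
Proof.
rewrite -[p%:R]/(p%:Z%:~R) padic_abs_int; last by rewrite -lt0n prime_gt0.
by rewrite /= logn_prime // eqxx expr1.
Qed.

Lemma padic_abs_pXz (k : int) : abs (p%:R ^ k) = p%:R ^ (- k).
Proof.
case: k => k; first by rewrite -exprnP padic_absX padic_abs_p exprVn exprnN.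
rewrite NegzE opprK -invr_expz -exprnP padic_absV padic_absX padic_abs_p.
by rewrite exprVn invrK exprnP.
Qed.

Lemma padic_natr_neq0 (k : nat) : (k%:R == 0 :> padic K) = (k == 0%N).
Proof.
apply/eqP/eqP => [e|->//]; apply/eqP; apply: contraT => k0.
have := @padic_abs_int k%:Z k0; rewrite -[_%:~R]/(k%:R) e padic_abs0 => /esym/eqP.
by rewrite invr_eq0 expf_eq0 gt_eqF ?p0 // andbF.
Qed.

Lemma char_padic : [pchar (padic K)] =i pred0.
Proof. by apply/(pcharf0P (padic K)).2; exact: padic_natr_neq0. Qed.

Lemma padic_abs_intD (z w : int) : abs (z + w)%:~R <= Num.max (abs z%:~R) (abs w%:~R).
Proof.
have [->|z0] := eqVneq z 0; first by rewrite add0r le_max lexx orbT.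
have [->|w0] := eqVneq w 0; first by rewrite addr0 le_max lexx.
have [->|s0] := eqVneq (z + w) 0; first by rewrite padic_abs0 le_max padic_abs_ge0.
wlog h : z w z0 w0 s0 / (logn p `|z| <= logn p `|w|)%N.
  move=> H; case/orP: (leq_total (logn p `|z|) (logn p `|w|)) => h; first exact: H.
  by rewrite addrC maxC; apply: H => //; rewrite addrC.
rewrite le_max; apply/orP; left; rewrite !padic_abs_int //.
rewrite lef_pV2 ?posrE ?exprn_gt0 // ler_eXn2l //.
have dz : (p ^ logn p `|z| %| `|z|)%N by exact: pfactor_dvdnn.
have dw : (p ^ logn p `|z| %| `|w|)%N.
  by apply: dvdn_trans (pfactor_dvdnn p _); exact: dvdn_exp2l.
have : (p ^ logn p `|z| %| `|(z + w)%R|)%N.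
  by rewrite -[X in (X %| _)%N]/(`|(p ^ logn p `|z|)%N%:Z|%N) -dvdzE rpredD // dvdzE.
by rewrite pfactor_dvdn // absz_gt0.
Qed.

Lemma ratr_padicE (q : rat) : ratr q = (numq q)%:~R / (denq q)%:~R :> padic K.
Proof. by []. Qed.

Lemma padic_abs_rat q : abs (ratr q) = rat_padic_abs R p q.
Proof. exact: padic_absval_rat. Qed.

Lemma padic_abs_ratD (q r : rat) :
  abs (ratr q + ratr r) <= Num.max (abs (ratr q)) (abs (ratr r)).
Proof.
have dqF : (denq q)%:~R != 0 :> padic K.
  by rewrite -padic_abs_eq0 padic_abs_int ?denq_neq0 // invr_eq0 expf_neq0 // gt_eqF.
have drF : (denq r)%:~R != 0 :> padic K.
  by rewrite -padic_abs_eq0 padic_abs_int ?denq_neq0 // invr_eq0 expf_neq0 // gt_eqF.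
rewrite !ratr_padicE addf_div //.
have -> : (numq q)%:~R / (denq q)%:~R =
   ((numq q)%:~R * (denq r)%:~R) / ((denq q)%:~R * (denq r)%:~R) :> padic K.
  by rewrite -mulf_div divff // mulr1.
have -> : (numq r)%:~R / (denq r)%:~R =
   ((numq r)%:~R * (denq q)%:~R) / ((denq q)%:~R * (denq r)%:~R) :> padic K.
  by rewrite [_%:~R * (denq r)%:~R]mulrC -mulf_div divff // mulr1.
rewrite -!intrM -intrD !padic_absM -maxr_pMl ?padic_abs_ge0 //.
by rewrite ler_wpM2r ?padic_abs_ge0 // padic_abs_intD.
Qed.

Lemma padic_rat_near a e : 0 < e -> exists q : rat, abs (a - ratr q) < e.
Proof. exact: padic_dense_rat. Qed.

Lemma padic_abs_tri a b : abs (a + b) <= abs a + abs b.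
Proof. exact: padic_absvalD. Qed.

(** The model postulates only the triangle inequality. The ultrametric one holds for rationals by
    divisibility, and rational approximations within [e / 4] transfer it to the whole field up to
    [e]. *)
Lemma padic_absD a b : abs (a + b) <= Num.max (abs a) (abs b).
Proof.
apply/ler_addgt0Pr => e e0.
have e4 : 0 < e / 4 by lra.
have [q hq] := padic_rat_near a e4; have [r hr] := padic_rat_near b e4.
have h1 : abs (a + b) <= abs (ratr q + ratr r) + e / 2.
  have -> : a + b = (ratr q + ratr r) + ((a - ratr q) + (b - ratr r)) by ring.
  apply: le_trans (padic_abs_tri _ _) _; rewrite lerD2l.
  by apply: le_trans (padic_abs_tri _ _) _; lra.
have h2 c (s : rat) : abs (c - ratr s) < e / 4 -> abs (ratr s) <= abs c + e / 4.
  move=> hc; have := padic_abs_tri c (ratr s - c).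
  have -> : abs (ratr s - c) = abs (c - ratr s) by rewrite -padic_absN opprB.
  by rewrite addrCA subrr addr0; lra.
have := padic_abs_ratD q r; have := h2 _ _ hq; have := h2 _ _ hr.
by case: (leP (abs (ratr q)) (abs (ratr r))) => ?; case: (leP (abs a) (abs b)) => ?; lra.
Qed.

Lemma padic_absD_lt a b r : abs a < r -> abs b < r -> abs (a + b) < r.
Proof. by move=> ha hb; apply: le_lt_trans (padic_absD a b) _; rewrite gt_max ha. Qed.

Lemma padic_absD_le a b r : abs a <= r -> abs b <= r -> abs (a + b) <= r.
Proof. by move=> ha hb; apply: le_trans (padic_absD a b) _; rewrite ge_max ha. Qed.

Lemma padic_absB_lt a b r : abs a < r -> abs b < r -> abs (a - b) < r.
Proof. by move=> ha hb; apply: padic_absD_lt; rewrite ?padic_absN. Qed.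

Lemma padic_absB_le a b r : abs a <= r -> abs b <= r -> abs (a - b) <= r.
Proof. by move=> ha hb; apply: padic_absD_le; rewrite ?padic_absN. Qed.

Lemma padic_abs_near a b : abs (a - b) < abs a -> abs b = abs a.
Proof.
move=> h; apply/eqP; rewrite eq_le; apply/andP; split.
  have -> : b = a - (a - b) by ring.
  by apply: padic_absB_le => //; exact: ltW.
rewrite leNgt; apply/negP => hb.
suff : abs a < abs a by rewrite ltxx.
have {1}-> : a = (a - b) + b by ring.
exact: padic_absD_lt.
Qed.

(** A rational closer to [a] than [abs a] has the same absolute value as [a], so the value group is
    that of the rationals. *)
Lemma padic_abs_val a : a != 0 -> exists k : int, abs a = p%:R ^ k.
Proof.
rewrite -padic_abs_gt0 => a0; have [q hq] := padic_rat_near a a0.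
have e := padic_abs_near hq; rewrite -e padic_abs_rat /rat_padic_abs.
case: eqVneq => [q0|_]; last by eexists.
move: e; rewrite q0 (ratr_int _ 0) padic_abs0 => e0.
by rewrite -e0 ltxx in a0.
Qed.

Lemma pXn_small (e : R) : 0 < e -> exists M : nat, p%:R ^- M < e.
Proof.
move=> e0; exists (Num.truncn e^-1).+1.
have h : e^-1 < p%:R ^+ (Num.truncn e^-1).+1.
  have h1 : e^-1 < (Num.truncn e^-1).+1%:R by rewrite truncnS_gt.
  apply: lt_le_trans h1 _; rewrite -natrX ler_nat.
  by apply: ltnW; apply: ltn_expl; exact: prime_gt1.
by rewrite -[X in _ < X]invrK ltf_pV2 ?posrE ?invr_gt0 ?exprn_gt0.
Qed.

(** Z is dense in Z_p. A rational [q] within distance less than 1 of [a] is p-adically integral, so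
    its denominator is prime to [p] and can be inverted modulo a high power of [p]. *)
Lemma padic_int_near a (e : R) : abs a <= 1 -> 0 < e -> exists k : int, abs (a - k%:~R) < e.
Proof.
move=> a1 e0; have m0 : 0 < Num.min e 1 by rewrite lt_min e0 ltr01.
have [q hq] := padic_rat_near a m0.
have [hqe hq1] : abs (a - ratr q) < e /\ abs (a - ratr q) < 1.
  by move: hq; rewrite lt_min => /andP.
have q1 : abs (ratr q) <= 1.
  have -> : ratr q = a - (a - ratr q) by ring.
  by apply: padic_absB_le => //; exact: ltW.
have d1 : ~~ (p %| `|denq q|)%N.
  apply/negP => pd; have pn : ~~ (p %| `|numq q|)%N.
    apply/negP => pn; have := coprime_num_den q; rewrite /coprime => /eqP g1.
    have : (p %| gcdn `|numq q| `|denq q|)%N by rewrite dvdn_gcd pn.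
    by rewrite g1 dvdn1 => /eqP p1'; move: (prime_gt1 pp); rewrite p1'.
  move: q1; rewrite padic_abs_rat /rat_padic_abs; case: eqVneq => [q0|q0].
    by move: pd; rewrite q0 dvdn1 => /eqP p1'; move: (prime_gt1 pp); rewrite p1'.
  have -> : logn p `|numq q| = 0%N.
    by apply/eqP; rewrite lognE (negPf pn) !andbF.
  rewrite subr0 leNgt => /negP; apply; rewrite -exprnP exprn_egt1 ?ltr1n ?prime_gt1 //.
  by rewrite -lt0n logn_gt0 mem_primes pp absz_gt0 denq_neq0.
have [M hM] := pXn_small e0.
(* In a Bezout relation u d + v p^M = 1 for the denominator d, the integer [numq q * u] differs from
   [q] by [numq q] v p^M / d, which is small. *)
have : coprimez (denq q) (p ^ M)%N%:Z.
  by rewrite /coprimez /gcdz /= -[_ == _]/(coprime _ _) coprimeXr // coprime_sym prime_coprime.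
case/coprimezP => -[u v] /= huv.
exists (numq q * u).
have -> : a - (numq q * u)%:~R = (a - ratr q) + (ratr q - (numq q * u)%:~R) by ring.
apply: padic_absD_lt => //.
have dq0 : abs (denq q)%:~R = 1.
  rewrite padic_abs_int ?denq_neq0 // (_ : logn _ _ = 0%N) ?expr0 ?invr1 //.
  by apply/eqP; rewrite lognE (negPf d1) !andbF.
have dqF : (denq q)%:~R != 0 :> padic K by rewrite -padic_abs_eq0 dq0 oner_neq0.
have -> : ratr q - (numq q * u)%:~R = (numq q)%:~R * v%:~R * p%:R ^+ M / (denq q)%:~R :> padic K.
  rewrite ratr_padicE; apply: (mulIf dqF); rewrite mulrBl !mulfVK //.
  rewrite -[p%:R ^+ M]natrX -[(p ^ M)%:R]/((p ^ M)%N%:Z%:~R) -!intrM -intrB; congr _%:~R.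
  by rewrite -[X in X - _]mulr1 -huv; ring.
rewrite !padic_absM padic_absV dq0 invr1 mulr1 padic_absX padic_abs_p exprVn.
apply: le_lt_trans hM; rewrite -[X in _ <= X]mul1r; apply: ler_wpM2r.
  by rewrite invr_ge0 exprn_ge0 // ltW.
by rewrite mulr_ile1 ?padic_abs_ge0 ?padic_abs_int_le1.
Qed.

(** Closures are handled through sequences, entry by entry; [cvM_closureP] is the link with the
    topology of matrices. *)
Definition cvK (u : nat -> padic K) l :=
  forall e : R, 0 < e -> exists N0, forall k, (N0 <= k)%N -> abs (u k - l) < e.

Lemma cvK_const a : cvK (fun=> a) a.
Proof. by move=> e e0; exists 0%N => k _; rewrite subrr padic_abs0. Qed.

Lemma cvK_eq u v l : (forall k, u k = v k) -> cvK u l -> cvK v l.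
Proof. by move=> uv hu e /hu[N0 h]; exists N0 => k /h; rewrite uv. Qed.

Lemma cvKD u v l l' : cvK u l -> cvK v l' -> cvK (fun k => u k + v k) (l + l').
Proof.
move=> hu hv e e0; have [N1 h1] := hu e e0; have [N2 h2] := hv e e0.
exists (maxn N1 N2) => k; rewrite geq_max => /andP[k1 k2].
have -> : u k + v k - (l + l') = (u k - l) + (v k - l') by ring.
by apply: padic_absD_lt; [exact: h1|exact: h2].
Qed.

Lemma cvKN u l : cvK u l -> cvK (fun k => - u k) (- l).
Proof.
by move=> hu e /hu[N0 h]; exists N0 => k /h; rewrite -opprD padic_absN.
Qed.

Lemma cvK0M u v : cvK u 0 -> (exists B, forall k, abs (v k) <= B) -> cvK (fun k => u k * v k) 0.
Proof.
move=> hu [B hB] e e0.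
have B0 : 0 <= B by apply: le_trans (hB 0%N); exact: padic_abs_ge0.
have eB : 0 < e / (B + 1) by rewrite divr_gt0 // ltr_wpDl.
have [N0 h] := hu _ eB; exists N0 => k /h; rewrite !subr0 padic_absM => hk.
apply: le_lt_trans (_ : abs (u k) * (B + 1) < e); last by rewrite -ltr_pdivlMr // ltr_wpDl.
by rewrite ler_wpM2l ?padic_abs_ge0 // (le_trans (hB k)) // lerDl.
Qed.

Lemma cvK_bounded u l : cvK u l -> exists B, forall k, abs (u k) <= B.
Proof.
move=> hu; have [N0 h] := hu 1 ltr01.
exists (\sum_(i < N0) abs (u i) + (abs l + 1)) => k.
have s0 : 0 <= \sum_(i < N0) abs (u i) by apply: sumr_ge0 => i _; exact: padic_abs_ge0.
have [kN|Nk] := ltnP k N0.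
  rewrite (bigD1 (Ordinal kN)) //= -addrA lerDl addr_ge0 //.
    by apply: sumr_ge0 => i _; exact: padic_abs_ge0.
  by rewrite addr_ge0 // padic_abs_ge0.
have := h k Nk; have := padic_abs_tri (u k - l) l; rewrite subrK; lra.
Qed.

Lemma cvKM u v l l' : cvK u l -> cvK v l' -> cvK (fun k => u k * v k) (l * l').
Proof.
move=> hu hv.
have h1 : cvK (fun k => (u k - l) * v k) 0.
  apply: cvK0M (cvK_bounded hv).
  by have := cvKD hu (cvKN (cvK_const l)); rewrite subrr.
have h2 : cvK (fun k => (v k - l') * l) 0.
  apply: cvK0M; last by exists (abs l).
  by have := cvKD hv (cvKN (cvK_const l')); rewrite subrr.
have := cvKD (cvKD h1 h2) (cvK_const (l * l')); rewrite !add0r.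
by apply: cvK_eq => k; ring.
Qed.

Lemma cvK_uniq u l l' : cvK u l -> cvK u l' -> l = l'.
Proof.
move=> hu hv; apply/eqP; rewrite -subr_eq0; apply: contraT => n0.
have e0 : 0 < abs (l - l') by rewrite padic_abs_gt0.
have [N1 h1] := hu _ e0; have [N2 h2] := hv _ e0.
have {}h1 := h1 _ (leq_maxl N1 N2); have {}h2 := h2 _ (leq_maxr N1 N2).
suff : abs (l - l') < abs (l - l') by rewrite ltxx.
have {1}-> : l - l' = (u (maxn N1 N2) - l') - (u (maxn N1 N2) - l) by ring.
exact: padic_absB_lt.
Qed.

Lemma cvK_le u l r : (forall k, abs (u k) <= r) -> cvK u l -> abs l <= r.
Proof.
move=> hr hu; apply/ler_addgt0Pr => e e0; have [N0 h] := hu e e0.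
have := padic_abs_tri (u N0) (l - u N0); rewrite addrCA subrr addr0 => h1.
apply: le_trans h1 _; apply: lerD => //.
by rewrite -padic_absN opprB; apply: ltW; exact: h.
Qed.

Lemma cvK_unif (k : nat) (u : nat -> nat -> padic K) (l : nat -> padic K) :
  (forall j, (j < k)%N -> cvK (u j) (l j)) -> forall e, 0 < e ->
  exists N0, forall i, (N0 <= i)%N -> forall j, (j < k)%N -> abs (u j i - l j) < e.
Proof.
move=> h e e0; elim: k h => [|k IH] h; first by exists 0%N.
have [|N1 h1] := IH; first by move=> j jk; apply: h; exact: ltnW.
have [N2 h2] := h k (ltnSn k) e e0; exists (maxn N1 N2) => i.
rewrite geq_max => /andP[i1 i2] j; rewrite ltnS leq_eqVlt => /orP[/eqP ->|jk].
  exact: h2.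
exact: h1.
Qed.

Lemma cvK_sum (I : Type) (r : seq I) (u : I -> nat -> padic K) l :
  (forall i, cvK (u i) (l i)) -> cvK (fun k => \sum_(i <- r) u i k) (\sum_(i <- r) l i).
Proof.
move=> h; elim: r => [|i r IH].
  by rewrite big_nil; apply: cvK_eq (cvK_const 0) => k; rewrite big_nil.
rewrite big_cons; apply: cvK_eq (cvKD (h i) IH) => k.
by rewrite big_cons.
Qed.

Lemma cvK_prod (I : Type) (r : seq I) (u : I -> nat -> padic K) l :
  (forall i, cvK (u i) (l i)) -> cvK (fun k => \prod_(i <- r) u i k) (\prod_(i <- r) l i).
Proof.
move=> h; elim: r => [|i r IH].
  by rewrite big_nil; apply: cvK_eq (cvK_const 1) => k; rewrite big_nil.
rewrite big_cons; apply: cvK_eq (cvKM (h i) IH) => k.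
by rewrite big_cons.
Qed.

Variable N : nat.
Notation M := 'M[padic K]_N.+1.

Definition cvM (u : nat -> M) (g : M) := forall i j, cvK (fun k => u k i j) (g i j).

Lemma cvM_const g : cvM (fun=> g) g.
Proof. by move=> i j; exact: cvK_const. Qed.

Lemma cvM_eq u v g : (forall k, u k = v k) -> cvM u g -> cvM v g.
Proof. by move=> uv hu i j; apply: cvK_eq (hu i j) => k; rewrite uv. Qed.

Lemma cvMD u v g h : cvM u g -> cvM v h -> cvM (fun k => u k + v k) (g + h).
Proof.
move=> hu hv i j; rewrite mxE; apply: cvK_eq (cvKD (hu i j) (hv i j)) => k.
by rewrite mxE.
Qed.

Lemma cvMM u v g h : cvM u g -> cvM v h -> cvM (fun k => u k * v k) (g * h).
Proof.
move=> hu hv i j; rewrite -mulmxE mxE.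
apply: cvK_eq (cvK_sum _ (fun l => cvKM (hu i l) (hv l j))) => k.
by rewrite mxE.
Qed.

Lemma cvMZ (a : nat -> padic K) b u g : cvK a b -> cvM u g -> cvM (fun k => a k *: u k) (b *: g).
Proof.
move=> ha hu i j; rewrite mxE; apply: cvK_eq (cvKM ha (hu i j)) => k.
by rewrite mxE.
Qed.

Lemma cvMX u g l : cvM u g -> cvM (fun k => u k ^+ l) (g ^+ l).
Proof.
move=> hu; elim: l => [|l IH]; first exact: cvM_const.
by rewrite exprS; apply: cvM_eq (cvMM hu IH) => k; rewrite exprS.
Qed.

Lemma cvM_sum (I : Type) (r : seq I) (u : I -> nat -> M) g :
  (forall i, cvM (u i) (g i)) -> cvM (fun k => \sum_(i <- r) u i k) (\sum_(i <- r) g i).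
Proof.
move=> h; elim: r => [|i r IH].
  by rewrite big_nil; apply: cvM_eq (cvM_const 0) => k; rewrite big_nil.
rewrite big_cons; apply: cvM_eq (cvMD (h i) IH) => k.
by rewrite big_cons.
Qed.

Lemma cvM_uniq u g h : cvM u g -> cvM u h -> g = h.
Proof. by move=> hu hv; apply/matrixP => i j; apply: cvK_uniq (hu i j) (hv i j). Qed.

Lemma cvM_sub1 u g : cvM u g -> cvM (fun k => u k - 1) (g - 1).
Proof. by move=> hu; apply: cvMD hu (cvM_const _). Qed.

Lemma cvM_upow u g (a : nat -> padic K) b : cvM u g -> cvK a b ->
  cvM (fun k => unipotent_pow (u k) (a k)) (unipotent_pow g b).
Proof.
move=> hu ha; apply: cvM_sum => l; apply: cvMZ.
  apply: cvKM (cvK_const _); apply: cvK_prod => i.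
  exact: cvKD ha (cvK_const _).
exact/cvMX/cvM_sub1.
Qed.

Lemma cvM_ulog u g : cvM u g -> cvM (fun k => ulog (u k)) (ulog g).
Proof.
move=> hu; apply: cvM_sum => l; apply: cvMZ; first exact: cvK_const.
exact/cvMX/cvM_sub1.
Qed.

Lemma cvM_inv u g : (forall k, unip (u k)) -> unip g -> cvM u g ->
  cvM (fun k => (u k)^-1) g^-1.
Proof.
move=> uu ug hu.
have e h : unip h -> h^-1 = unipotent_pow h (- (1 : padic K)).
  by move=> hh; rewrite unipotent_powN ?unipotent_pow1 //; exact: char_padic.
rewrite e //; apply: cvM_eq (cvM_upow hu (cvK_const (- 1))) => k.
by rewrite e.
Qed.

Lemma cvM_phi (c : nat -> 'cV[padic K]_(N.+1 * N.+1)) i u g : cvM u g ->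
  cvK (fun k => phi c i (u k)) (phi c i g).
Proof.
move=> /cvM_ulog hu; rewrite /phi mxE.
have h l : cvK (fun k => mxvec (ulog (u k)) 0 l * c i l 0) (mxvec (ulog g) 0 l * c i l 0).
  apply: cvKM (cvK_const _); case/mxvec_indexP: l => a b.
  by rewrite mxvecE; apply: cvK_eq (hu a b) => k; rewrite mxvecE.
by apply: cvK_eq (cvK_sum _ h) => k; rewrite mxE.
Qed.

(** Coordinates are built from logarithms, linear functionals and powers, all polynomial; so they
    are continuous on the whole matrix space and not only on the flag. *)
Lemma cvM_coords (y : nat -> M) c i u g j : cvM u g ->
  cvK (fun k => coords y c i (u k) j) (coords y c i g j).
Proof.
elim: i u g => [|i IH] u g hu /=; first exact: cvK_const.
have hp := cvM_phi c i hu.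
case: eqP => _ //; apply: (IH (fun k => u k * ypow y i (- phi c i (u k)))).
by apply: cvMM hu _; apply: cvM_upow (cvM_const _) (cvKN hp).
Qed.

Lemma cvM_word (y : nat -> M) i (a : nat -> nat -> padic K) (b : nat -> padic K) :
  (forall j, (j < i)%N -> cvK (fun k => a k j) (b j)) ->
  cvM (fun k => word y i (a k)) (word y i b).
Proof.
elim: i => [|i IH] h.
  by rewrite word0; apply: cvM_eq (cvM_const _) => k; rewrite word0.
rewrite wordS; have hi : cvM (fun k => word y i (a k)) (word y i b).
  by apply: IH => j ji; apply: h; exact: ltnW.
have := cvMM hi (cvM_upow (cvM_const (y i)) (h i (ltnSn i))).
by apply: cvM_eq => k; rewrite wordS.
Qed.

Lemma cvM_closureP (S : set M) g :
  closure S g <-> exists u, (forall k, S (u k)) /\ cvM u g.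
Proof.
split=> [hg|[u [Su hu]] B].
  have h (k : nat) : exists h, S h /\ forall i j, abs (h i j - g i j) < k.+1%:R^-1.
    have e0 : (0 : R) < k.+1%:R^-1 by rewrite invr_gt0.
    have [h [Sh hh]] := hg _ (nbhsx_ballx g _ e0).
    exists h; split=> // i j; case: hh => _ /(_ i j).
    by rewrite ballEmdist /= /mdist /= /padic_dist -padic_absN opprB.
  have [u hu] := choice h; exists u; split=> [k|i j e e0]; first by case: (hu k).
  exists (Num.truncn e^-1) => k hk; have [_ /(_ i j)] := hu k.
  move=> /lt_le_trans; apply; rewrite -[e]invrK lef_pV2 ?posrE ?invr_gt0 //.
  apply: (@le_trans _ _ (Num.truncn e^-1).+1%:R); last by rewrite ler_nat.
  by apply: ltW; rewrite truncnS_gt.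
move=> /nbhs_ballP[e e0 he].
have : exists N0, forall k, (N0 <= k)%N -> forall i j, abs (u k i j - g i j) < e.
  have : forall (s : seq ('I_N.+1 * 'I_N.+1)), exists N0, forall k, (N0 <= k)%N ->
      forall ij, ij \in s -> abs (u k ij.1 ij.2 - g ij.1 ij.2) < e.
    elim=> [|ij s [N1 h1]]; first by exists 0%N.
    have [N2 h2] := hu ij.1 ij.2 e e0; exists (maxn N1 N2) => k.
    rewrite geq_max => /andP[k1 k2] ij'; rewrite inE => /orP[/eqP ->|]; last exact: h1.
    exact: h2.
  move=> /(_ (enum {: 'I_N.+1 * 'I_N.+1}))[N0 h]; exists N0 => k /h hk i j.
  by apply: (hk (i, j)); rewrite mem_enum.
case=> N0 h; exists (u N0); split=> //; apply: he; split=> // i j.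
have := h _ (leqnn N0) i j; rewrite ballEmdist /= /mdist /= /padic_dist.
by rewrite -padic_absN opprB.
Qed.

End PadicAbs.

(** * Finite indices counted by transversals *)

Definition quot_card (T : Type) (H : set T) (E : T -> T -> Prop) (k : nat) : Prop :=
  exists r : 'I_k -> T, (forall i, H (r i)) /\ forall h, H h -> exists! i, E (r i) h.

Section QuotCard.
Variables (T : Type) (H : set T) (E : T -> T -> Prop).
Hypothesis E_sym : forall a b, H a -> H b -> E a b -> E b a.
Hypothesis E_trans : forall a b c, H a -> H b -> H c -> E a b -> E b c -> E a c.
Hypothesis E_refl : forall a, H a -> E a a.

Lemma quot_card_fin (I : finType) (r : I -> T) : (forall i, H (r i)) ->
  (forall h, H h -> exists! i, E (r i) h) -> quot_card H E #|I|.
Proof.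
move=> hr hE; exists (fun k => r (enum_val k)); split=> // h /hE[i [hi ui]].
exists (enum_rank i); split=> [|k hk]; first by rewrite enum_rankK.
by apply: enum_val_inj; rewrite enum_rankK; exact: ui.
Qed.

(** From a family that meets every class, possibly several times, each element receives a canonical
    index through [pick]; the indices that are canonical for their own representative form the
    transversal. *)
Lemma quot_card_cover (I : finType) (r : I -> T) : (forall i, H (r i)) ->
  (forall h, H h -> exists i, E (r i) h) -> exists k, quot_card H E k.
Proof.
move=> hr hE; pose c h := [pick j | `[< E (r j) h >]].
pose J := {j : I | c (r j) == Some j}.
exists #|{: J}|; apply: (@quot_card_fin J (fun j => r (val j))) => // h hh.
have [i hi] := hE h hh.
have cE a b : H a -> H b -> E a b -> c a = c b.
  move=> ha hb ab; rewrite /c; apply: eq_pick => j; apply/asbool_equiv_eq; split=> hj.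
    exact: E_trans ab.
  by apply: E_trans (E_sym _ _ ab).
case e : (c h) => [j|]; last first.
  by move: e; rewrite /c; case: pickP => // /(_ i) /asboolP.
have hj : E (r j) h by move: e; rewrite /c; case: pickP => // j' /asboolP hj' [<-].
have ej : c (r j) == Some j by rewrite (cE _ h) // e.
exists (exist _ j ej); split=> //= -[j' ej'] /= hj'.
apply: val_inj => /=; apply: Some_inj; rewrite -e -(eqP ej').
exact/esym/cE.
Qed.

Lemma quot_card_uniq k l : quot_card H E k -> quot_card H E l -> k = l.
Proof.
have le k' l' : quot_card H E k' -> quot_card H E l' -> (k' <= l')%N.
  move=> [r [hr hE]] [r' [hr' hE']].
  have [f hf] : {f : 'I_k' -> 'I_l' | forall i, E (r' (f i)) (r i)}.
    have h i : {j | E (r' j) (r i)} by apply/cid; have [j [hj _]] := hE' _ (hr i); exists j.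
    by exists (fun i => projT1 (h i)) => i; exact: projT2 (h i).
  have fi : injective f.
    move=> i j e; have [i0 [_ u]] := hE _ (hr' (f i)).
    rewrite -(u i); last exact: E_sym.
    by apply: u; apply: E_sym => //; rewrite e.
  by have := leq_card f fi; rewrite !card_ord.
by move=> hk hl; apply/eqP; rewrite eqn_leq !le.
Qed.

End QuotCard.

Lemma quot_card_subset (T : Type) (H H' : set T) (E : T -> T -> Prop) k :
  (forall a b, H a -> H b -> E a b -> E b a) ->
  (forall a b c, H a -> H b -> H c -> E a b -> E b c -> E a c) ->
  H' `<=` H -> quot_card H E k -> exists l, quot_card H' E l.
Proof.
move=> Es Et H'H [r [hr hE]].
pose J := {i : 'I_k | `[< exists2 h, H' h & E (r i) h >]}.
have h (j : J) : {h | H' h /\ E (r (val j)) h}.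
  by apply/cid; case: j => i /= /asboolP[h' h1 h2]; exists h'.
apply: (@quot_card_cover _ H' E _ _ J (fun j => projT1 (h j))).
- by move=> a b /H'H ha /H'H hb; exact: Es.
- by move=> a b c /H'H ha /H'H hb /H'H; exact: Et.
- by move=> j; case: (projT2 (h j)).
- move=> h' hh'; have [i [hi _]] := hE _ (H'H _ hh').
  have Ji : `[< exists2 h, H' h & E (r i) h >] by apply/asboolP; exists h'.
  exists (exist _ i Ji); have [h1 h2] := projT2 (h (exist _ i Ji)).
  by apply: Et hi => //; [exact: H'H|exact: H'H|apply: Es => //; exact: H'H].
Qed.

Section Cosets.
Variable A : unitRingType.
Implicit Types H S : set A.

Definition left_equiv S (g h : A) : Prop := S (g^-1 * h).

Lemma left_equiv_sym H S a b : subgroup H -> subgroup S -> H a -> H b ->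
  left_equiv S a b -> left_equiv S b a.
Proof.
move=> sH sS ha hb /(subgroupV sS); rewrite invrM ?invrK //.
  by rewrite unitrV; exact: subgroup_unit ha.
exact: subgroup_unit hb.
Qed.

Lemma left_equiv_trans H S a b c : subgroup H -> subgroup S -> H a -> H b -> H c ->
  left_equiv S a b -> left_equiv S b c -> left_equiv S a c.
Proof.
move=> sH sS ha hb hc ab bc; have := subgroupM sS ab bc.
by rewrite mulrA mulrK //; exact: subgroup_unit hb.
Qed.

(** Pigeonhole: two of the k + 1 powers of [g] with exponents 0 to [k] lie in the same left coset,
    and their quotient is a positive power of [g] in [S]. *)
Lemma quot_card_torsion H S k g : subgroup H -> subgroup S ->
  quot_card H (left_equiv S) k -> H g -> exists2 M : nat, (0 < M)%N & S (g ^+ M).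
Proof.
move=> sH sS [r [hr hE]] hg; have ug := subgroup_unit sH hg.
have hf (i : 'I_k.+1) : {j | left_equiv S (r j) (g ^+ i)}.
  by apply/cid; have [j [hj _]] := hE _ (subgroupX i sH hg); exists j.
pose f i := projT1 (hf i).
have : ~ injective f.
  by move=> fi; have := leq_card f fi; rewrite !card_ord ltnn.
move=> ni; have [i [j [ij eij]]] : exists i j : 'I_k.+1, (i < j)%N /\ f i = f j.
  apply: contrapT => nE; apply: ni => i j e; apply: contrapT => nij; apply: nE.
  case: (ltngtP i j) => h; [by exists i, j|by exists j, i|].
  by case: nij; apply: val_inj.
have h1 := projT2 (hf i); have h2 := projT2 (hf j).
rewrite -/(f i) eij in h1.
exists (j - i)%N; first by rewrite subn_gt0.
have := left_equiv_trans sH sS (subgroupX i sH hg) (hr _) (subgroupX j sH hg)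
  (left_equiv_sym sH sS (hr _) (subgroupX i sH hg) h1) h2.
rewrite /left_equiv -{1}(subnKC (ltnW ij)) exprD mulrA mulVr ?mul1r //.
exact: unitrX.
Qed.

End Cosets.

Section AdditiveQuotient.
Variable F : zmodType.
Implicit Types A B : set F.

Definition add_subgroup A : Prop := A 0 /\ forall a b, A a -> A b -> A (a - b).

Definition add_equiv B (a b : F) : Prop := B (b - a).

Lemma add_subgroupN A a : add_subgroup A -> A a -> A (- a).
Proof. by move=> [A0 AB] ha; rewrite -[- a]add0r; exact: AB. Qed.

Lemma add_subgroupD A a b : add_subgroup A -> A a -> A b -> A (a + b).
Proof. by move=> sA ha hb; rewrite -[b]opprK; apply: sA.2 => //; exact: add_subgroupN. Qed.

Lemma add_subgroup_sum A (I : Type) (r : seq I) (f : I -> F) : add_subgroup A ->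
  (forall i, A (f i)) -> A (\sum_(i <- r) f i).
Proof.
by move=> sA h; apply: big_ind => //; [case: sA|move=> a b; exact: add_subgroupD].
Qed.

Lemma add_equiv_sym B a b : add_subgroup B -> add_equiv B a b -> add_equiv B b a.
Proof. by move=> sB /(add_subgroupN sB); rewrite opprB. Qed.

Lemma add_equiv_trans B a b c : add_subgroup B -> add_equiv B a b -> add_equiv B b c ->
  add_equiv B a c.
Proof.
by move=> sB ab bc; have := add_subgroupD sB bc ab; rewrite addrA subrK.
Qed.

(* Translation by [t] permutes the classes, so the sum of the representatives
   changes by an element of [B]. *)
Lemma quot_card_mulrn A B k t : add_subgroup A -> add_subgroup B ->
  quot_card A (add_equiv B) k -> A t -> B (t *+ k).
Proof.
move=> sA sB [r [hr hE]] ht.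
have hf i : {j | add_equiv B (r j) (t + r i)}.
  by apply/cid; have [j [hj _]] := hE _ (add_subgroupD sA ht (hr i)); exists j.
pose f i := projT1 (hf i).
have fi : injective f.
  move=> i j e; have [i0 [_ u]] := hE _ (hr i).
  have hi := projT2 (hf i); have hj := projT2 (hf j).
  rewrite -/(f i) e in hi; rewrite -(u i); last by rewrite /add_equiv subrr; case: sB.
  apply: u; have := add_equiv_trans sB (add_equiv_sym sB hj) hi.
  by rewrite /add_equiv opprD addrACA subrr add0r.
have : B (\sum_i (t + r i - r (f i))) by apply: add_subgroup_sum => // i; exact: projT2 (hf i).
rewrite sumrB big_split /= sumr_const card_ord.
have -> : \sum_(i < k) r (f i) = \sum_(i < k) r i by rewrite [RHS](reindex_inj fi).
by rewrite addrK.
Qed.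

End AdditiveQuotient.

Lemma divz_ratE (w : int) (k : nat) :
  w%:~R = (w %/ k)%Z%:~R * k%:R + (w %% k)%Z%:~R :> rat.
Proof. by rewrite {1}(divz_eq w k) intrD intrM. Qed.

(** The multiples of [k] lie in [B] by [quot_card_mulrn], so the residues 0, ..., k - 1 meet all [k]
    classes. Hence they meet each exactly once, and an element of [B], being in the class of 0, has
    residue 0. *)
Lemma quot_card_int (B : set rat) (k : nat) :
  add_subgroup B -> (forall t, B t -> exists z : int, t = z%:~R) ->
  quot_card [set t : rat | exists z : int, t = z%:~R] (add_equiv B) k ->
  (0 < k)%N /\ forall t, B t <-> exists z : int, t = z%:~R * k%:R.
Proof.
move=> sB Bint hq.
have sZ : add_subgroup [set t : rat | exists z : int, t = z%:~R].
  split; first by exists 0.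
  by move=> _ _ [a ->] [b ->]; exists (a - b); rewrite intrB.
have k0 : (0 < k)%N.
  by case: hq => r [_ hE]; have [i _] := hE 0 sZ.1; exact: leq_ltn_trans (ltn_ord i).
have kB (z : int) : B (z%:~R * k%:R).
  by rewrite mulr_natr; apply: (quot_card_mulrn sZ sB hq); exists z.
split=> // t; split=> [Bt|[z ->]]; last exact: kB.
have [z ez] := Bint t Bt; have [r [hr hE]] := hq.
have hf (i : 'I_k) : {j | add_equiv B (r j) i%:R}.
  by apply/cid; have [|j [hj _]] := hE i%:R; [exists i%:Z|exists j].
pose f i := projT1 (hf i).
have fsurj j : exists i, f i = j.
  have [w ew] := hr j.
  have wk : (`|(w %% k)%Z| < k)%N.
    by rewrite -ltz_nat gez0_abs ?modz_ge0 ?ltz_pmod // -?lt0n // eqz_nat -lt0n.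
  exists (Ordinal wk); have [|j0 [_ u]] := hE (Ordinal wk)%:R; first by exists (Ordinal wk : nat)%:Z.
  rewrite -(u (f (Ordinal wk))); last exact: projT2 (hf (Ordinal wk)).
  apply: u; rewrite /add_equiv /= ew.
  have -> : `|(w %% k)%Z|%:R = (w %% k)%Z%:~R :> rat.
    by rewrite -[LHS]/((`|(w %% k)%Z|%N%:Z)%:~R) gez0_abs // modz_ge0 // eqz_nat -lt0n.
  have -> : (w %% k)%Z%:~R - w%:~R = (- (w %/ k)%Z)%:~R * k%:R :> rat.
    by rewrite (divz_ratE w k) mulrNz; ring.
  exact: kB.
have [g gK] : {g : 'I_k -> 'I_k | cancel g f}.
  have h j : {i | f i = j} by apply/cid.
  by exists (fun j => projT1 (h j)) => j; exact: projT2 (h j).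
have fi : injective f.
  have [g' fg gf] : bijective g by apply: injF_bij; exact: can_inj gK.
  by move=> a b e; rewrite -[a]gf -[b]gf !gK in e *; rewrite e.
have zk : (`|(z %% k)%Z| < k)%N.
  by rewrite -ltz_nat gez0_abs ?modz_ge0 ?ltz_pmod // -?lt0n // eqz_nat -lt0n.
have e0 : f (Ordinal zk) = f (Ordinal k0).
  have [j0 [_ u]] := hE 0 sZ.1.
  have e1 : f (Ordinal k0) = j0 by apply/esym/u; exact: (projT2 (hf (Ordinal k0))).
  rewrite e1; apply/esym/u.
  apply: (add_equiv_trans sB (projT2 (hf (Ordinal zk)))).
  rewrite /add_equiv sub0r /=; apply: add_subgroupN => //.
  have -> : `|(z %% k)%Z|%:R = (z %% k)%Z%:~R :> rat.
    by rewrite -[LHS]/((`|(z %% k)%Z|%N%:Z)%:~R) gez0_abs // modz_ge0 // eqz_nat -lt0n.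
  have -> : (z %% k)%Z%:~R = t - (z %/ k)%Z%:~R * k%:R :> rat.
    by rewrite ez (divz_ratE z k); ring.
  by apply: sB.2.
have /(congr1 val) /= z0 := fi _ _ e0.
exists (z %/ k)%Z; rewrite ez {1}(divz_ratE z k).
by move/eqP: z0; rewrite absz_eq0 => /eqP ->; rewrite addr0.
Qed.

(** By [quot_card_mulrn] the elements of [A] are integral multiples of [b / k]. The [k]
    representatives have distinct numerators modulo [k], so every residue occurs and every such
    multiple belongs to [A]. *)
Lemma quot_card_super (A : set rat) (b : rat) (k : nat) : b != 0 ->
  add_subgroup A -> (forall z : int, A (z%:~R * b)) ->
  quot_card A (add_equiv [set t | exists z : int, t = z%:~R * b]) k ->
  (0 < k)%N /\ forall t, A t <-> exists z : int, t = z%:~R * (b / k%:R).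
Proof.
move=> b0 sA bA; pose B : set rat := [set t | exists z : int, t = z%:~R * b].
rewrite -/B => hq.
have sB : add_subgroup B.
  split; first by exists 0; rewrite mul0r.
  by move=> _ _ [u ->] [v ->]; exists (u - v); rewrite intrB mulrBl.
have k0 : (0 < k)%N.
  by case: hq => r [_ hE]; have [i _] := hE 0 sA.1; exact: leq_ltn_trans (ltn_ord i).
have k0' : k%:R != 0 :> rat by rewrite pnatr_eq0 -lt0n.
have hA t : A t -> exists z : int, t = z%:~R * (b / k%:R).
  move=> /(quot_card_mulrn sA sB hq)[z hz]; exists z.
  by rewrite mulrA -hz -[t *+ k]mulr_natr mulfK.
split=> // t; split=> [/hA//|[z ->]].
have [r [hr hE]] := hq.
have hw i : {w : int | r i = w%:~R * (b / k%:R)} by apply/cid; exact: hA.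
pose w i := projT1 (hw i); have wE i : r i = (w i)%:~R * (b / k%:R) := projT2 (hw i).
have wk i : (`|(w i %% k)%Z| < k)%N.
  by rewrite -ltz_nat gez0_abs ?modz_ge0 ?ltz_pmod // -?lt0n // eqz_nat -lt0n.
pose f i := Ordinal (wk i).
have modE i : `|(w i %% k)%Z|%N%:Z = (w i %% k)%Z by rewrite gez0_abs // modz_ge0 // eqz_nat -lt0n.
have fi : injective f.
  move=> i j /(congr1 val) /= /(congr1 Posz); rewrite !modE => e.
  have [j0 [_ u]] := hE _ (hr j).
  rewrite -(u j); last by exists 0; rewrite subrr mul0r.
  rewrite -(u i) //; exists ((w j %/ k)%Z - (w i %/ k)%Z).
  rewrite !wE (divz_ratE (w j) k) (divz_ratE (w i) k) e intrB.
  by field.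
have [g fg gf] := injF_bij fi.
have zk : (`|(z %% k)%Z| < k)%N.
  by rewrite -ltz_nat gez0_abs ?modz_ge0 ?ltz_pmod // -?lt0n // eqz_nat -lt0n.
have := congr1 (fun i => (val i)%:Z) (gf (Ordinal zk)); rewrite /= modE.
rewrite gez0_abs ?modz_ge0 // ?eqz_nat -?lt0n // => e.
have -> : z%:~R * (b / k%:R) = r (g (Ordinal zk)) + ((z %/ k)%Z - (w (g (Ordinal zk)) %/ k)%Z)%:~R * b.
  rewrite wE (divz_ratE (w (g (Ordinal zk))) k) e {1}(divz_ratE z k) intrB.
  by field.
by apply: add_subgroupD.
Qed.

(** * Indices and powers along the flag *)

Section IndexFiltration.
Variables (F : fieldType) (N : nat).
Hypothesis charF : [pchar F] =i pred0.
Notation M := 'M[F]_N.+1.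
Variables (n : nat) (y : nat -> M).
Hypothesis y_unip : forall i, unip (y i).
Hypothesis y_comm : forall i j, (i < n)%N -> (j < n)%N ->
  generated_subgroup [set y k | k in [set k | (k < i)%N]]
    (y j * y i * (y j)^-1 * (y i)^-1).
Variables (c : nat -> 'cV[F]_(N.+1 * N.+1)).
Hypothesis c_diag : forall i, (i < n)%N -> mxvec (ulog (y i)) *m c i = 1%:M.
Hypothesis c_low : forall i j, (i < n)%N -> (j < i)%N ->
  mxvec (ulog (y j)) *m c i = 0.

Let sF i : (i <= n)%N -> subgroup (flag y i) :=
  subgroup_flag charF y_unip y_comm (leqnn n) c_diag c_low (i := i).
Let phM := phiM charF y_unip y_comm (leqnn n) c_diag c_low.
Let phV := phiV charF y_unip y_comm (leqnn n) c_diag c_low.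
Let ph0 := flag_phi0 charF y_unip y_comm (leqnn n) c_diag c_low.
Let phF := phi_flag charF y_unip y_comm (leqnn n) c_diag c_low.

Definition flag_pi (D : set M) (i : nat) : set F :=
  [set t | exists g, [/\ D g, flag y i.+1 g & phi c i g = t]].

Lemma subgroup_setI (A : unitRingType) (H S : set A) : subgroup H -> subgroup S ->
  subgroup (H `&` S).
Proof.
move=> sH sS; split=> [g [hg _]||g h [g1 g2] [h1 h2]|g [g1 g2]].
- exact: subgroup_unit hg.
- by split; exact: subgroup1.
- by split; exact: subgroupM.
- by split; exact: subgroupV.
Qed.

Lemma flag_pi_subgroup D i : subgroup D -> (i < n)%N -> add_subgroup (flag_pi D i).
Proof.
move=> sD hi; split.
  exists 1; split; first exact: subgroup1.
    exact: subgroup1 (sF hi).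
  by apply: phF => //; exact: subgroup1 (sF (ltnW hi)).
move=> _ _ [g [Dg fg <-]] [h [Dh fh <-]]; exists (g * h^-1); split.
- by apply: subgroupM => //; exact: subgroupV.
- by apply: (subgroupM (sF hi)) => //; exact: (subgroupV (sF hi)).
- by rewrite phM // ?phV //; exact: (subgroupV (sF hi)).
Qed.

Variables D D' : set M.
Hypothesis sD : subgroup D.
Hypothesis sD' : subgroup D'.
Hypothesis D'D : D' `<=` D.
Hypothesis Dn : D `<=` flag y n.

Let E := left_equiv D'.
Lemma flag_piP i g : flag_pi D' i (phi c i g) -> D g -> flag y i.+1 g -> (i < n)%N ->
  exists d z, [/\ D' d, flag y i.+1 d, D z, flag y i z & g = d * z].
Proof.
move=> [d [hd fd e]] Dg fg hi; exists d, (d^-1 * g).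
have ud := subgroup_unit sD' hd; split=> //.
- by apply: subgroupM => //; apply: subgroupV => //; exact: D'D.
- have fdV := subgroupV (sF hi) fd.
  apply: ph0 => //; first exact: (subgroupM (sF hi)).
  by rewrite phM // phV // e addNr.
- by rewrite mulrA mulrV // mul1r.
Qed.

(** A transversal consists of the products u v, with u lifting the representatives in the quotient
    and v running over the representatives one level below. The order matters, as [D'] need not be
    normal and the classes are left cosets. *)
Lemma quot_card_step i a b : (i < n)%N ->
  quot_card (D `&` flag y i) E a ->
  quot_card (flag_pi D i) (add_equiv (flag_pi D' i)) b ->
  quot_card (D `&` flag y i.+1) E (a * b).
Proof.
move=> hi [v [hv vE]] [t [ht tE]].
have hu j : {g | [/\ D g, flag y i.+1 g & phi c i g = t j]} by apply/cid; exact: ht.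
pose u j := projT1 (hu j).
have [uD uf ut] : [/\ forall j, D (u j), forall j, flag y i.+1 (u j) & forall j, phi c i (u j) = t j].
  by split=> j; case: (projT2 (hu j)).
have uu j : u j \is a GRing.unit by exact: subgroup_unit (uD j).
have vD k : D (v k) by case: (hv k).
have vf k : flag y i (v k) by case: (hv k).
have vu k : v k \is a GRing.unit by exact: subgroup_unit (vD k).
have wid g : flag y i g -> flag y i.+1 g by apply: (flag_widen charF y_unip).
have -> : (a * b = #|{: 'I_b * 'I_a}|)%N by rewrite card_prod !card_ord mulnC.
apply: (@quot_card_fin _ _ _ _ (fun jk => u jk.1 * v jk.2)) => [[j k]|h [Dh fh]] /=.
  split; first exact: subgroupM.
  by apply: (subgroupM (sF hi)) => //; exact: wid.
have [j [hj ju]] := tE (phi c i h) (ex_intro _ h (And3 Dh fh erefl)).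
have fuV := subgroupV (sF hi) (uf j).
have Duh : D ((u j)^-1 * h) by apply: subgroupM => //; exact: subgroupV.
have fuh : flag y i.+1 ((u j)^-1 * h) by exact: (subgroupM (sF hi)).
have puh : phi c i ((u j)^-1 * h) = phi c i h - t j by rewrite phM // phV // ut addrC.
(* [flag_piP] splits off the factor from [D'] on the left. Applied to the inverse, it yields this
   factor on the right, where a left coset absorbs it. *)
have hj' : flag_pi D' i (phi c i ((u j)^-1 * h)^-1).
  rewrite phV // puh opprB; rewrite -opprB; apply: add_subgroupN => //.
  exact: flag_pi_subgroup.
have [d [z [D'd fd Dz fz e]]] := flag_piP hj' (subgroupV sD Duh) (subgroupV (sF hi) fuh) hi.
have ud := subgroup_unit sD' D'd; have uz := subgroup_unit sD Dz.
have e' : h = u j * (z^-1 * d^-1).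
  rewrite -invrM // -e invrK mulrA mulrV // mul1r //.
have [k [hk ku]] := vE z^-1 (conj (subgroupV sD Dz) (subgroupV (sF (ltnW hi)) fz)).
exists (j, k); split=> /=.
  rewrite /E /left_equiv e' invrM // !mulrA mulrVK //.
  by apply: (subgroupM sD' hk); exact: subgroupV.
move=> [j' k'] /= hjk.
have Dhjk : D (u j' * v k') by exact: subgroupM.
have jj' : j = j'.
  apply: ju; exists ((u j' * v k')^-1 * h); split=> //.
    apply: (subgroupM (sF hi)) => //; apply: (subgroupV (sF hi)).
    by apply: (subgroupM (sF hi)) => //; exact: wid.
  have fuv : flag y i.+1 (u j' * v k') by apply: (subgroupM (sF hi)) => //; exact: wid.
  have fuvV := subgroupV (sF hi) fuv.
  have e1 : phi c i (u j' * v k') = t j'.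
    by rewrite phM ?ut ?phF ?addr0 //; exact: wid.
  by rewrite phM // phV // e1 addrC.
congr (_, _) => //; apply: ku.
move: hjk; rewrite -jj' /E /left_equiv e' invrM // !mulrA mulrVK //.
by move=> /(subgroupM sD')/(_ D'd); rewrite mulrVK.
Qed.

Lemma index_filtration k : quot_card D E k ->
  exists b : nat -> nat,
    (forall i, (i < n)%N -> quot_card (flag_pi D i) (add_equiv (flag_pi D' i)) (b i)) /\
    k = (\prod_(i < n) b i)%N.
Proof.
move=> hq.
have Es g h : D g -> D h -> E g h -> E h g by exact: left_equiv_sym.
have Et f g h : D f -> D g -> D h -> E f g -> E g h -> E f h.
  by move=> ? ? ?; exact: (left_equiv_trans sD sD').
have hi_card i : {l | quot_card (D `&` flag y i) E l}.
  by apply/cid; apply: (quot_card_subset Es Et _ hq) => g [].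
pose l i := projT1 (hi_card i).
have hl i : quot_card (D `&` flag y i) E (l i) := projT2 (hi_card i).
have hb i : {b | (i < n)%N -> quot_card (flag_pi D i) (add_equiv (flag_pi D' i)) b}.
  apply/cid; case: (ltnP i n) => [hi|_]; last by exists 0%N.
  have sP := flag_pi_subgroup sD' hi.
  suff [b hb] : exists b, quot_card (flag_pi D i) (add_equiv (flag_pi D' i)) b by exists b.
  have [r [hr hE]] := hl i.+1.
  apply: (@quot_card_cover _ _ _ _ _ _ (fun j => phi c i (r j))).
  - by move=> a b _ _; exact: add_equiv_sym.
  - by move=> a b d _ _ _; exact: add_equiv_trans.
  - by move=> j; exists (r j); case: (hr j).
  - move=> _ [g [Dg fg <-]]; have [j [hj _]] := hE g (conj Dg fg).
    have [Dr fr] := hr j; have frV := subgroupV (sF hi) fr.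
    exists j, ((r j)^-1 * g); split=> //; first exact: (subgroupM (sF hi)).
    by rewrite phM // phV // addrC.
pose b i := projT1 (hb i); exists b; split=> [i|]; first exact: (projT2 (hb i)).
have h i : (i <= n)%N -> l i = (\prod_(j < i) b j)%N.
  elim: i => [|i IH] hi.
    rewrite big_ord0; apply: (quot_card_uniq _ (hl 0%N)).
      by move=> g h [Dg _] [Dh _]; exact: Es.
    exists (fun=> 1); split=> [_|h [Dh [a ->]]].
      by split; [exact: subgroup1|exact: subgroup1 (sF (leq0n n))].
    exists ord0; split=> [|j _]; last by rewrite [j]ord1.
    by rewrite word0 /E /left_equiv invr1 mul1r; exact: subgroup1.
  rewrite big_ord_recr /= -IH ?(ltnW hi) //.
  apply: (quot_card_uniq _ (hl i.+1)); last first.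
    by apply: quot_card_step => //; exact: (projT2 (hb i) hi).
  by move=> g h [Dg _] [Dh _]; exact: Es.
rewrite -h //; apply: (quot_card_uniq _ hq) => //.
suff <- : D `&` flag y n = D by [].
by apply/seteqP; split=> [g []|g Dg]; last by split=> //; exact: Dn.
Qed.

(** Modulo [flag i] the element [z] is central, so the power of the product is the product of the
    powers up to an element of [flag i]; the correction stays in [D] because it is made of
    conjugates and commutators. *)
Lemma flag_powM i (b : nat) d z : (i < n)%N -> D d -> D z -> flag y i.+1 z ->
  exists w, [/\ D w, flag y i w & (d * z) ^+ b = d ^+ b * z ^+ b * w].
Proof.
move=> hi Dd Dz fz; have fd := Dn Dd; have sFi := sF (ltnW hi); have sFn := sF (leqnn n).
have ud := subgroup_unit sD Dd; have uz := subgroup_unit sD Dz.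
have cj g h : D g -> flag y i h -> flag y i (g * h * g^-1).
  move=> /Dn; exact: (flag_conj_stable charF y_unip y_comm (leqnn n) c_diag c_low (ltnW hi) (leqnn n)).
elim: b => [|b [w [Dw fw e]]].
  by exists 1; rewrite !expr0 !mulr1; split=> //; [exact: subgroup1|exact: subgroup1].
have DV h : D h -> D h^-1 by exact: subgroupV.
pose w' := z^-1 * ((z ^- b * d^-1 * z ^+ b * d) * (d^-1 * w * d)) * z.
exists w'; split.
- have Db : D (z ^+ b) by exact: subgroupX.
  by do !apply: (subgroupM sD) => //; exact: DV.
- rewrite /w' -[X in _ * X]invrK; apply: (cj); first exact: DV.
  apply: (subgroupM sFi).
    have := flag_comm charF y_unip y_comm (leqnn n) c_diag c_low hi (leqnn n)
      (subgroupV sFn fd) (subgroupV (sF hi) (subgroupX b (sF hi) fz)).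
    by rewrite !invrK.
  by have := cj d^-1 w (DV d Dd) fw; rewrite invrK.
- rewrite exprSr e /w' [d ^+ b.+1]exprSr [z ^+ b.+1]exprSr !mulrA.
  by rewrite !(mulrK, mulrVK) ?unitrX.
Qed.

(** For a subgroup that is not normal, the index need not be an exponent. Here nilpotency helps: at
    each level of the flag, raising to the index of that quotient moves the coordinate into the
    image of [D'], and the factor from [D'] is split off. The product of these indices is [k]. *)
Lemma index_pow k g : quot_card D E k -> D g -> D' (g ^+ k).
Proof.
move=> /index_filtration[b [hb ->]] Dg.
suff h i : (i <= n)%N -> exists d z, [/\ D' d, D z, flag y (n - i) z &
    g ^+ (\prod_(j < i) b (n - j.+1)) = d * z].
  have [d [z [D'd Dz [a ez] e]]] := h n (leqnn n).
  (* The levels were treated from the top of the flag down, whereas the product of indices is taken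
     upwards. *)
  rewrite (reindex_inj rev_ord_inj) /= e ez subnn word0 mulr1 //.
elim: i => [|i IH] hi.
  exists 1, g; rewrite subn0 big_ord0 expr1 mul1r; split=> //; first exact: subgroup1.
  exact: Dn.
have [d [z [D'd Dz fz e]]] := IH (ltnW hi).
have ej : (n - i = (n - i.+1).+1)%N by lia.
set j := (n - i.+1)%N in ej *; have hj : (j < n)%N by rewrite /j; lia.
rewrite ej in fz; rewrite big_ord_recr /= -/j exprM e.
have [w [Dw fw ->]] := flag_powM (b j) hj (D'D D'd) Dz fz.
have Dzb : D (z ^+ b j) by exact: subgroupX.
have fzb : flag y j.+1 (z ^+ b j) := subgroupX _ (sF hj) fz.
have hz : flag_pi D' j (phi c j (z ^+ b j)).
  have -> : phi c j (z ^+ b j) = phi c j z *+ b j.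
    have uz := flag_unip y_unip fz.
    by rewrite -(unipotent_pow_nat charF _ uz) (phi_upow charF) // mulr_natl.
  apply: (quot_card_mulrn (flag_pi_subgroup sD hj) (flag_pi_subgroup sD' hj) (hb j hj)).
  by exists z.
have [d' [z' [D'd' _ Dz' fz' ->]]] := flag_piP hz Dzb fzb hj.
exists (d ^+ b j * d'), (z' * w); split.
- by apply: subgroupM => //; exact: subgroupX.
- exact: subgroupM.
- by apply: (subgroupM (sF (ltnW hj))).
- by rewrite !mulrA.
Qed.

End IndexFiltration.

Lemma mmap_rmorph (k : nat) (S S' : comNzRingType) (f : {rmorphism S -> S'})
    (h : 'I_k -> S) (P : mpoly.mpoly k int) :
  f (mpoly.mmap (intr : int -> S) h P) = mpoly.mmap (intr : int -> S') (f \o h) P.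
Proof.
rewrite /mpoly.mmap rmorph_sum; apply: eq_bigr => i _.
rewrite rmorphM rmorph_int; congr (_ * _).
by rewrite /mpoly.mmap1 rmorph_prod; apply: eq_bigr => j _; rewrite rmorphXn.
Qed.

Lemma mmap_eq (k : nat) (S : comNzRingType) (h h' : 'I_k -> S) (P : mpoly.mpoly k int) :
  h =1 h' -> mpoly.mmap (intr : int -> S) h P = mpoly.mmap (intr : int -> S) h' P.
Proof.
move=> hh; rewrite /mpoly.mmap; apply: eq_bigr => i _; congr (_ * _).
by rewrite /mpoly.mmap1; apply: eq_bigr => j _; rewrite hh.
Qed.

(** * Rational lattices *)

Section Localization.
Variable p : nat.
Hypothesis pp : prime p.

Definition zinvp (t : rat) : Prop := exists l (z : int), t * p%:R ^+ l = z%:~R.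

Let p0 : p%:R != 0 :> rat.
Proof. by rewrite pnatr_eq0 -lt0n prime_gt0. Qed.

Lemma zinvp_int (z : int) : zinvp z%:~R.
Proof. by exists 0%N, z; rewrite expr0 mulr1. Qed.

Lemma zinvpD s t : zinvp s -> zinvp t -> zinvp (s + t).
Proof.
move=> [l [z hz]] [l' [z' hz']]; exists (l + l')%N, (z * p%:Z ^+ l' + z' * p%:Z ^+ l).
rewrite intrD !intrM -hz -hz' !rmorphXn /= exprD.
by rewrite -[(p%:Z)%:~R]/(p%:R); ring.
Qed.

Lemma zinvpM s t : zinvp s -> zinvp t -> zinvp (s * t).
Proof.
move=> [l [z hz]] [l' [z' hz']]; exists (l + l')%N, (z * z').
by rewrite intrM -hz -hz' exprD; ring.
Qed.

Lemma zinvpN s : zinvp s -> zinvp (- s).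
Proof. by move=> [l [z hz]]; exists l, (- z); rewrite mulNr hz mulrNz. Qed.

Lemma zinvp_sum (I : Type) (r : seq I) (P : pred I) (f : I -> rat) :
  (forall i, P i -> zinvp (f i)) -> zinvp (\sum_(i <- r | P i) f i).
Proof.
by move=> h; apply: big_ind => //; [exact: zinvp_int 0|exact: zinvpD].
Qed.

Lemma zinvp_divp s l : zinvp (s * p%:R ^+ l) -> zinvp s.
Proof.
by move=> [l' [z hz]]; exists (l + l')%N, z; rewrite exprD mulrA.
Qed.

Variable N : nat.
Notation M := 'M[rat]_N.+1.

Definition zinvp_mx (g : M) : Prop := forall i j, zinvp (g i j).

Lemma zinvp_mxM g h : zinvp_mx g -> zinvp_mx h -> zinvp_mx (g * h).
Proof.
by move=> hg hh i j; rewrite -mulmxE mxE; apply: zinvp_sum => k _; apply: zinvpM.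
Qed.

Lemma zinvp_mx_int (g : 'M[int]_N.+1) : zinvp_mx (map_mx intr g).
Proof. by move=> i j; rewrite mxE; exact: zinvp_int. Qed.

Lemma unip_entry (g : M) (i j : 'I_N.+1) : unip g -> (i <= j)%N -> g i j = (i == j)%:R.
Proof.
move=> [/is_trig_mxP gt g1] ij; case: eqVneq ij => [->|ne] ij; first by rewrite g1.
by rewrite gt // ltn_neqAle ij andbT.
Qed.

(* On the [d]-th subdiagonal, [g ^+ k] agrees with [g *+ k] up to a polynomial
   expression in the entries closer to the diagonal. *)
Lemma unip_pow_entry (g : M) (d k : nat) : unip g -> (0 < d)%N ->
  (forall i j : 'I_N.+1, (i < j + d)%N -> zinvp (g i j)) ->
  (forall i j : 'I_N.+1, (i < j + d)%N -> zinvp ((g ^+ k) i j)) /\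
  (forall i j : 'I_N.+1, i = (j + d)%N :> nat -> zinvp ((g ^+ k) i j - g i j *+ k)).
Proof.
move=> ug d0 hg; elim: k => [|k [IH1 IH2]].
  split=> i j ij; first by rewrite mxE; exact: (zinvp_int (i == j)).
  by rewrite mulr0n subr0 mxE; exact: (zinvp_int (i == j)).
have uk := unipX k ug.
have low (h h' : M) (i j l : 'I_N.+1) : unip h -> unip h' ->
    (forall i j : 'I_N.+1, (i < j + d)%N -> zinvp (h i j)) ->
    (forall i j : 'I_N.+1, (i < j + d)%N -> zinvp (h' i j)) ->
    (i <= j + d)%N -> l != i -> l != j -> zinvp (h i l * h' l j).
  move=> uh uh' zh zh' ijd li lj.
  have [il|li'] := ltnP i l.
    rewrite (unip_entry uh (ltnW il)) (_ : (i == l) = false) ?mul0r; first exact: (zinvp_int 0).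
    by rewrite eq_sym (negPf li).
  have [lj'|jl] := ltnP l j.
    rewrite (unip_entry uh' (ltnW lj')) (negPf lj) mulr0; exact: (zinvp_int 0).
  have ne1 : (l != i :> nat) by []. 
  have ne2 : (l != j :> nat) by [].
  by apply: zinvpM; [apply: zh|apply: zh']; lia.
split=> i j ij.
  rewrite exprSr -mulmxE mxE; apply: zinvp_sum => l _.
  have [->|li] := eqVneq l i.
    by apply: zinvpM; [rewrite (unip_entry uk) // eqxx; exact: (zinvp_int 1)|exact: hg].
  have [->|lj] := eqVneq l j.
    by apply: zinvpM; [exact: IH1|rewrite (unip_entry ug) // eqxx; exact: (zinvp_int 1)].
  by apply: low => //; lia.
have nij : j != i by apply/eqP => e; move: ij; rewrite e; lia.
rewrite exprSr -mulmxE mxE (bigD1 i) //= (bigD1 j) //=.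
rewrite (unip_entry uk (leqnn i)) (unip_entry ug (leqnn j)) !eqxx mul1r mulr1.
rewrite mulrSr.
have -> (s : rat) : g i j + ((g ^+ k) i j + s) - (g i j *+ k + g i j) =
   ((g ^+ k) i j - g i j *+ k) + s by ring.
apply: zinvpD; first exact: IH2.
by apply: zinvp_sum => l /andP[li lj]; apply: low => //; rewrite ij.
Qed.

(** Induction on the subdiagonals: on the next one, the entries of the power are p^k times those of
    [g] up to elements of Z[1/p], and division by p^k is possible in that ring. *)
Lemma zinvp_mx_root (g : M) (k : nat) : unip g -> zinvp_mx (g ^+ (p ^ k)) -> zinvp_mx g.
Proof.
move=> ug hk.
suff h d : forall i j : 'I_N.+1, (i < j + d.+1)%N -> zinvp (g i j).
  by move=> i j; apply: (h N); have := ltn_ord i; lia.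
elim: d => [|d IH] i j ij.
  have ij' : (i <= j)%N by lia.
  by rewrite (unip_entry ug ij'); exact: (zinvp_int (i == j)).
have [lt|] := ltnP i (j + d.+1); first exact: IH.
move=> le; have e : i = (j + d.+1)%N :> nat by lia.
have [_ h2] := unip_pow_entry (p ^ k) ug (ltn0Sn d) IH.
apply: (@zinvp_divp _ k); rewrite -natrX mulr_natr.
have -> : g i j *+ p ^ k = (g ^+ (p ^ k)) i j - ((g ^+ (p ^ k)) i j - g i j *+ p ^ k) by ring.
by apply: zinvpD; [exact: hk|apply: zinvpN; exact: h2].
Qed.

End Localization.

Section RationalLattice.
Variables (m : nat) (G : unipotentZGroup m) (n : nat) (x : 'I_n -> 'M[int]_m.+1).
Hypothesis hx : malcev_basis G x.
Local Notation y := (xF x rat).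

(** An equation of G evaluated on the powers of a generator is a polynomial in the exponent. It
    vanishes at natural exponents, where the powers are integral points, hence identically. *)
Lemma flag_points (F : fieldType) (charF : [pchar F] =i pred0) :
  flag (xF x F) n `<=` points G F.
Proof.
have sG : subgroup (points G F) := @zequations_group _ G F charF.
have hy i a : points G F (ypow (xF x F) i a).
  have ui := unip_xF hx F i.
  have [ut u1] := unip_upow a ui; split=> // P hP.
  have [_ [_ [Q [hQ _ _]]]] := polyfam_upow charF ui.
  pose q := mpoly.mmap (intr : int -> {poly F}) (fun k => mxvec Q 0 k) P.
  have qE b : mpoly.mmap (intr : int -> F) (fun k => mxvec (ypow (xF x F) i b) 0 k) P = q.[b].
    rewrite -[RHS]/(horner_eval b q) mmap_rmorph; apply: mmap_eq => k /=.
    by rewrite /ypow hQ -map_mxvec mxE.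
  suff q0 : q = 0 by rewrite qE q0 horner0.
  apply: (poly_natr_eq0 charF) => k; rewrite -qE /ypow unipotent_pow_nat //.
  have [_ _ h] := subgroupX k (points_int_subgroup hx) (xn_points hx i).
  have := h P hP => /(congr1 (intr : int -> F)); rewrite mmap_rmorph => e.
  apply: etrans e; apply: mmap_eq => j /=.
  by rewrite /xF -(rmorphXn (map_mx (intr : int -> F))) /= -map_mxvec mxE.
move=> _ [a ->]; suff h k : points G F (word (xF x F) k a) by exact: h.
elim: k => [|i IH]; first by rewrite word0; exact: subgroup1.
by rewrite wordS; apply: (subgroupM sG).
Qed.

Definition gammaQ : set 'M[rat]_m.+1 := [set map_mx intr g | g in points G int].

Lemma subgroup_gammaQ : subgroup gammaQ.
Proof.
have sG := points_int_subgroup hx.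
split.
- by move=> _ [g hg <-] /=; exact/unip_unit/unip_map/points_unip/hg.
- by exists 1; [exact: subgroup1|rewrite map_mx1].
- move=> _ _ [g hg <-] [h hh <-]; exists (g * h); first exact: (subgroupM sG).
  by rewrite -!mulmxE map_mxM.
- move=> _ [g hg <-]; exists g^-1; first exact: (subgroupV sG).
  rewrite (rmorphV (map_mx (intr : int -> rat))) //.
  exact: subgroup_unit sG hg.
Qed.

Lemma gammaQ_word g : gammaQ g -> exists k : nat -> int, g = word y n (fun j => (k j)%:~R).
Proof.
move=> [h hh <-]; apply: (malcev_term_word hx char_rat (leqnn n)).
by rewrite (malcev_term_full hx).
Qed.

Lemma gammaQ_flag : gammaQ `<=` flag y n.
Proof. by move=> g /gammaQ_word[k ->]; exists (fun j => (k j)%:~R). Qed.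

Lemma y_gammaQ i : gammaQ (y i).
Proof. by exists (xn x i) => //; exact: xn_points. Qed.

Lemma flag_int_gammaQ g : flag y n g -> (forall i j, exists z : int, g i j = z%:~R) ->
  gammaQ g.
Proof.
move=> fg gint; have [z hz] : {z : 'I_m.+1 -> 'I_m.+1 -> int | forall i j, g i j = (z i j)%:~R}.
  have h i j : {z : int | g i j = z%:~R} by apply/cid.
  by exists (fun i j => projT1 (h i j)) => i j; exact: projT2 (h i j).
exists (\matrix_(i, j) z i j); last by apply/matrixP => i j; rewrite !mxE hz.
have [/is_trig_mxP gt g1 hP] := flag_points char_rat fg; split.
- apply/is_trig_mxP => i j ij; rewrite mxE; apply/eqP; rewrite -(eqr_int rat) -hz.
  by rewrite gt.
- by move=> i; rewrite mxE; apply/eqP; rewrite -(eqr_int rat) -hz g1.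
- move=> P /hP h; apply/eqP; rewrite -(eqr_int rat) -[_%:~R]/(intmul _ _) mmap_rmorph.
  rewrite -[0%:~R]/(0 : rat) -h; apply/eqP; apply: mmap_eq => k /=.
  by case/mxvec_indexP: k => i j; rewrite !mxvecE mxE -hz.
Qed.

Variable c : nat -> 'cV[rat]_(m.+1 * m.+1).
Hypothesis c_diag : forall i, (i < n)%N -> mxvec (ulog (y i)) *m c i = 1%:M.
Hypothesis c_low : forall i j, (i < n)%N -> (j < i)%N ->
  mxvec (ulog (y j)) *m c i = 0.

Let uy := unip_xF hx rat.
Let cy := @xF_comm _ _ _ _ hx rat.

Lemma flag_pi_gammaQ i t : (i < n)%N ->
  flag_pi y c gammaQ i t <-> exists z : int, t = z%:~R.
Proof.
move=> hi; have phE b := phi_mulr char_rat uy cy (leqnn n) c_diag c_low b hi.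
have f1 : flag y i 1 := subgroup1 (subgroup_flag char_rat uy cy (leqnn n) c_diag c_low (ltnW hi)).
split=> [[g [hg fg <-]]|[z ->]]; last first.
  exists (ypow y i z%:~R); split.
  - rewrite (xpow_int hx char_rat); exists (xn x i ^ z) => //.
    exact: subgroupXz (points_int_subgroup hx) (xn_points hx i).
  - by apply/flagSP; exists 1, z%:~R; rewrite mul1r.
  - by rewrite -[ypow _ _ _]mul1r phE.
have [k ek] := gammaQ_word hg; exists (k i).
have [a ea] := fg.
have := wordK char_rat uy cy (leqnn n) c_diag c_low (fun j => (k j)%:~R) (leqnn n) hi.
have e : phi c i g = a i by rewrite ea wordS phE //; exists a.
move=> <-; rewrite -ek e ea.
rewrite (word_pad char_rat uy a hi).
rewrite (wordK char_rat uy cy (leqnn n) c_diag c_low _ (leqnn n) hi) ltnSn.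
by [].
Qed.

(** The level indices of the intersection in [D] and in G(Z) divide p^k, so they are powers p^(a1)
    and p^(a2). The image of the intersection is generated by p^(a2) and that of [D] by p^(a2 - a1);
    hence [e' *+ 2 - e] is a1 + a2 at each level. *)
Lemma lattice_exponents (p k : nat) (D : set 'M[rat]_m.+1) (N1 N2 : nat) :
  prime p -> subgroup D -> D `<=` flag y n ->
  quot_card D (left_equiv (D `&` gammaQ)) N1 ->
  quot_card gammaQ (left_equiv (D `&` gammaQ)) N2 -> (N1 * N2 = p ^ k)%N ->
  exists e e' : nat -> int, [/\
    forall i t, (i < n)%N -> flag_pi y c D i t <-> exists z : int, t = z%:~R * p%:R ^ e i,
    forall i t, (i < n)%N ->
      flag_pi y c (D `&` gammaQ) i t <-> exists z : int, t = z%:~R * p%:R ^ e' i,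
    \sum_(i < n) (e' i *+ 2 - e i) = k%:Z,
    forall g, D g -> gammaQ (g ^+ (p ^ k)) &
    forall g, gammaQ g -> D (g ^+ (p ^ k))].
Proof.
move=> pp sD Dn q1 q2 eN; have sG := subgroup_gammaQ; have sDG := subgroup_setI sD sG.
have p0 : p%:R != 0 :> rat by rewrite pnatr_eq0 -lt0n prime_gt0.
have [b1 [hb1 E1]] := index_filtration char_rat uy cy c_diag c_low sD sDG (@subIsetl _ _ _) Dn q1.
have [b2 [hb2 E2]] := index_filtration char_rat uy cy c_diag c_low sG sDG (@subIsetr _ _ _) gammaQ_flag q2.
have pw (b : nat -> nat) i : (i < n)%N -> (\prod_(j < n) b j %| p ^ k)%N ->
    exists a, b i = (p ^ a)%N.
  move=> hi hd; have : (b i %| p ^ k)%N.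
    by apply: dvdn_trans hd; rewrite (bigD1 (Ordinal hi)) //= dvdn_mulr.
  by case/(dvdn_pfactor _ _ pp) => a _ ->; exists a.
have d1 : (\prod_(j < n) b1 j %| p ^ k)%N by rewrite -E1 -eN dvdn_mulr.
have d2 : (\prod_(j < n) b2 j %| p ^ k)%N by rewrite -E2 -eN dvdn_mull.
pose a1 i := logn p (b1 i); pose a2 i := logn p (b2 i).
have a1E i : (i < n)%N -> b1 i = (p ^ a1 i)%N.
  by move=> hi; have [a ea] := pw _ _ hi d1; rewrite /a1 ea pfactorK.
have a2E i : (i < n)%N -> b2 i = (p ^ a2 i)%N.
  by move=> hi; have [a ea] := pw _ _ hi d2; rewrite /a2 ea pfactorK.
have pi' i t : (i < n)%N ->
    flag_pi y c (D `&` gammaQ) i t <-> exists z : int, t = z%:~R * p%:R ^ (a2 i)%:Z.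
  move=> hi; have h : [set t | exists z : int, t = z%:~R] = flag_pi y c gammaQ i.
    by apply/seteqP; split=> s /(flag_pi_gammaQ _ hi).
  have sP := flag_pi_subgroup char_rat uy cy c_diag c_low sDG hi.
  have := hb2 i hi; rewrite -h a2E // => hq.
  have [|_ ->] := quot_card_int sP _ hq; last by rewrite natrX.
  by move=> s [g [[_ gG] fg <-]]; apply/(flag_pi_gammaQ _ hi); exists g.
exists (fun i => (a2 i)%:Z - (a1 i)%:Z), (fun i => (a2 i)%:Z); split=> //.
- move=> i t hi.
  have b0 : p%:R ^ (a2 i)%:Z != 0 :> rat by rewrite expfz_neq0.
  have := hb1 i hi.
  have -> : flag_pi y c (D `&` gammaQ) i = [set t | exists z : int, t = z%:~R * p%:R ^ (a2 i)%:Z].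
    by apply/seteqP; split=> s /(pi' _ _ hi).
  move=> hq; have [|_ ->] := quot_card_super b0 (flag_pi_subgroup char_rat uy cy c_diag c_low sD hi) _ hq.
    move=> z; have : flag_pi y c (D `&` gammaQ) i (z%:~R * p%:R ^ (a2 i)%:Z).
      by apply/(pi' _ _ hi); exists z.
    by move=> [g [[Dg _] fg eg]]; exists g.
  by rewrite a1E // natrX expfzDr // -invr_expz.
- have : (p ^ (\sum_(i < n) (a1 i + a2 i)) = p ^ k)%N.
    rewrite -eN E1 E2 -big_split /= expn_sum; apply: eq_bigr => i _.
    by rewrite a1E // a2E // expnD.
  move=> /(expnI (prime_gt1 pp)) <-; rewrite -[RHS]natz natr_sum.
  by apply: eq_bigr => i _; rewrite natz PoszD; ring.
- move=> g Dg; have [_ h] := index_pow char_rat uy cy c_diag c_low sD sDG (@subIsetl _ _ _) Dn q1 Dg.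
  by rewrite -eN exprM; exact: subgroupX.
- move=> g Gg; have [h _] := index_pow char_rat uy cy c_diag c_low sG sDG (@subIsetr _ _ _) gammaQ_flag q2 Gg.
  by rewrite -eN mulnC exprM; exact: subgroupX.
Qed.

End RationalLattice.

(** * Closures in G(Q_p) *)

Section PadicClosure.
Variables (R : realType) (p : nat) (K : padicField R p).
Hypothesis pp : prime p.
Variables (m : nat) (G : unipotentZGroup m) (n : nat) (x : 'I_n -> 'M[int]_m.+1).
Hypothesis hx : malcev_basis G x.
Variable c : nat -> 'cV[rat]_(m.+1 * m.+1).
Hypothesis c_diag : forall i, (i < n)%N -> mxvec (ulog (xF x rat i)) *m c i = 1%:M.
Hypothesis c_low : forall i j, (i < n)%N -> (j < i)%N ->
  mxvec (ulog (xF x rat j)) *m c i = 0.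

Local Notation yQ := (xF x rat).
Local Notation yK := (xF x (padic K)).
Local Notation MQ := 'M[rat]_m.+1.
Local Notation MK := 'M[padic K]_m.+1.
Notation abs := (@padic_abs R p K).

Let charK := char_padic K pp.

Definition ratK : rat -> padic K := ratr0 charK.
HB.instance Definition _ := GRing.RMorphism.on ratK.

Definition toK (g : MQ) : MK := map_mx ratK g.
Definition cK i : 'cV[padic K]_(m.+1 * m.+1) := map_mx ratK (c i).

Lemma toK_y i : toK (yQ i) = yK i.
Proof. by apply/matrixP => a b; rewrite !mxE rmorph_int. Qed.

Lemma toKM g h : toK (g * h) = toK g * toK h.
Proof. exact: map_mxM. Qed.

Lemma toK1 : toK 1 = 1.
Proof. exact: map_mx1. Qed.

Lemma toKX g k : toK (g ^+ k) = toK g ^+ k.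
Proof. exact: (rmorphXn (map_mx ratK)). Qed.

Lemma cK_diag i : (i < n)%N -> mxvec (ulog (yK i)) *m cK i = 1%:M.
Proof.
by move=> hi; rewrite -toK_y /toK -map_ulog -map_mxvec -map_mxM c_diag // map_mx1.
Qed.

Lemma cK_low i j : (i < n)%N -> (j < i)%N -> mxvec (ulog (yK j)) *m cK i = 0.
Proof.
by move=> hi ji; rewrite -toK_y /toK -map_ulog -map_mxvec -map_mxM c_low // map_mx0.
Qed.

Let uQ := unip_xF hx rat.
Let uK := unip_xF hx (padic K).
Let cmQ := @xF_comm _ _ _ _ hx rat.
Let cmK := @xF_comm _ _ _ _ hx (padic K).
Let sflagQ i (hi : (i <= n)%N) := subgroup_flag char_rat uQ cmQ (leqnn n) c_diag c_low hi.
Let sflagK i (hi : (i <= n)%N) := subgroup_flag charK uK cmK (leqnn n) cK_diag cK_low hi.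
Let phiMK := phiM charK uK cmK (leqnn n) cK_diag cK_low.
Let phiVK := phiV charK uK cmK (leqnn n) cK_diag cK_low.
Let phiFK := phi_flag charK uK cmK (leqnn n) cK_diag cK_low.
Let phi0K := flag_phi0 charK uK cmK (leqnn n) cK_diag cK_low.
Let upowK := flag_upow charK uK cmK (leqnn n) cK_diag cK_low.

Lemma toK_word i a : toK (word yQ i a) = word yK i (ratK \o a).
Proof.
elim: i => [|i IH]; first by rewrite !word0 toK1.
by rewrite !wordS toKM IH; congr (_ * _); rewrite /ypow /toK map_unipotent_pow -/(toK _) toK_y.
Qed.

Lemma toK_flag i g : flag yQ i g -> flag yK i (toK g).
Proof. by case=> a ->; rewrite toK_word; exists (ratK \o a). Qed.

Lemma toK_phi i g : phi cK i (toK g) = ratK (phi c i g).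
Proof.
by rewrite /phi /toK -map_ulog -map_mxvec -map_mxM mxE.
Qed.

(** The coordinates of the limit are the limits of the coordinates, so the limit is the word they
    define. *)
Lemma flag_limit i u g : (i <= n)%N -> (forall k, flag yK i (u k)) -> cvM u g -> flag yK i g.
Proof.
move=> hi fu hu; exists (coords yK cK i g).
apply: (cvM_uniq pp hu).
have := @cvM_word R p K pp _ yK i (fun k => coords yK cK i (u k)) (coords yK cK i g)
  (fun j _ => cvM_coords pp yK cK i j hu).
by apply: cvM_eq => k; rewrite (coordsK charK uK cmK (leqnn n) cK_diag cK_low hi).
Qed.

Lemma closure_flag i S : (i <= n)%N -> S `<=` flag yK i -> closure S `<=` flag yK i.
Proof.
move=> hi Si g /cvM_closureP[u [Su hu]]; apply: flag_limit hu => // k.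
exact/Si/Su.
Qed.

Lemma subgroup_closure S : subgroup S -> S `<=` flag yK n -> subgroup (closure S).
Proof.
move=> sS Sn; have cn := closure_flag (leqnn n) Sn; split.
- by move=> g /cn /(flag_unip uK) /unip_unit.
- by apply: subset_closure; exact: subgroup1.
- move=> g h /cvM_closureP[u [Su hu]] /cvM_closureP[v [Sv hv]].
  apply/cvM_closureP; exists (fun k => u k * v k); split; last by have := cvMM pp hu hv.
  by move=> k; exact: subgroupM.
- move=> g cg; have /cvM_closureP[u [Su hu]] := cg.
  apply/cvM_closureP; exists (fun k => (u k)^-1); split.
    by move=> k; exact: subgroupV.
  apply: (cvM_inv pp) hu => [k|]; first exact/(flag_unip uK)/Sn/Su.
  exact/(flag_unip uK)/cn.
Qed.

Lemma closure_limit (S : set MK) u g : (forall k, closure S (u k)) -> cvM u g -> closure S g.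
Proof.
move=> Su hu; rewrite (closure_id (closure S)).1; last exact: closed_closure.
by apply/cvM_closureP; exists u.
Qed.

(** Integer powers stay in the closure, which is a group; p-adically integral exponents are limits
    of integers, and powers depend continuously on the exponent. *)
Lemma closure_upow S g z : subgroup S -> S `<=` flag yK n -> closure S g ->
  abs z <= 1 -> closure S (unipotent_pow g z).
Proof.
move=> sS Sn cg z1; have sC := subgroup_closure sS Sn.
have ug : unip g := flag_unip uK (closure_flag (leqnn n) Sn cg).
have h (k : nat) : exists w : int, abs (w%:~R - z) < k.+1%:R^-1.
  have [|w hw] := padic_int_near pp z1 (e := k.+1%:R^-1); first by rewrite invr_gt0.
  by exists w; rewrite -padic_absN opprB.
have [w hw] := choice h.
apply: (@closure_limit S (fun k => unipotent_pow g (w k)%:~R)).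
  by move=> k; rewrite (unipotent_powz charK) //; exact: (subgroupXz _ sC cg).
apply: (cvM_upow pp (cvM_const g)).
move=> e e0; exists (Num.truncn e^-1) => k hk.
apply: lt_le_trans (hw k) _; rewrite -[X in _ <= X]invrK lef_pV2 ?posrE ?invr_gt0 //.
apply: (@le_trans _ _ (Num.truncn e^-1).+1%:R); last by rewrite ler_nat.
by apply: ltW; rewrite truncnS_gt.
Qed.

Lemma ratK_pXz (k : int) : ratK (p%:R ^ k) = p%:R ^ k.
Proof.
rewrite rmorphXz ?rmorph_nat // unitfE pnatr_eq0 -lt0n.
exact: prime_gt0.
Qed.

Lemma ratKM (z k : int) : ratK (z%:~R * p%:R ^ k) = z%:~R * p%:R ^ k.
Proof. by rewrite rmorphM /= rmorph_int ratK_pXz. Qed.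

(* [p ^ e i] generates the image of [D] in the [i]-th quotient of the flag. *)
Record plattice (D : set MQ) (e : nat -> int) (M : nat) : Prop := PLattice {
  pl_subgroup : subgroup D;
  pl_flag : D `<=` flag yQ n;
  pl_pi : forall i t, (i < n)%N ->
    flag_pi yQ c D i t <-> exists z : int, t = z%:~R * p%:R ^ e i;
  pl_zinvp : forall g, D g -> zinvp_mx p g;
  pl_pow : forall i, D (yQ i ^+ (p ^ M)) }.

Definition pclosure (D : set MQ) : set MK := closure [set toK g | g in D].

Lemma malcev_powE (j : 'I_n) (a : padic K) : malcev_pow x j a = ypow yK j a.
Proof. by rewrite /malcev_pow /ypow /xF xnE. Qed.

Lemma malcev_flagE i : (i <= n)%N -> malcev_flag x i = flag yK i.
Proof.
move=> hi; have sF := sflagK hi.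
have sM : subgroup (malcev_flag (K := K) x i).
  apply: subgroup_generated => _ [j [r [_ ->]]]; rewrite malcev_powE.
  exact/unip_unit/(unip_ypow uK).
apply/seteqP; split.
  apply: generated_sub => // _ [j [r [ji ->]]]; rewrite malcev_powE.
  apply: (flag_widen charK uK ji); apply/flagSP; exists 1, r; rewrite mul1r; split=> //.
  exact: subgroup1 (sflagK (ltnW (ltn_ord j))).
move=> _ [a ->]; suff h k : (k <= i)%N -> malcev_flag x i (word yK k a) by exact: h.
elim: k => [|k IH] ki; first by rewrite word0; exact: subgroup1.
rewrite wordS; apply: (subgroupM sM); first by apply: IH; exact: ltnW.
have kn := leq_trans ki hi.
apply: sub_generated; exists (Ordinal kn), (a k); split=> //.
by rewrite malcev_powE.
Qed.

Section OneLattice.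
Variables (D : set MQ) (e : nat -> int) (M : nat).
Hypothesis hD : plattice D e M.
Local Notation Dc := (pclosure D).

Lemma subgroup_toK : subgroup [set toK g | g in D].
Proof.
have sD := pl_subgroup hD; split.
- by move=> _ [g Dg <-]; exact/unip_unit/(flag_unip uK)/toK_flag/(pl_flag hD).
- by exists 1; [exact: subgroup1|exact: toK1].
- by move=> _ _ [g Dg <-] [h Dh <-]; exists (g * h); [exact: subgroupM|exact: toKM].
- move=> _ [g Dg <-]; exists g^-1; first exact: subgroupV.
  by rewrite /toK (rmorphV (map_mx ratK)) //; exact: subgroup_unit sD Dg.
Qed.

Lemma toK_sub_flag : [set toK g | g in D] `<=` flag yK n.
Proof. by move=> _ [g Dg <-]; exact/toK_flag/(pl_flag hD). Qed.

Lemma subgroup_pclosure : subgroup Dc.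
Proof. exact: subgroup_closure subgroup_toK toK_sub_flag. Qed.

Lemma pclosure_flag : Dc `<=` flag yK n.
Proof. exact: closure_flag toK_sub_flag. Qed.

Lemma pclosure_upow g z : Dc g -> abs z <= 1 -> Dc (unipotent_pow g z).
Proof. exact: closure_upow subgroup_toK toK_sub_flag. Qed.

Lemma pclosure_toK g : D g -> Dc (toK g).
Proof. by move=> Dg; apply: subset_closure; exists g. Qed.

Lemma pclosureP g : Dc g <-> exists u, (forall k, D (u k)) /\ cvM (fun k => toK (u k)) g.
Proof.
split=> [/cvM_closureP[v [hv cv]]|[u [Du cu]]].
  have [u hu] := choice (fun k => let: ex_intro2 h h1 h2 := hv k in ex_intro (fun h => D h /\ toK h = v k) h (conj h1 h2)).
  exists u; split=> [k|]; first by case: (hu k).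
  by apply: cvM_eq cv => k; case: (hu k).
by apply/cvM_closureP; exists (fun k => toK (u k)); split=> // k; exists (u k).
Qed.

Lemma pl_gen i : (i < n)%N -> exists g, [/\ D g, flag yQ i.+1 g & phi c i g = p%:R ^ e i].
Proof. by move=> hi; apply/(pl_pi hD) => //; exists 1; rewrite mul1r. Qed.

(** An element of the closure lying in a smaller flag must be approximated from within that flag.
    Going down one level, the approximants are corrected by powers of a generator of the image of
    [D]; the exponents tend to 0 because the coordinate is continuous and vanishes at the limit, so
    the corrections tend to 1. *)
Lemma pclosure_descent d g : (d <= n)%N -> Dc g -> flag yK (n - d) g ->
  exists u, (forall k, D (u k) /\ flag yQ (n - d) (u k)) /\ cvM (fun k => toK (u k)) g.
Proof.
elim: d g => [|d IH] g hd Dg.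
  move=> _; have /pclosureP[u [Du cu]] := Dg; exists u; split=> // k; split=> //.
  by rewrite subn0; exact: pl_flag hD _ (Du k).
set i := (n - d.+1)%N; have ei : (n - d = i.+1)%N by rewrite /i; lia.
have hi : (i < n)%N by rewrite /i; lia.
move=> fg; have fg' : flag yK (n - d) g.
  by rewrite ei; apply: (flag_widen charK uK) fg.
have [u [hu cu]] := IH g (ltnW hd) Dg fg'; rewrite ei in hu.
have [g0 [Dg0 fg0 pg0]] := pl_gen hi.
have hz k : {z : int | phi c i (u k) = z%:~R * p%:R ^ e i}.
  apply/cid/(pl_pi hD) => //; have [Du fu] := hu k; by exists (u k).
pose z k := projT1 (hz k); have zE k : phi c i (u k) = (z k)%:~R * p%:R ^ e i := projT2 (hz k).
have sD := pl_subgroup hD.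
exists (fun k => u k * g0 ^ (- z k)); split=> [k|].
  have [Du fu] := hu k; split.
    by apply: subgroupM => //; exact: subgroupXz.
  have fz : flag yQ i.+1 (g0 ^ (- z k)) by exact: (subgroupXz _ (sflagQ hi)).
  apply: (flag_phi0 char_rat uQ cmQ (leqnn n) c_diag c_low) => //.
    exact: (subgroupM (sflagQ hi)).
  rewrite (phiM char_rat uQ cmQ (leqnn n) c_diag c_low) //.
  rewrite -(unipotent_powz char_rat) ?(phi_upow char_rat) ?pg0 ?zE; try exact: (flag_unip uQ fg0).
  by rewrite mulrNz mulNr subrr.
have ug0 : unip (toK g0) by exact/(flag_unip uK)/toK_flag/fg0.
have cz : cvK (fun k => (z k)%:~R : padic K) 0.
  have := cvKM pp (cvM_phi pp cK i cu) (cvK_const (p%:R ^ (- e i))).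
  rewrite (phiFK hi fg) mul0r; apply: cvK_eq => k.
  rewrite toK_phi zE ratKM -mulrA -expfzDr.
    by rewrite subrr expr0z mulr1.
  by rewrite (padic_natr_neq0 K pp) -lt0n prime_gt0.
have := cvMM pp cu (cvM_upow pp (cvM_const (toK g0)) (cvKN cz)).
rewrite oppr0 (unipotent_pow0 charK ug0) mulr1; apply: cvM_eq => k.
rewrite toKM -mulrNz (unipotent_powz charK) //; congr (_ * _).
rewrite /toK (rmorphXz (map_mx ratK)) //.
exact: subgroup_unit sD Dg0.
Qed.

Lemma abs_pXz k : abs (p%:R ^ k) = p%:R ^ (- k).
Proof. exact: padic_abs_pXz. Qed.

Lemma pclosure_pi_le i g : (i < n)%N -> Dc g -> flag yK i.+1 g ->
  abs (phi cK i g) <= p%:R ^ (- e i).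
Proof.
move=> hi Dg fg; have ei : (n - (n - i.+1) = i.+1)%N by lia.
have [||u [hu cu]] := @pclosure_descent (n - i.+1) g _ Dg; rewrite ?ei //; first by lia.
apply: (cvK_le _ (cvM_phi pp cK i cu)) => k; have [Du] := hu k; rewrite ei => fu.
have /(pl_pi hD _ hi)[z hz] : flag_pi yQ c D i (phi c i (u k)) by exists (u k).
rewrite toK_phi hz ratKM padic_absM abs_pXz.
rewrite -[X in _ <= X]mul1r ler_wpM2r ?(padic_abs_int_le1 K pp) //.
by rewrite exprz_ge0.
Qed.

Lemma pclosure_pi_ge i t : (i < n)%N -> abs t <= p%:R ^ (- e i) ->
  exists g, [/\ Dc g, flag yK i.+1 g & phi cK i g = t].
Proof.
move=> hi ht; have [g0 [Dg0 fg0 pg0]] := pl_gen hi.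
have p0 : p%:R != 0 :> padic K by rewrite (padic_natr_neq0 K pp) -lt0n prime_gt0.
exists (unipotent_pow (toK g0) (t / p%:R ^ e i)); split.
- apply: pclosure_upow; first exact: pclosure_toK.
  rewrite padic_absM padic_absV abs_pXz ler_pdivrMr ?mul1r //.
  by rewrite exprz_gt0 // ltr0n prime_gt0.
- by apply: upowK => //; exact: toK_flag.
- rewrite (phi_upow charK); last exact/(flag_unip uK)/toK_flag/fg0.
  by rewrite toK_phi pg0 ratK_pXz mulfVK // expfz_neq0.
Qed.

Lemma pclosure_word i a : (forall j, (j < i)%N -> abs (a j) <= p%:R ^- M) ->
  Dc (word yK i a).
Proof.
have sDc := subgroup_pclosure.
have p0 : p%:R != 0 :> padic K by rewrite (padic_natr_neq0 K pp) -lt0n prime_gt0.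
have pM0 : p%:R ^+ M != 0 :> padic K by rewrite expf_neq0.
elim: i => [|i IH] ha; first by rewrite word0; exact: subgroup1.
rewrite wordS; apply: (subgroupM sDc).
  by apply: IH => j ji; apply: ha; exact: ltnW.
have -> : ypow yK i (a i) = unipotent_pow (toK (yQ i ^+ (p ^ M))) (a i / p%:R ^+ M).
  rewrite toKX toK_y -(unipotent_pow_nat charK) // -(unipotent_powM charK) //.
  by rewrite natrX mulrC mulfVK.
apply: pclosure_upow; first exact/pclosure_toK/(pl_pow hD).
rewrite padic_absM padic_absV padic_absX (padic_abs_p K pp) exprVn.
by rewrite invrK -ler_pdivlMr ?mul1r ?ha // exprn_gt0 // ltr0n prime_gt0.
Qed.

(** The closure contains all words with coordinates divisible by p^M, by [pl_pow] and integral
    powers: a neighbourhood of 1 in the flag. Continuity of division and of coordinates translates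
    it to any point. *)
Lemma pclosure_open a : Dc (word yK n a) -> exists2 eps : R, 0 < eps &
  forall b, (forall j, (j < n)%N -> abs (b j - a j) < eps) -> Dc (word yK n b).
Proof.
move=> Da; apply: contrapT => nE.
have h (k : nat) : exists b, (forall j, (j < n)%N -> abs (b j - a j) < k.+1%:R^-1) /\
    ~ Dc (word yK n b).
  apply: contrapT => nb; apply: nE; exists k.+1%:R^-1; first by rewrite invr_gt0.
  by move=> b hb; apply: contrapT => Db; apply: nb; exists b.
have [b hb] := choice h.
have sDc := subgroup_pclosure.
have cb j : (j < n)%N -> cvK (fun k => b k j) (a j).
  move=> jn eps eps0; exists (Num.truncn eps^-1) => k hk.
  have [/(_ j jn) hbk _] := hb k.
  apply: lt_le_trans hbk _; rewrite -[X in _ <= X]invrK lef_pV2 ?posrE ?invr_gt0 //.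
  apply: (@le_trans _ _ (Num.truncn eps^-1).+1%:R); last by rewrite ler_nat.
  by apply: ltW; rewrite truncnS_gt.
have ua := unip_word uK n a.
have := cvMM pp (cvM_const (word yK n a)^-1) (cvM_word pp yK cb).
rewrite mulVr; last exact: unip_unit.
move=> c1.
have c0 j : (j < n)%N -> coords yK cK n 1 j = 0.
  move=> jn; have := wordK charK uK cmK (leqnn n) cK_diag cK_low (fun=> 0) (leqnn n) jn.
  by rewrite word_zero.
have eM : (0 : R) < p%:R ^- M by rewrite invr_gt0 exprn_gt0 // ltr0n prime_gt0.
have [|N0 hN] := @cvK_unif _ _ _ n (fun j k => coords yK cK n ((word yK n a)^-1 * word yK n (b k)) j) (fun=> 0) _ _ eM.
  by move=> j jn; rewrite -(c0 j jn); exact: cvM_coords.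
have [_] := hb N0; apply.
have -> : word yK n (b N0) = word yK n a * ((word yK n a)^-1 * word yK n (b N0)).
  by rewrite mulrA mulrV ?mul1r //; exact: unip_unit.
apply: (subgroupM sDc) => //.
set w := (_^-1 * _).
have fw : flag yK n w.
  by apply: (subgroupM (sflagK (leqnn n))); [apply: (subgroupV (sflagK (leqnn n)))|]; exact: flag_word.
rewrite -(coordsK charK uK cmK (leqnn n) cK_diag cK_low (leqnn n) fw).
apply: pclosure_word => j jn; apply: ltW.
by have := hN N0 (leqnn _) j jn; rewrite subr0.
Qed.

Lemma word_flagS (i : 'I_n) (a : nat -> padic K) : (forall j, (i < j)%N -> a j = 0) ->
  flag yK i.+1 (word yK n a) /\ phi cK i (word yK n a) = a i.
Proof.
move=> ha; have -> : word yK n a = word yK i.+1 a.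
  rewrite (word_pad charK uK a (ltn_ord i)); apply: eq_word => j jn.
  by rewrite ltnS; case: leqP => // /ha.
split; first exact: flag_word.
rewrite wordS (phi_mulr charK uK cmK (leqnn n) cK_diag cK_low) //.
exact: flag_word.
Qed.

(** The closed flag condition at each level becomes a condition on one diagonal entry: it must
    generate the image of the closure in the quotient, an additive group p^(e i) Z_p. *)
Lemma good_basis_pclosure (A : 'I_n -> nat -> padic K) :
  (forall (i : 'I_n) j, (i < j)%N -> A i j = 0) ->
  good_basis G x Dc (fun i => word yK n (A i)) <->
  forall i : 'I_n, Dc (word yK n (A i)) /\ abs (A i i) = p%:R ^ (- e i).
Proof.
move=> hA; have hF i := word_flagS (hA i).
have pe0 k : (0 : R) < p%:R ^ k by rewrite exprz_gt0 // ltr0n prime_gt0.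
have sDc := subgroup_pclosure.
pose S i := generated_subgroup [set word yK n (A j) | j in [set j : 'I_n | (j < i)%N]].
have sS i : subgroup (S i).
  by apply: subgroup_generated => _ [j _ <-]; exact/unip_unit/(unip_word uK).
have Sflag i : (i <= n)%N -> S i `<=` flag yK i.
  move=> hi; apply: generated_sub; first exact: sflagK.
  move=> _ [j /= ji <-]; apply: (flag_widen charK uK ji).
  by case: (hF j).
have flagn i : (i <= n)%N -> flag yK i `<=` flag yK n.
  by move=> hi g; exact: (flag_widen charK uK hi).
split=> [[hD1 hD2] i|h].
  have Di := hD1 i; split=> //; have [fi phii] := hF i.
  apply/eqP; rewrite eq_le; apply/andP; split.
    by rewrite -phii; exact: pclosure_pi_le.
  have [|g [Dg fg pg]] := @pclosure_pi_ge i (p%:R ^ e i) (ltn_ord i).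
    by rewrite abs_pXz.
  have : (Dc `&` malcev_flag x i.+1) g by split=> //; rewrite malcev_flagE.
  rewrite -hD2 => -[_ cg].
  suff : abs (phi cK i g) <= abs (A i i) by rewrite pg abs_pXz.
  have /cvM_closureP[u [Su cu]] := cg.
  apply: (cvK_le _ (cvM_phi pp cK i cu)) => k.
  (* A group containing the generators, on which the top coordinate is bounded by the diagonal
     entry; the bound passes to limits. Compared with an element of the closure of coordinate p^(e
     i), it gives the missing inequality. *)
  pose T := [set g : MK | flag yK i.+1 g /\ abs (phi cK i g) <= abs (A i i)].
  suff : T (u k) by case.
  have sT : subgroup T.
    have sf := sflagK (ltn_ord i); split.
    - by move=> h [/(flag_unip uK)/unip_unit].
    - split; first exact: subgroup1 sf.
      rewrite phiFK //; first by rewrite padic_abs0 padic_abs_ge0.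
      exact: subgroup1 (sflagK (ltnW (ltn_ord i))).
    - move=> h h' [fh ph] [fh' ph']; split; first exact: (subgroupM sf).
      by rewrite phiMK // padic_absD_le.
    - move=> h [fh ph]; split; first exact: (subgroupV sf).
      by rewrite phiVK // padic_absN.
  apply: (generated_sub sT _ (Su k)) => _ [j /= + <-]; have [fj pj] := hF j.
  rewrite leq_eqVlt => /orP[/eqP/val_inj ->|ji]; first by rewrite /T /= phii.
  have fji : flag yK i (word yK n (A j)) by exact: (flag_widen charK uK ji).
  split; first by apply: (flag_widen charK uK (leqnSn i)).
  by rewrite phiFK // padic_abs0 padic_abs_ge0.
have SDc i : (i <= n)%N -> S i `<=` Dc.
  by move=> hi; apply: generated_sub => // _ [j _ <-]; case: (h j).
have key i : (i <= n)%N -> forall g, Dc g -> flag yK i g -> closure (S i) g.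
  elim: i => [|i IH] hi g Dg fg.
    have -> : g = 1 by case: fg => a ->; rewrite word0.
    by apply: subset_closure; exact: subgroup1 (sS 0%N).
  pose I := Ordinal hi; have [DI eI] := h I; have [fI pI] := hF I.
  have A0 : A I I != 0 by rewrite -padic_abs_eq0 eI gt_eqF.
  have sC := subgroup_closure (sS i.+1) (subset_trans (Sflag _ hi) (flagn _ hi)).
  set w := word yK n (A I) in DI fI pI.
  have uw : unip w := unip_word uK _ _.
  (* The exponent that cancels the top coordinate of [g]. It is p-adically integral by the
     assumption on the diagonal entry, so the power of [w] stays in the closure of the generated
     group. *)
  pose z := - (phi cK i g / A I I).
  have z1 : abs z <= 1.
    rewrite padic_absN padic_absM padic_absV eI ler_pdivrMr ?mul1r //.
    exact: (pclosure_pi_le hi Dg fg).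
  have Dwz : Dc (unipotent_pow w z) by exact: pclosure_upow.
  have fwz : flag yK i.+1 (unipotent_pow w z) by exact: upowK.
  have Cw : closure (S i.+1) (unipotent_pow w z).
    apply: closure_upow (sS _) (subset_trans (Sflag _ hi) (flagn _ hi)) _ z1.
    by apply: subset_closure; apply: sub_generated; exists I => /=.
  have -> : g = (g * unipotent_pow w z) * (unipotent_pow w z)^-1.
    by rewrite mulrK //; exact/unip_unit/unip_upow.
  apply: (subgroupM sC); last exact: (subgroupV sC).
  have Si : S i `<=` S i.+1.
    apply: generated_sub => // _ [j /= ji <-]; apply: sub_generated; exists j => //=.
    exact: ltnW.
  apply: (closureS Si); apply: IH; first exact: ltnW.
    exact: (subgroupM sDc).
  apply: phi0K => //; first exact: (subgroupM (sflagK hi)).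
  rewrite phiMK // (phi_upow charK) // -[i]/(nat_of_ord I) pI /z mulNr mulfVK // subrr.
  by [].
split=> [i|i]; first by case: (h i).
rewrite malcev_flagE //; apply/seteqP; split=> g.
  move=> [_ cg]; split.
    have h1 : S i.+1 `<=` Dc by exact: SDc.
    have /(closureS h1) : closure (S i.+1) g by [].
    by rewrite -(closure_id Dc).1 //; exact: closed_closure.
  exact: (closure_flag (ltn_ord i) (Sflag _ (ltn_ord i))).
move=> [Dg fg]; split; last exact: (key i.+1 (ltn_ord i) g Dg fg).
by apply: (flag_points hx charK); exact: pclosure_flag.
Qed.

End OneLattice.

(** At the top index the flag contains both sets, so the last condition expresses each of them
    through the basis alone. For [n = 0] there is no such index, but then the flag is trivial. *)
Lemma good_basis_inj (S T : set MK) h : S 1 -> T 1 -> S `<=` flag yK n -> T `<=` flag yK n ->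
  good_basis G x S h -> good_basis G x T h -> S = T.
Proof.
move=> S1 T1 Sn Tn [_ hS] [_ hT]; case: (posnP n) => [n0|n0].
  have f1 g : flag yK n g -> g = 1 by move=> [a ->]; rewrite /word big_geq // n0.
  by apply/seteqP; split=> g; [move=> /Sn/f1 ->|move=> /Tn/f1 ->].
have hn : (n.-1 < n)%N by rewrite prednK.
have := hS (Ordinal hn); rewrite (hT (Ordinal hn)) /= prednK // malcev_flagE //.
by move/seteqP => [h1 h2]; apply/seteqP; split=> g hg;
  [have [] := h2 g (conj hg (Sn _ hg))|have [] := h1 g (conj hg (Tn _ hg))].
Qed.

Lemma zinvp_padic_int t : zinvp p t -> abs (ratK t) <= 1 -> exists z : int, t = z%:~R.
Proof.
move=> [l [z hz]] ht; have pl0 : p%:R ^+ l != 0 :> rat.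
  by rewrite expf_neq0 // pnatr_eq0 -lt0n prime_gt0.
have [z0|z0] := eqVneq z 0.
  exists 0; apply/eqP; have /eqP := hz; rewrite z0 mulf_eq0 (negPf pl0) orbF.
  by [].
have p0 : (0 : R) < p%:R by rewrite ltr0n prime_gt0.
have : abs (ratK t) * p%:R ^- l = p%:R ^- logn p `|z|.
  rewrite -(padic_abs_int K z0) -[z%:~R](rmorph_int ratK) -hz.
  have ep : ratK (p%:R ^+ l) = p%:R ^+ l := ratK_pXz l.
  by rewrite rmorphM /= ep (padic_absM (ratK t)) padic_absX (padic_abs_p K pp) exprVn.
move=> e; have : p%:R ^- logn p `|z| <= p%:R ^- l :> R.
  by rewrite -e -[X in _ <= X]mul1r ler_wpM2r // invr_ge0 exprn_ge0 // ltW.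
rewrite lef_pV2 ?posrE ?exprn_gt0 // ler_eXn2l ?ltr1n ?prime_gt1 //.
rewrite -pfactor_dvdn ?absz_gt0 // => dv.
have : ((p ^ l)%N%:Z %| z)%Z by [].
move=> /dvdzP[w ew]; exists w; apply: (mulIf pl0).
by rewrite hz ew intrM -[(p ^ l)%N%:Z%:~R]/((p ^ l)%N%:R) natrX.
Qed.

Lemma near_integral (u : nat -> MK) g : cvM u g -> (forall i j, abs (g i j) <= 1) ->
  exists N0, forall k, (N0 <= k)%N -> forall i j, abs (u k i j) <= 1.
Proof.
move=> cu g1.
have h : forall ij : nat, (ij < m.+1 * m.+1)%N ->
    cvK (fun k => oapp (fun l => mxvec (u k) 0 l) 0 (insub ij))
        (oapp (fun l => mxvec g 0 l) 0 (insub ij)).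
  move=> ij hij; rewrite insubT /=.
  case/mxvec_indexP: (Sub ij hij) => a b; rewrite mxvecE.
  by apply: cvK_eq (cu a b) => k; rewrite mxvecE.
have [N0 hN] := cvK_unif h ltr01.
exists N0 => k hk i j.
have := hN k hk (mxvec_index i j) (ltn_ord _); rewrite valK /= !mxvecE => h1.
have -> : u k i j = g i j + (u k i j - g i j) by ring.
by apply: (padic_absD_le pp) => //; exact: ltW.
Qed.

Lemma zinvp_integral_gamma g : flag yQ n g -> zinvp_mx p g ->
  (forall i j, abs (toK g i j) <= 1) -> gammaQ G g.
Proof.
move=> fg zg g1; apply: (flag_int_gammaQ hx fg) => i j.
by apply: zinvp_padic_int => //; have := g1 i j; rewrite mxE.
Qed.

Lemma gamma_integral g : gammaQ G g -> forall i j, abs (toK g i j) <= 1.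
Proof.
by move=> [h _ <-] i j; rewrite !mxE rmorph_int; exact: padic_abs_int_le1.
Qed.

(** For the inclusion from right to left: approximants in [D] of an integral limit eventually have
    p-adically integral entries; as these lie in Z[1/p], they are integers, and the approximants
    belong to G(Z). *)
Lemma pclosure_integral D e M : plattice D e M ->
  pclosure (D `&` gammaQ G) = pclosure D `&` @padic_integral_points R p K m G.
Proof.
move=> hD; apply/seteqP; split=> g.
  move=> cg; have Dg : pclosure D g.
    by move: g cg; apply: closureS => _ [g [Dg _] <-]; exists g.
  split=> //; split; first exact: (flag_points hx charK (pclosure_flag hD Dg)).
  move=> i j; have /cvM_closureP[u [hu cu]] := cg.
  apply: (cvK_le _ (cu i j)) => k; have [h [_ Gh] <-] := hu k.
  exact: gamma_integral.
move=> [/(pclosureP D)[u [Du cu]] [_ gi]].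
have [N0 hN] := near_integral cu gi.
apply/cvM_closureP; exists (fun k => toK (u (k + N0)%N)); split=> [k|].
  exists (u (k + N0)%N) => //; split=> //; apply: zinvp_integral_gamma.
  - exact: (pl_flag hD).
  - exact: (pl_zinvp hD).
  - by apply: hN; exact: leq_addl.
move=> i j eps e0; have [N1 hN1] := cu i j eps e0; exists N1 => k hk.
by apply: hN1; apply: leq_trans hk (leq_addr _ _).
Qed.

(** Let [g] in [D1] be the limit of [u k] in [D2]. The quotients [v k] have entries in Z[1/p] and
    tend to 1, so eventually they lie in G(Z) with Mal'cev coordinates divisible by p^(M2). By
    [pl_pow] such an integral word lies in [D2], and so does [g = u k * v k]. *)
Lemma pclosure_inj D1 D2 e1 e2 M1 M2 : plattice D1 e1 M1 -> plattice D2 e2 M2 ->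
  pclosure D1 `<=` pclosure D2 -> D1 `<=` D2.
Proof.
move=> h1 h2 h12 g Dg.
have fg := pl_flag h1 Dg; have fQ := sflagQ (leqnn n).
have /(pclosureP D2)[u [Du cu]] := h12 _ (pclosure_toK Dg).
have sD2 := pl_subgroup h2.
have fu k : flag yQ n (u k) := pl_flag h2 (Du k).
pose v k := (u k)^-1 * g.
have fv k : flag yQ n (v k) by apply: (subgroupM fQ) => //; exact: (subgroupV fQ).
have zv k : zinvp_mx p (v k).
  by apply: zinvp_mxM; [apply: (pl_zinvp h2); exact: subgroupV|exact: (pl_zinvp h1)].
have ug := unip_unit (flag_unip uK (toK_flag fg)).
have cv : cvM (fun k => toK (v k)) 1.
  rewrite -(mulVr ug).
  have := cvMM pp (cvM_inv pp (fun k => flag_unip uK (toK_flag (fu k))) (flag_unip uK (toK_flag fg)) cu) (cvM_const (toK g)).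
  apply: cvM_eq => k; rewrite toKM; congr (_ * _).
  by rewrite /toK (rmorphV (map_mx ratK)) //; exact: subgroup_unit sD2 (Du k).
have [|N0 hN] := near_integral cv.
  by move=> i j; rewrite mxE; case: eqP => _; rewrite ?padic_abs1 ?padic_abs0.
have c0 j : (j < n)%N -> coords yK cK n 1 j = 0.
  move=> jn; have := wordK charK uK cmK (leqnn n) cK_diag cK_low (fun=> 0) (leqnn n) jn.
  by rewrite word_zero.
have eM : (0 : R) < p%:R ^- M2 by rewrite invr_gt0 exprn_gt0 // ltr0n prime_gt0.
have [j jn|N1 hN1] := @cvK_unif _ _ _ n (fun j k => coords yK cK n (toK (v k)) j) (fun=> 0) _ _ eM.
  by rewrite -(c0 j jn); exact: cvM_coords.
pose k := maxn N0 N1.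
have vG : gammaQ G (v k).
  by apply: zinvp_integral_gamma => //; apply: hN; exact: leq_maxl.
have [a ea] := gammaQ_word hx vG.
have ha j : (j < n)%N -> exists b : int, a j = b * (p ^ M2)%N%:Z.
  move=> jn; have := hN1 k (leq_maxr _ _) j jn; rewrite subr0 ea toK_word.
  rewrite (wordK charK uK cmK (leqnn n) cK_diag cK_low _ (leqnn n) jn) /= rmorph_int.
  have [->|a0] := eqVneq (a j) 0; first by exists 0; rewrite mul0r.
  rewrite (padic_abs_int K a0) ltf_pV2 ?posrE ?exprn_gt0 ?ltr0n ?prime_gt0 //.
  rewrite ltr_eXn2l ?ltr1n ?prime_gt1 // => /ltnW.
  rewrite -pfactor_dvdn ?absz_gt0 // => dv.
  have : ((p ^ M2)%N%:Z %| a j)%Z by [].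
  by move=> /dvdzP[w ew]; exists w.
have Dv : D2 (v k).
  rewrite ea; suff : forall i, (i <= n)%N -> D2 (word yQ i (fun j => (a j)%:~R)) by exact.
  elim=> [|i IH] hi; first by rewrite word0; exact: subgroup1.
  rewrite wordS; apply: subgroupM => //; first by apply: IH; exact: ltnW.
  have [b ->] := ha i hi.
  rewrite /ypow mulrC intrM -[_%:~R]/((p ^ M2)%N%:R) (unipotent_powM char_rat) //.
  rewrite (unipotent_pow_nat char_rat) // (unipotent_powz char_rat); last exact: unipX.
  by apply: subgroupXz => //; exact: (pl_pow h2).
have -> : g = u k * v k by rewrite /v mulrA mulrV ?mul1r //; exact: subgroup_unit sD2 (Du k).
exact: subgroupM.
Qed.

End PadicClosure.

(** * Haar measure of sets fibred in balls *)

Lemma modz_nat (z : int) (k : nat) : (0 < k)%N ->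
  (`|(z %% k)%Z| < k)%N /\ `|(z %% k)%Z|%N%:Z = (z %% k)%Z.
Proof.
move=> k0; have kz : k%:Z != 0 by rewrite eqz_nat -lt0n.
have e : `|(z %% k)%Z|%N%:Z = (z %% k)%Z by rewrite gez0_abs // modz_ge0.
by split=> //; rewrite -ltz_nat e ltz_pmod // ltz_nat.
Qed.

Section Haar.
Variables (R : realType) (p : nat) (K : padicField R p).
Hypothesis pp : prime p.
Variables (n : nat) (nu : {measure set (trigpair_borel K n) -> \bar R}).
Hypothesis hnu : normalized_haar nu.
Notation abs := (@padic_abs R p K).
Notation T := (trigpair K n).
Notation I := (bool * 'I_n * 'I_n)%type.
Implicit Types (v w : T) (e : I) (S D Q : set T).

Definition entry e v : padic K := trigval (if e.1.1 then v.1 else v.2) e.1.2 e.2.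

Definition lower e : bool := (e.2 <= e.1.2)%N.

Definition unit_trig (i j : 'I_n) (q : padic K) : trigmx (padic K) n :=
  insubd 0 (q *: delta_mx i j).

Definition shift_entry e q : T :=
  if e.1.1 then (unit_trig e.1.2 e.2 q, 0) else (0, unit_trig e.1.2 e.2 q).

Lemma entryD e v w : entry e (v + w) = entry e v + entry e w.
Proof. by rewrite /entry; case: e.1.1; rewrite /= mxE. Qed.

Lemma entry_upper e v : ~~ lower e -> entry e v = 0.
Proof.
rewrite /lower -ltnNge /entry => h.
by have /is_trig_mxP := trigvalP (if e.1.1 then v.1 else v.2); exact.
Qed.

Lemma entry_shift e e' q : lower e ->
  entry e' (shift_entry e q) = if e' == e then q else 0.
Proof.
move=> he; have hv : trigval (unit_trig e.1.2 e.2 q) = q *: delta_mx e.1.2 e.2.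
  rewrite -[trigval _]/(val _) val_insubd ifT //.
  apply/is_trig_mxP => i j ij; rewrite !mxE; case: eqP => [ei|]; last by rewrite mulr0.
  case: eqP => [ej|]; last by rewrite mulr0.
  by move: ij he; rewrite ei ej ltnNge /lower => /negPf ->.
rewrite /entry /shift_entry; case: e he hv => [[s i] j] /= he hv; case: e' => [[s' i'] j'] /=.
rewrite !xpair_eqE; move: {he} hv; case: s; case: s' => /= hv; rewrite ?hv ?mxE //=.
  by case: eqP => _; case: eqP => _; rewrite /= ?mulr1 ?mulr0.
by case: eqP => _; case: eqP => _; rewrite /= ?mulr1 ?mulr0.
Qed.

Definition set_entry e t v : T := v + shift_entry e (t - entry e v).

Lemma entry_set e e' t v : lower e -> entry e' (set_entry e t v) = if e' == e then t else entry e' v.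
Proof.
move=> he; rewrite entryD entry_shift //; case: eqP => [->|_]; last by rewrite addr0.
by rewrite addrC subrK.
Qed.

Lemma trigpair_ext v w : (forall e, entry e v = entry e w) -> v = w.
Proof.
case: v => v1 v2; case: w => w1 w2 h; congr pair.
  by apply: val_inj; apply/matrixP => i j; have := h (true, i, j).
by apply: val_inj; apply/matrixP => i j; have := h (false, i, j).
Qed.

Lemma set_entry_id e v : lower e -> set_entry e (entry e v) v = v.
Proof.
by move=> he; apply: trigpair_ext => e'; rewrite entry_set //; case: eqP => [->|].
Qed.

(** Openness for the maximum of the entries. Every set to be measured is shown to be open in this
    sense or is obtained from such sets by countable operations. *)
Definition eopen S := forall v, S v -> exists2 eps : R, 0 < eps &
  forall w, (forall e, abs (entry e w - entry e v) < eps) -> S w.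

Lemma eopen_measurable S : eopen S -> measurable (S : set (trigpair_borel K n)).
Proof.
move=> hS; apply: sub_sigma_algebra; rewrite /= openE => v Sv.
have [eps e0 he] := hS v Sv; rewrite /interior.
pose B (M : 'M[padic K]_n) := ball M eps.
have nb (M : trigmx (padic K) n) : nbhs M (@trigval (padic K) n @^-1` B (trigval M)).
  have c := @initial_continuous _ _ (@trigval (padic K) n) M.
  by apply: c; exact: nbhsx_ballx.
exists ((@trigval (padic K) n @^-1` B (trigval v.1)), (@trigval (padic K) n @^-1` B (trigval v.2))).
  by split; exact: nb.
move=> w /= [[_ h1] [_ h2]]; apply: he => -[[s i] j]; rewrite /entry /=.
case: s; [have := h1 i j|have := h2 i j]; rewrite ballEmdist /= /mdist /= /padic_dist.
  by rewrite -padic_absN opprB.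
by rewrite -padic_absN opprB.
Qed.

Lemma eopenI S Q : eopen S -> eopen Q -> eopen (S `&` Q).
Proof.
move=> hS hQ v [Sv Qv]; have [e1 e10 h1] := hS v Sv; have [e2 e20 h2] := hQ v Qv.
exists (Num.min e1 e2); first by rewrite lt_min e10.
by move=> w hw; split; [apply: h1|apply: h2] => e; apply: lt_le_trans (hw e) _;
  rewrite ge_min lexx ?orbT.
Qed.

Lemma eopen_forall (J : finType) (S : J -> set T) :
  (forall j, eopen (S j)) -> eopen [set v | forall j, S j v].
Proof.
move=> hS v Sv.
have h : forall s : seq J, exists2 eps : R, 0 < eps &
    forall w, (forall e, abs (entry e w - entry e v) < eps) -> forall j, j \in s -> S j w.
  elim=> [|j s [e1 e10 h1]]; first by exists 1.
  have [e2 e20 h2] := hS j v (Sv j).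
  exists (Num.min e1 e2); first by rewrite lt_min e10.
  move=> w hw j'; rewrite inE => /orP[/eqP ->|].
    by apply: h2 => e; apply: lt_le_trans (hw e) _; rewrite ge_min lexx ?orbT.
  by apply: h1 => e; apply: lt_le_trans (hw e) _; rewrite ge_min lexx ?orbT.
have [eps e0 he] := h (enum J); exists eps => // w hw j.
by apply: (he w hw); rewrite mem_enum.
Qed.

Lemma eopen_eq S Q : (forall v, S v <-> Q v) -> eopen S -> eopen Q.
Proof.
move=> SQ hS v /SQ/hS[eps e0 h]; exists eps => // w hw.
by apply/SQ; exact: h.
Qed.

Lemma eopen_true : eopen setT.
Proof. by move=> v _; exists 1. Qed.

Lemma eopen_ball e r : 0 < r -> eopen [set v | abs (entry e v) <= r].
Proof.
move=> r0 v hv; exists r => // w hw /=.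
have -> : entry e w = (entry e w - entry e v) + entry e v by rewrite subrK.
by apply: (padic_absD_le pp) => //; exact: ltW.
Qed.

Lemma eopen_sphere e r : 0 < r -> eopen [set v | abs (entry e v) = r].
Proof.
move=> r0 v /= hv; exists r => // w hw /=; rewrite -hv.
by apply: (padic_abs_near pp); rewrite -padic_absN opprB hv.
Qed.

Lemma eopen_set e t S : lower e -> eopen S -> eopen [set v | S (set_entry e t v)].
Proof.
move=> le hS v /hS[eps e0 h]; exists eps => // w hw; apply: h => e'.
by rewrite !entry_set //; case: eqP => // _; rewrite subrr padic_abs0.
Qed.

Lemma haar_shift t S : eopen S -> nu [set t + v | v in S] = nu S.
Proof. by move=> hS; apply: hnu.1; exact: eopen_measurable. Qed.

Definition shift_invariant e D := forall v q, D v -> D (v + shift_entry e q).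

Let p0 : (0 : R) < p%:R.
Proof. by rewrite ltr0n prime_gt0. Qed.

(* If each fibre of [D `&` Q] over the other coordinates is a ball of radius [r],
   its centre can be chosen rational, hence from a countable set, and translated
   to the origin without changing the measure. *)
Lemma haar_shear e r D Q : lower e -> 0 < r -> shift_invariant e D -> eopen D -> eopen Q ->
  (forall v, D v -> exists c0, forall t, Q (set_entry e t v) <-> abs (t - c0) <= r) ->
  nu (D `&` Q) = nu (D `&` [set v | abs (entry e v) <= r]).
Proof.
move=> le r0 invD oD oQ hQ.
pose q (k : nat) : padic K := ratr (odflt 0 (unpickle k : option rat)).
pose W k : set T := D `&` [set v | Q (set_entry e (q k) v)].
have oW k : eopen (W k) by apply: eopenI => //; exact: eopen_set.
(* [V k] collects the points for which [q k] is the first rational lying in the fibre. This does not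
   depend on the entry [e] itself, so [V k] is invariant under shifts of that entry. *)
pose V : nat -> set T := seqDU W.
have WE k v : W k v <-> D v /\ Q (set_entry e (q k) v) by [].
have near v : D v -> exists k, W k v.
  move=> Dv; have [c0 hc] := hQ v Dv; have [a ha] := padic_rat_near c0 r0.
  exists (pickle a); split=> //; apply/hc; rewrite /q pickleK /=.
  by rewrite -padic_absN opprB; exact: ltW.
have QW k v t : W k v -> Q (set_entry e t v) <-> abs (t - q k) <= r.
  move=> [Dv Wv]; have [c0 hc] := hQ v Dv; have /hc h1 := Wv.
  split=> [/hc h2|h2]; last first.
    apply/hc; have -> : t - c0 = (t - q k) + (q k - c0) by ring.
    exact: (padic_absD_le pp).
  have -> : t - q k = (t - c0) - (q k - c0) by ring.
  exact: (padic_absB_le pp).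
have set_shift v s t : set_entry e t (v + shift_entry e s) = set_entry e t v.
  apply: trigpair_ext => e'; rewrite [LHS]entry_set // [RHS]entry_set //.
  by case: ifP => // ne; rewrite entryD entry_shift // ne addr0.
have Wshift k v s : W k v -> W k (v + shift_entry e s).
  by move=> [Dv Qv]; split; [exact: invD|rewrite /= set_shift].
have shiftK v s : v + shift_entry e s + shift_entry e (- s) = v.
  apply: trigpair_ext => e'; rewrite !entryD !entry_shift //.
  by case: eqP => _; rewrite ?addrK ?addr0.
have Wshift' k v s : W k (v + shift_entry e s) -> W k v.
  by move=> /(Wshift k _ (- s)); rewrite shiftK.
have VE k v : V k v <-> W k v /\ forall l, (l < k)%N -> ~ W l v.
  rewrite /V /seqDU; split=> [[Wv nW]|[Wv nW]].
    split=> // l lk Wl; apply: nW; rewrite -bigcup_mkord; by exists l.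
  by split=> //; rewrite -bigcup_mkord => -[l lk]; exact: nW.
have Vshift k v s : V k v -> V k (v + shift_entry e s).
  move=> /VE[Wv nW]; apply/VE; split; first exact: Wshift.
  by move=> l lk /Wshift'; exact: nW.
have mW k : measurable (W k : set (trigpair_borel K n)) by exact: eopen_measurable.
have mV k : measurable (V k : set (trigpair_borel K n)).
  apply: measurableD => //; apply: bigsetU_measurable => i _; exact: mW.
have tV : trivIset setT V by exact: trivIset_seqDU.
have DV : D = \bigcup_k V k.
  rewrite /V -seqDU_bigcup_eq; apply/seteqP; split=> v; first by case/near => k Wk; exists k.
  by case=> k _ [].
pose Bl : set T := [set v | abs (entry e v) <= r].
have split_nu (Z : set T) : eopen Z -> nu (D `&` Z) = (\sum_(k <oo) nu (V k `&` Z))%E.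
  move=> oZ; have mZ := eopen_measurable oZ.
  rewrite DV setI_bigcupl measure_bigcup //.
  - by apply: eq_eseriesl => k; rewrite in_setT.
  - by move=> k _; exact: measurableI.
  - exact: trivIset_setIr.
rewrite split_nu // split_nu //; last exact: eopen_ball.
apply: eq_eseriesr => k _.
(* Over [V k] the fibre is the ball around [q k], any point of an ultrametric ball being a centre;
   one global translation by [q k] maps the centred ball onto it. *)
have -> : V k `&` Q = [set shift_entry e (q k) + v | v in V k `&` Bl].
  apply/seteqP; split=> [v [Vv Qv]|_ [v [Vv Bv] <-]].
    have /VE[Wv _] := Vv.
    exists (v + shift_entry e (- q k)); last first.
      by rewrite addrC -{2}[q k]opprK shiftK.
    split; first exact: Vshift.
    rewrite /Bl /= entryD entry_shift // eqxx.
    by apply/(QW k v _ Wv); rewrite set_entry_id.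
  have /VE[Wv _] := Vv; rewrite addrC; split; first exact: Vshift.
  have : W k (v + shift_entry e (q k)) by exact: Wshift.
  move=> /QW h; rewrite -[X in Q X](@set_entry_id e) //; apply/h.
  by rewrite entryD entry_shift // eqxx addrK.
apply: hnu.1; apply: measurableI => //.
by apply: eopen_measurable; exact: eopen_ball.
Qed.

(** A ball of radius p^(-k) is the disjoint union of the translates by l p^k, for 0 <= l < p, of the
    ball of radius p^(-k-1). Existence of l comes from density of Z in Z_p, disjointness from l' - l
    being prime to p. *)
Lemma haar_ball_step e D (k : int) : lower e -> shift_invariant e D -> eopen D ->
  nu (D `&` [set v | abs (entry e v) <= p%:R ^ (- k)]) =
  (p%:R%:E * nu (D `&` [set v | (abs (entry e v) <= p%:R ^ (- (k + 1)))%R]))%E.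
Proof.
move=> le invD oD.
have pz0 l : (0 : R) < p%:R ^ l by rewrite exprz_gt0.
have pK : p%:R != 0 :> padic K by rewrite (padic_natr_neq0 K pp) -lt0n prime_gt0.
have pkK l : p%:R ^ l != 0 :> padic K by rewrite expfz_neq0.
set B := D `&` [set v | abs (entry e v) <= p%:R ^ (- (k + 1))].
have oB : eopen B by apply: eopenI => //; exact: eopen_ball.
pose q (l : nat) : padic K := l%:R * p%:R ^ k.
have near a : abs a <= p%:R ^ (- k) ->
    exists l, (l < p)%N /\ abs (a - q l) <= p%:R ^ (- (k + 1)).
  move=> ha; have h1 : abs (a / p%:R ^ k) <= 1.
    by rewrite padic_absM padic_absV (padic_abs_pXz K pp) ler_pdivrMr // mul1r.
  have pV : (0 : R) < p%:R^-1 by rewrite invr_gt0.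
  have [z hz] := padic_int_near pp h1 pV.
  have [hl zE] := modz_nat z (prime_gt0 pp).
  exists `|(z %% p)%Z|%N; split=> //.
  have -> : a - q `|(z %% p)%Z|%N = (a / p%:R ^ k - `|(z %% p)%Z|%:R) * p%:R ^ k.
    by rewrite mulrBl mulfVK.
  rewrite padic_absM (padic_abs_pXz K pp) opprD expfzDr ?gt_eqF //.
  rewrite mulrC ler_wpM2l ?(ltW (pz0 _)) // -[p%:R ^ (-1)]/(p%:R^-1).
  have -> : `|(z %% p)%Z|%:R = z%:~R - (z %/ p)%Z%:~R * p%:R :> padic K.
    have -> : `|(z %% p)%Z|%:R = (z %% p)%Z%:~R :> padic K.
      by rewrite -[LHS]/((`|(z %% p)%Z|%N%:Z)%:~R) zE.
    have -> : z%:~R = (z %/ p)%Z%:~R * p%:R + (z %% p)%Z%:~R :> padic K.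
      by rewrite {1}(divz_eq z p) intrD intrM.
    by rewrite addrAC subrr add0r.
  have -> : a / p%:R ^ k - (z%:~R - (z %/ p)%Z%:~R * p%:R) =
    (a / p%:R ^ k - z%:~R) + (z %/ p)%Z%:~R * p%:R by ring.
  apply: (padic_absD_le pp); first exact: ltW.
  rewrite padic_absM (padic_abs_p K pp) -[X in _ <= X]mul1r ler_wpM2r ?(padic_abs_int_le1 K pp) //.
have far l l' : (l < l' < p)%N -> ~ abs (q l' - q l) <= p%:R ^ (- (k + 1)).
  move=> /andP[ll' l'p]; rewrite /q -mulrBl -natrB; last exact: ltnW.
  rewrite padic_absM (padic_abs_pXz K pp) -[(l' - l)%:R]/((l' - l)%N%:Z%:~R) padic_abs_int; last first.
    by rewrite eqz_nat subn_eq0 -ltnNge.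
  have -> : logn p `|(l' - l)%N%:Z|%N = 0%N.
    rewrite /= lognE; case: and3P => // -[_ _ /dvdn_leq]; rewrite subn_gt0 => /(_ ll') h.
    by have := leq_trans l'p (leq_trans h (leq_subr _ _)); rewrite ltnn.
  rewrite expr0 invr1 mul1r => h.
  have : p%:R ^ (- k) <= p%:R ^ (- k) * p%:R^-1 :> R.
    by move: h; rewrite opprD expfzDr ?gt_eqF.
  rewrite -ler_pdivrMl // mulVf ?gt_eqF // invf_ge1 //.
  by rewrite leNgt ltr1n prime_gt1.
pose F (l : nat) : set T := [set shift_entry e (q l) + v | v in B].
have -> : D `&` [set v | abs (entry e v) <= p%:R ^ (- k)] = \bigcup_(l in [set l | (l < p)%N]) F l.
  apply/seteqP; split=> [v [Dv hv]|v].
    have [l [lp hl]] := near _ hv; exists l => //.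
    exists (v + shift_entry e (- q l)); last first.
      by apply: trigpair_ext => e'; rewrite !entryD !entry_shift //; case: eqP => _; rewrite ?addr0 ?add0r // addrC subrK.
    by split; [exact: invD|rewrite /= entryD entry_shift // eqxx].
  move=> [l lp [w [Dw hw] <-]]; rewrite addrC.
  split; first exact: invD.
  rewrite /= entryD entry_shift // eqxx; apply: (padic_absD_le pp).
    apply: le_trans hw _; rewrite opprD expfzDr ?gt_eqF // ler_piMr ?(ltW (pz0 _)) //.
    by rewrite invf_le1 // ler1n prime_gt0.
  rewrite padic_absM (padic_abs_pXz K pp) -[X in _ <= X]mul1r ler_wpM2r ?(ltW (pz0 _)) //.
  by rewrite -[l%:R]/(l%:Z%:~R) padic_abs_int_le1.
have shiftE a v w : shift_entry e a + v = w -> v = w + shift_entry e (- a).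
  move=> <-; apply: trigpair_ext => e'; rewrite !entryD !entry_shift //.
  by case: eqP => _; rewrite ?addr0 ?add0r // addrAC subrr add0r.
have oS l : eopen (F l).
  move=> _ [v Bv <-]; have [eps e0 h] := oB v Bv; exists eps => // w hw.
  exists (w + shift_entry e (- q l)); last first.
    by apply: trigpair_ext => e'; rewrite !entryD !entry_shift //; case: eqP => _; rewrite ?addr0 ?add0r // addrC subrK.
  apply: h => e'; have := hw e'; rewrite !entryD !entry_shift //.
  by case: eqP => _; rewrite ?addr0 ?add0r // opprD addrA.
rewrite bigcup_mkord (measure_bigsetU_ord _ xpredT (F := fun l : 'I_p => (F l : set (trigpair_borel K n)))) //=; first last.
- apply/trivIsetP => l l' /= lp l'p ne; rewrite -subset0 => v [[w [Dw hw] ew] [w' [Dw' hw'] ew']].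
  have key l1 l2 w1 w2 : (l1 < l2 < p)%N -> abs (entry e w1) <= p%:R ^ (- (k + 1)) ->
      abs (entry e w2) <= p%:R ^ (- (k + 1)) ->
      shift_entry e (q l1) + w1 = shift_entry e (q l2) + w2 -> False.
    move=> /far nf h1 h2 /(congr1 (entry e)); rewrite !entryD !entry_shift // eqxx => eq12.
    apply: nf; have -> : q l2 - q l1 = entry e w1 - entry e w2.
      have -> : entry e w1 = q l2 + entry e w2 - q l1.
        by rewrite -eq12 addrAC subrr add0r.
      by ring.
    exact: (padic_absB_le pp).
  case: (ltngtP l l') => h; last by rewrite (val_inj h) eqxx in ne.
    have lh : (l < l' < p)%N by rewrite h ltn_ord.
    exact: (key l l' w w' lh hw hw' (etrans ew (esym ew'))).
  have lh : (l' < l < p)%N by rewrite h ltn_ord.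
  exact: (key l' l w' w lh hw' hw (etrans ew' (esym ew))).
- by move=> l; exact: eopen_measurable.
under eq_bigr do rewrite haar_shift //.
by rewrite sumr_const card_ord mule_natl.
Qed.

Lemma haar_ball e D (k : int) : lower e -> shift_invariant e D -> eopen D ->
  nu (D `&` [set v | abs (entry e v) <= p%:R ^ (- k)]) =
  ((p%:R ^ (- k))%:E * nu (D `&` [set v | (abs (entry e v) <= 1)%R]))%E.
Proof.
move=> le invD oD.
pose mu (k : int) := nu (D `&` [set v | abs (entry e v) <= p%:R ^ (- k)]).
have st (j : int) : mu j = (p%:R%:E * mu (j + 1)%R)%E by exact: haar_ball_step.
have st' (j : int) : mu (j + 1) = (p%:R^-1%:E * mu j)%E.
  by rewrite (st j) muleA -EFinM mulVf ?gt_eqF // mul1e.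
rewrite -/(mu k); have -> : nu (D `&` [set v | (abs (entry e v) <= 1)%R]) = mu 0.
  by rewrite /mu oppr0 expr0z.
have hP (j : nat) : mu j%:Z = ((p%:R ^ (- j%:Z))%:E * mu 0%R)%E.
  elim: j => [|j IH]; first by rewrite oppr0 expr0z mul1e.
  rewrite -addn1 PoszD st' IH muleA -EFinM opprD [in RHS]expfzDr ?gt_eqF //.
  by rewrite mulrC.
have hN (j : nat) : mu (- j%:Z) = ((p%:R ^ j%:Z)%:E * mu 0%R)%E.
  elim: j => [|j IH]; first by rewrite oppr0 expr0z mul1e.
  rewrite st -addn1 PoszD opprD subrK IH muleA -EFinM [in RHS]expfzDr ?gt_eqF //.
  by rewrite mulrC.
by case: (intP k) => [|j|j]; rewrite ?opprK; [exact: (hP 0%N)|exact: hP|exact: hN].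
Qed.

(** The sphere is the difference of two consecutive balls, as the absolute value takes only powers
    of [p]; finiteness of the measure allows the subtraction. *)
Lemma haar_sphere e D (k : int) : lower e -> shift_invariant e D -> eopen D ->
  (nu (D `&` [set v | (abs (entry e v) <= 1)%R]) < +oo)%E ->
  nu (D `&` [set v | abs (entry e v) = p%:R ^ (- k)]) =
  (((1 - p%:R^-1) * p%:R ^ (- k))%:E * nu (D `&` [set v | (abs (entry e v) <= 1)%R]))%E.
Proof.
move=> le invD oD fin.
have pz0 l : (0 : R) < p%:R ^ l by rewrite exprz_gt0.
have hB := haar_ball k le invD oD; have hB' := haar_ball (k + 1) le invD oD.
set X := nu (D `&` [set v | abs (entry e v) = p%:R ^ (- k)]).
move: fin hB hB'; set Y := nu (D `&` [set v | (abs (entry e v) <= 1)%R]) => fin hB hB'.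
have Y0 : (0 <= Y)%E by exact: measure_ge0.
have finY : Y \is a fin_num by rewrite ge0_fin_numE.
have : nu (D `&` [set v | abs (entry e v) <= p%:R ^ (- k)]) =
    (X + nu (D `&` [set v | (abs (entry e v) <= p%:R ^ (- (k + 1)))%R]))%E.
  rewrite /X -measureU.
  - congr (nu _); rewrite -setIUr; congr (D `&` _); apply/seteqP; split=> v /=.
      have [->|n0] := eqVneq (entry e v) 0.
        by move=> _; right; rewrite padic_abs0 ltW.
      have [l ->] := padic_abs_val pp n0.
      rewrite ler_eXz2l ?ltr1n ?prime_gt1 // le_eqVlt => /orP[/eqP ->|h]; first by left.
      by right; rewrite ler_eXz2l ?ltr1n ?prime_gt1 //; lia.
    case=> [->//|h]; apply: le_trans h _; rewrite ler_eXz2l ?ltr1n ?prime_gt1 //; lia.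
  - by apply: eopen_measurable; apply: eopenI => //; exact: eopen_sphere.
  - by apply: eopen_measurable; apply: eopenI => //; exact: eopen_ball.
  - rewrite -subset0 => v [[_ /= ->] [_ /=]].
    rewrite ler_eXz2l ?ltr1n ?prime_gt1 //; lia.
rewrite hB hB' -(fineK finY) -!EFinM.
have X0 : (0 <= X)%E by exact: measure_ge0.
have pk : p%:R ^ (- (k + 1)) = p%:R ^ (- k) * p%:R^-1 :> R.
  by rewrite opprD expfzDr ?gt_eqF.
case: X X0 => [X| |] // X0 [eX]; congr EFin.
by move: eX; rewrite pk => eX; apply/eqP; rewrite -subr_eq0; apply/eqP; lra.
Qed.

Definition radius_factor (E : I -> int) e : R :=
  (if e.1.2 == e.2 then 1 - p%:R^-1 else 1) * p%:R ^ (- E e).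

Definition radius_cond (E : I -> int) e : set T :=
  [set v | if e.1.2 == e.2 then abs (entry e v) = p%:R ^ (- E e)
           else abs (entry e v) <= p%:R ^ (- E e)].

Lemma eopen_radius_cond E e : eopen (radius_cond E e).
Proof.
rewrite /radius_cond; case: eqP => _; first by apply: eopen_sphere; rewrite exprz_gt0.
by apply: eopen_ball; rewrite exprz_gt0.
Qed.

(** Starting from the integral pairs, of measure 1 by normalisation, the condition that an entry be
    integral is replaced by the wanted one, entry after entry; [s] lists the entries already
    treated. Each replacement multiplies the measure by the factor of that entry. *)
Lemma haar_box E : nu [set v | forall e, lower e -> radius_cond E e v] =
  (\prod_(e | lower e) radius_factor E e)%:E.
Proof.
pose cond (s : seq I) e : set T :=
  if e \in s then radius_cond E e else [set v | abs (entry e v) <= 1].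
have h s : uniq s -> all lower s ->
    nu [set v | forall e, cond s e v] = (\prod_(e <- s) radius_factor E e)%:E.
  elim: s => [|e s IH] /=.
    move=> _ _; rewrite big_nil -hnu.2; congr (nu _).
    apply/seteqP; split=> v hv; last first.
      by case: hv => h1 h2 [[[] i] j]; [exact: h1|exact: h2].
    by split=> i j; [exact: (hv (true, i, j))|exact: (hv (false, i, j))].
  move=> /andP[es us] /andP[le ls]; have {IH} := IH us ls.
  pose D : set T := [set v | forall e', e' != e -> cond s e' v].
  have invD : shift_invariant e D.
    move=> v q Dv e' ne; have := Dv e' ne; rewrite /cond /radius_cond.
    by case: ifP => _ /=; rewrite ?entryD ?entry_shift // (negPf ne) addr0.
  have oc s' e' : eopen (cond s' e').
    by rewrite /cond; case: ifP => _; [exact: eopen_radius_cond|exact: eopen_ball].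
  have oD : eopen D.
    apply: (eopen_eq (S := [set v | forall e', (if e' != e then cond s e' else setT) v])).
      move=> v; split=> hv e'; first by move=> ne; have := hv e'; rewrite ne.
      by case: ifP => // ne; exact: hv.
    by apply: eopen_forall => e'; case: ifP => _; [exact: oc|exact: eopen_true].
  have -> : [set v | forall e', cond s e' v] = D `&` [set v | abs (entry e v) <= 1].
    apply/seteqP; split=> v hv.
      split=> [e' _|]; first exact: hv.
      by have := hv e; rewrite /cond (negPf es).
    move=> e'; have [->|ne] := eqVneq e' e; last exact: hv.1.
    by rewrite /cond (negPf es); exact: hv.2.
  have -> : [set v | forall e', cond (e :: s) e' v] = D `&` radius_cond E e.
    have ce e' : e' != e -> cond (e :: s) e' = cond s e'.
      by move=> ne; rewrite /cond inE (negPf ne).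
    apply/seteqP; split=> v hv.
      split=> [e' ne|]; first by rewrite -ce.
      by have := hv e; rewrite /cond inE eqxx.
    move=> e'; have [->|ne] := eqVneq e' e; last by rewrite ce //; exact: hv.1.
    by rewrite /cond inE eqxx; exact: hv.2.
  move=> hs; rewrite big_cons EFinM -hs /radius_cond /radius_factor.
  case: ifP => _; last by rewrite mul1r; exact: haar_ball.
  by apply: haar_sphere => //; rewrite hs ltry.
have := h (enum lower) (enum_uniq _) _; rewrite big_enum /= => <-; last first.
  by apply/allP => e; rewrite mem_enum.
have en e : (e \in enum lower) = lower e by rewrite mem_enum.
congr (nu _); apply/seteqP; split=> v hv e.
  rewrite /cond en; case: ifP => [|/negbT] le; first exact: hv.
  by rewrite /= entry_upper // padic_abs0.
by move=> le; have := hv e; rewrite /cond en le.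
Qed.

(** Rows become sequences extended by 0, the form in which words take their exponents; [true] stands
    for the first matrix of the pair. *)
Definition rowf (s : bool) (i : 'I_n) v : nat -> padic K :=
  fun j => oapp (fun j' => entry (s, i, j') v) 0 (insub j).

Lemma rowfE s i v (j : 'I_n) : rowf s i v j = entry (s, i, j) v.
Proof. by rewrite /rowf valK. Qed.

Lemma rowf_upper s (i : 'I_n) v j : (i < j)%N -> rowf s i v j = 0.
Proof.
rewrite /rowf => ij; case: insubP => //= j' _ ej.
by apply: entry_upper; rewrite /lower /= -ltnNge ej.
Qed.

Section Fibred.
Variables (H : bool -> set (nat -> padic K)) (E : bool -> nat -> int).
Hypothesis H_open : forall s a, H s a -> exists2 eps : R, 0 < eps &
  forall b, (forall j, (j < n)%N -> abs (b j - a j) < eps) -> H s b.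
Hypothesis H_fibre : forall s a l, (l < n)%N -> H s a -> forall t,
  (exists b, [/\ b l = t, forall j, (l < j)%N -> b j = a j & H s b]) <->
  abs (t - a l) <= p%:R ^ (- E s l).
Hypothesis H0 : forall s, H s (fun=> 0).

Let EI e : int := E e.1.1 e.2.

(* Level [l] of a row only constrains its entries of index at least [l]. *)
Definition tail_cond l s i : set T :=
  [set v | exists a, H s a /\ forall j, (l <= j)%N -> a j = rowf s i v j].

Lemma eopen_tail l s i : eopen (tail_cond l s i).
Proof.
move=> v [a [Ha av]]; have [eps e0 h] := H_open Ha; exists eps => // w hw.
exists (fun j => if (l <= j)%N then rowf s i w j else a j); split=> [|j ->//].
apply: h => j jn; case: ifP => [lj|_]; last by rewrite subrr padic_abs0.
rewrite av //; have -> : j = Ordinal jn by [].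
by rewrite !rowfE.
Qed.

Lemma tail_condS l s i v : tail_cond l s i v -> tail_cond l.+1 s i v.
Proof. by case=> a [Ha h]; exists a; split=> // j lj; apply: h; exact: ltnW. Qed.

(** Interpolates between the fibred set and a box: in row [i] of matrix [s], the off-diagonal
    entries of index below [L s i] are already confined to balls centred at 0, while the rest of the
    row is still constrained by [H s]. *)
Definition level_set (L : bool -> 'I_n -> nat) : set T :=
  [set v | forall si : bool * 'I_n, [/\ tail_cond (L si.1 si.2) si.1 si.2 v,
     forall j : 'I_n, (j < L si.1 si.2)%N -> (j < si.2)%N -> radius_cond EI (si.1, si.2, j) v &
     radius_cond EI (si.1, si.2, si.2) v]].

(** Once the entries of index above l can be completed to an element of [H s0], those values of
    entry l that can still be completed form a ball by [H_fibre], and [haar_shear] recentres it at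
    0. *)
Lemma level_step (L : bool -> 'I_n -> nat) s0 (i0 : 'I_n) : (L s0 i0 < i0)%N ->
  nu (level_set L) =
  nu (level_set (fun s i => if (s == s0) && (i == i0) then (L s i).+1 else L s i)).
Proof.
set L' := fun s i => _; move=> hL.
have ln : (L s0 i0 < n)%N by exact: ltn_trans hL (ltn_ord i0).
pose l : 'I_n := Ordinal ln; pose e : I := (s0, i0, l).
have le : lower e by rewrite /lower /=; exact: ltnW.
have L'E : L' s0 i0 = (L s0 i0).+1 by rewrite /L' !eqxx.
have L'E' (si : bool * 'I_n) : si != (s0, i0) -> L' si.1 si.2 = L si.1 si.2.
  by case: si => s i; rewrite /L' xpair_eqE /= => /negPf ->.
pose row_ok (L1 : nat) (lim : nat) (si : bool * 'I_n) : set T :=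
  tail_cond L1 si.1 si.2 `&`
  ([set v | forall j : 'I_n, (j < lim)%N -> (j < si.2)%N -> radius_cond EI (si.1, si.2, j) v] `&`
  radius_cond EI (si.1, si.2, si.2)).
have o_ok L1 lim si : eopen (row_ok L1 lim si).
  apply: eopenI; first exact: eopen_tail.
  apply: eopenI; last exact: eopen_radius_cond.
  apply: (eopen_eq (S := [set v | forall j : 'I_n,
      (if (j < lim)%N && (j < si.2)%N then radius_cond EI (si.1, si.2, j) else setT) v])).
    move=> v; split=> hv j.
      by move=> j1 j2; have := hv j; rewrite j1 j2.
    by case: ifP => // /andP[j1 j2]; exact: hv.
  by apply: eopen_forall => j; case: ifP => _; [exact: eopen_radius_cond|exact: eopen_true].
have lvlE L1 v : level_set L1 v <-> forall si, row_ok (L1 si.1 si.2) (L1 si.1 si.2) si v.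
  by split=> h si; [have [h1 h2 h3] := h si|have [h1 [h2 h3]] := h si].
(* All conditions except the one on the entry [e]: tails are taken at the new level [L'], radii at
   the old level [L]. Adding [Q] gives the old level set, adding the centred ball gives the new
   one. *)
pose D : set T := [set v | forall si, row_ok (L' si.1 si.2) (L si.1 si.2) si v].
pose Q : set T := tail_cond l s0 i0.
have oD : eopen D by apply: eopen_forall => si; exact: o_ok.
have rowf_set s i v t j : (s, i) != (s0, i0) \/ j != l :> nat ->
    rowf s i (set_entry e t v) j = rowf s i v j.
  move=> h; rewrite /rowf; case: insubP => //= j' _ ej; rewrite entry_set // ifF //.
  apply/eqP => -[es ei ejl]; case: h => [/eqP|/eqP]; first by rewrite es ei.
  by rewrite -ej ejl.
have rowf_shift s i v t j : (s, i) != (s0, i0) \/ j != l :> nat ->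
    rowf s i (v + shift_entry e t) j = rowf s i v j.
  move=> h; rewrite /rowf; case: insubP => //= j' _ ej; rewrite entryD entry_shift // ifF ?addr0 //.
  apply/eqP => -[es ei ejl]; case: h => [/eqP|/eqP]; first by rewrite es ei.
  by rewrite -ej ejl.
have rc_shift si (j : 'I_n) v t : si != (s0, i0) \/ j != l ->
    radius_cond EI (si.1, si.2, j) v -> radius_cond EI (si.1, si.2, j) (v + shift_entry e t).
  move=> h; have ne : ((si.1, si.2, j) == e) = false.
    apply/eqP => -[es ei ejl]; case: h => [/eqP|/eqP]; last by rewrite ejl.
    by case: si es ei => s i /= -> ->.
  by rewrite /radius_cond /= entryD entry_shift // ne addr0.
have invD : shift_invariant e D.
  move=> v q Dv si; have [[a [Ha h1]] [h2 h3]] := Dv si.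
  have [esi|ne] := eqVneq si (s0, i0).
    rewrite esi /= in h1 h2 h3 *; split; [|split].
    - exists a; split; first by move: Ha; rewrite esi.
      move=> j hj; rewrite h1 // rowf_shift //; right.
      by move: hj; rewrite L'E => hj; rewrite gtn_eqF.
    - move=> j j1 j2; apply: (rc_shift (s0, i0)); last exact: h2.
      by right; apply/eqP => ejl; move: j1; rewrite ejl ltnn.
    - apply: (rc_shift (s0, i0)) => //; right; apply/eqP => eil.
      by move: hL; rewrite {2}(eil : i0 = l) /= ltnn.
  split; [|split].
  - by exists a; split=> // j hj; rewrite h1 // rowf_shift //; left; case: (si) ne.
  - by move=> j j1 j2; apply: rc_shift; [left|exact: h2].
  - by apply: rc_shift => //; left.
have hX : level_set L = D `&` Q.
  apply/seteqP; split=> v.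
    move=> /lvlE hv; split=> [si|]; last by have [] := hv (s0, i0).
    have [h1 h23] := hv si; split=> //.
    have [->|ne] := eqVneq si (s0, i0); last by rewrite L'E'.
    by rewrite /= L'E; apply: tail_condS; have [] := hv (s0, i0).
  move=> [Dv Qv]; apply/lvlE => si; have [h1 h23] := Dv si; split=> //.
  have [->|ne] := eqVneq si (s0, i0); first exact: Qv.
  by rewrite -(L'E' si).
have hX' : level_set L' = D `&` [set v | abs (entry e v) <= p%:R ^ (- E s0 l)].
  have rcl v : radius_cond EI e v <-> abs (entry e v) <= p%:R ^ (- E s0 l).
    rewrite /radius_cond /= ifF //; apply/eqP => /(congr1 val) /= eil.
    by move: hL; rewrite -eil ltnn.
  apply/seteqP; split=> v.
    move=> /lvlE hv; split=> [si|].
      have [h1 [h2 h3]] := hv si; split=> //; split=> // j j1 j2; apply: h2 => //.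
      have [esi|ne] := eqVneq si (s0, i0); last by rewrite L'E'.
      by rewrite esi /= L'E ltnW //; move: j1; rewrite esi.
    have [_ [h2 _]] := hv (s0, i0); apply/rcl; apply: h2 => //=.
    by rewrite L'E.
  move=> [Dv /rcl hl]; apply/lvlE => si; have [h1 [h2 h3]] := Dv si; split=> //; split=> //.
  have [esi|ne] := eqVneq si (s0, i0); last by rewrite L'E'.
  move=> j; rewrite esi /= L'E ltnS leq_eqVlt => /orP[/eqP ejl|j1] j2.
    by have -> : j = l by exact: val_inj.
  by have := h2 j; rewrite esi; exact.
rewrite hX hX'; apply: haar_shear => //; first by rewrite exprz_gt0.
  exact: eopen_tail.
move=> v Dv; have [[a [Ha h1]] _] := Dv (s0, i0).
rewrite /= L'E in Ha h1; exists (a l) => t.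
have hf := H_fibre ln Ha t; rewrite -hf; split=> [[b [Hb hb]]|[b [b1 b2 Hb]]].
  exists b; split=> //.
    by rewrite hb // -[L s0 i0]/(val l) rowfE entry_set // eqxx.
  move=> j lj; rewrite h1 // hb ?(ltnW lj) // rowf_set //; right.
  by rewrite gtn_eqF.
exists b; split=> // j; rewrite leq_eqVlt => /orP[/eqP <-|lj].
  by rewrite rowfE entry_set // eqxx b1.
by rewrite b2 // h1 // rowf_set //; right; rewrite gtn_eqF.
Qed.

Definition fibred_set : set T := [set v | forall (s : bool) (i : 'I_n),
  H s (rowf s i v) /\ abs (entry (s, i, i) v) = p%:R ^ (- E s i)].

Lemma H_congr s a b : (forall j, (j < n)%N -> b j = a j) -> H s a -> H s b.
Proof.
move=> ab /H_open[eps e0 h]; apply: h => j jn.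
by rewrite ab // subrr padic_abs0.
Qed.

Lemma level_set0 : level_set (fun _ _ => 0%N) = fibred_set.
Proof.
apply/seteqP; split=> v hv.
  move=> s i; have [[a [Ha h1]] _ /=] := hv (s, i).
  rewrite /radius_cond /= eqxx => h3; split=> //.
  by apply: H_congr Ha => j _; rewrite h1.
move=> [s i]; have [h1 h2] := hv s i; split=> //=.
  by exists (rowf s i v).
by rewrite /radius_cond /= eqxx.
Qed.

(** At the last level the tail of row [i] is its diagonal entry followed by zeros. The condition on
    the radius already implies that it extends to an element of [H s], by [H_fibre] at the zero
    sequence. *)
Lemma level_set_top : level_set (fun _ i => i) = [set v | forall e, lower e -> radius_cond EI e v].
Proof.
apply/seteqP; split=> v hv.
  move=> [[s i] j]; rewrite /lower /= leq_eqVlt => /orP[/eqP/val_inj ->|ji].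
    by have [_ _] := hv (s, i).
  by have [_ h _] := hv (s, i); exact: h.
move=> [s i]; split=> /=; last 2 first.
- by move=> j ji _; apply: hv; exact: ltnW.
- by apply: hv; exact: leqnn.
have := hv (s, i, i) (leqnn i); rewrite /radius_cond /= eqxx => hi.
have [|b [b1 b2 Hb]] := (H_fibre (ltn_ord i) (H0 s) (entry (s, i, i) v)).2.
  by rewrite subr0 hi.
exists b; split=> // j; rewrite leq_eqVlt => /orP[/eqP <-|ij]; first by rewrite rowfE b1.
by rewrite b2 // rowf_upper.
Qed.

Lemma haar_fibred : nu fibred_set = (\prod_(e | lower e) radius_factor EI e)%:E.
Proof.
rewrite -haar_box -level_set_top -level_set0.
(* Induction on the number of strictly lower entries that still have to be recentred. *)
suff h d (L : bool -> 'I_n -> nat) : (forall s i, (L s i <= i)%N) ->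
    (\sum_s \sum_(i < n) (i - L s i) <= d)%N -> nu (level_set L) = nu (level_set (fun _ i => i)).
  exact: (h _ (fun _ _ => 0%N) _ (leqnn _)).
elim: d L => [|d IH] L hL.
  rewrite leqn0 => /eqP hd; congr (nu _); congr level_set.
  apply/funext => s; apply/funext => i; apply/eqP; rewrite eqn_leq hL /=.
  rewrite -subn_eq0; move/eqP: hd; rewrite sum_nat_eq0 => /forallP/(_ s) /=.
  by rewrite sum_nat_eq0 => /forallP/(_ i).
have [/existsP[s0 /existsP[i0 hlt]]|] := boolP [exists s, [exists i : 'I_n, (L s i < i)%N]].
  move=> hd; rewrite (level_step hlt); apply: IH.
    by move=> s i; case: ifP => [/andP[/eqP -> /eqP ->]|_].
  rewrite -ltnS; apply: leq_trans hd.
  rewrite (bigD1 s0) //= [X in (_ < X)%N](bigD1 s0) //= -addSn leq_add //.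
    rewrite (bigD1 i0) //= [X in (_ < X)%N](bigD1 i0) //= -addSn leq_add //.
      by rewrite !eqxx /=; lia.
    by apply: leq_sum => i /negPf ->; rewrite andbF.
  by apply: leq_sum => s /negPf ->; apply: leq_sum => i _.
move=> nE _; congr (nu _); congr level_set.
apply/funext => s; apply/funext => i; apply/eqP; rewrite eqn_leq hL /= leqNgt.
by apply: contra nE => lt; apply/existsP; exists s; apply/existsP; exists i.
Qed.

Lemma eopen_fibred : eopen fibred_set.
Proof.
apply: (eopen_eq (S := [set v | forall si : bool * 'I_n,
   (tail_cond 0 si.1 si.2 `&` [set v | abs (entry (si.1, si.2, si.2) v) = p%:R ^ (- E si.1 si.2)]) v])).
  move=> v; split=> hv.
    move=> s i; have [[a [Ha h1]] /= h2] := hv (s, i); split=> //.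
    by apply: H_congr Ha => j _; rewrite h1.
  move=> [s i]; have [h1 h2] := hv s i; split=> //.
  by exists (rowf s i v).
apply: eopen_forall => si; apply: eopenI; first exact: eopen_tail.
by apply: eopen_sphere; rewrite exprz_gt0.
Qed.

End Fibred.

End Haar.

(** * From lattices in G(R) to rational lattices *)

Lemma counting_finite (R : realType) (T : choiceType) (X : set T) :
  (counting X < +oo :> \bar R)%E -> finite_set X.
Proof.
rewrite /counting; case: ifPn => [/asboolP//|_]; by rewrite ltxx.
Qed.

Lemma counting_ge0 (R : realType) (T : choiceType) (X : set T) : (0 <= counting X :> \bar R)%E.
Proof. by rewrite /counting; case: ifP => // _; rewrite lee_fin. Qed.

(** Replaces the counting measure of a set of cosets, with values in the extended reals, by a
    natural number with an explicit transversal, which is the form used by the index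
    computations. *)
Lemma quot_card_index (R : realType) (A : unitRingType) (H S : set A) (N : \bar R) :
  subgroup H -> subgroup S -> subgroup_index R H S = N -> (N < +oo)%E ->
  exists2 k : nat, quot_card H (left_equiv S) k & N = k%:R%:E.
Proof.
move=> sH sS eN Nfin.
have fX : finite_set (left_cosets H S) by apply: (@counting_finite R); rewrite -/(subgroup_index R H S) eN.
pose s : seq (set A) := finmap.enum_fset (fset_set (left_cosets H S)).
exists (size s); last first.
  by rewrite -eN /subgroup_index /counting asboolT.
have us : uniq s by exact: finmap.fset_uniq.
have sP X : X \in s <-> left_cosets H S X.
  by have -> : (X \in s) = (X \in left_cosets H S) := in_fset_set fX X; rewrite inE.
have coset_eq g h : H g -> H h ->
   [set g * u | u in S] = [set h * u | u in S] <-> S (g^-1 * h).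
  move=> Hg Hh; have ug := subgroup_unit sH Hg; have uh := subgroup_unit sH Hh.
  split=> [e|Sgh].
    have : [set g * u | u in S] h by rewrite e; exists 1; [exact: subgroup1|rewrite mulr1].
    by case=> u Su <-; rewrite mulKr.
  apply/seteqP; split=> _ [u Su <-].
    exists (h^-1 * g * u); last by rewrite -mulrA mulVKr.
    apply: (subgroupM sS) => //; have := subgroupV sS Sgh.
    by rewrite invrM ?unitrV // invrK.
  exists (g^-1 * h * u); last by rewrite -mulrA mulVKr.
  exact: (subgroupM sS).
have ex (i : 'I_(size s)) : {g | H g /\ [set g * u | u in S] = nth set0 s i}.
  apply: cid; have /sP[g Hg e] : nth set0 s i \in s by rewrite mem_nth.
  by exists g.
exists (fun i => sval (ex i)); split=> [i|h Hh]; first by case: (svalP (ex i)).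
pose C : set A := [set h * u | u in S].
have hs : C \in s by apply/sP; exists h.
have hi : (index C s < size s)%N by rewrite index_mem.
exists (Ordinal hi); split=> [|j].
  have [Hr e] := svalP (ex (Ordinal hi)).
  by apply/coset_eq => //; rewrite e nth_index.
have [Hr e] := svalP (ex j); move=> /(coset_eq _ _ Hr Hh) e'; apply: val_inj => /=.
by rewrite /C -e' e index_uniq.
Qed.

Lemma quot_card_preimage (T U : Type) (f : T -> U) (H : set U) (E : U -> U -> Prop)
    (E' : T -> T -> Prop) k :
  (forall h, H h -> exists t, f t = h) ->
  (forall s t, H (f s) -> H (f t) -> E (f s) (f t) <-> E' s t) ->
  quot_card H E k -> quot_card [set t | H (f t)] E' k.
Proof.
move=> surj EE' [r [Hr hr]].
have [l hl] := choice (fun i => surj _ (Hr i)).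
exists l; split=> [i|t Ht]; first by rewrite /= hl.
have [i [Ei ui]] := hr _ Ht; exists i; split=> [|j Ej].
  by apply/EE'; rewrite ?hl.
by apply: ui; rewrite -hl; apply/EE'; rewrite ?hl.
Qed.

Section RealLattice.
Variables (R : realType) (m : nat) (G : unipotentZGroup m) (n : nat) (x : 'I_n -> 'M[int]_m.+1).
Hypothesis hx : malcev_basis G x.
Local Notation yQ := (xF x rat).
Local Notation MQ := 'M[rat]_m.+1.
Local Notation MR := 'M[R]_m.+1.

Definition toR (g : MQ) : MR := map_mx ratr g.

Definition rational_part (D : set MR) : set MQ := [set g | D (toR g)].

Lemma toR_inj : injective toR.
Proof. by apply: map_mx_inj; exact: fmorph_inj. Qed.

Lemma toRM g h : toR (g * h) = toR g * toR h.
Proof. exact: rmorphM. Qed.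

Lemma toR_int (g : 'M[int]_m.+1) : toR (map_mx intr g) = map_mx intr g.
Proof. by rewrite /toR -map_mx_comp; apply/matrixP => i j; rewrite !mxE /= ratr_int. Qed.

Lemma integral_toR g : @integral_points R m G (toR g) <-> gammaQ G g.
Proof.
split=> [[h Gh eh]|[h Gh <-]]; last by exists h => //; rewrite toR_int.
by exists h => //; apply: toR_inj; rewrite toR_int.
Qed.

Lemma subgroup_integral : subgroup (@integral_points R m G).
Proof.
have s := points_int_subgroup hx.
split=> [_ [g Gg <-]|||].
- by apply: rmorph_unit; exact: (subgroup_unit s).
- by exists 1; [exact: subgroup1|exact: rmorph1].
- move=> _ _ [g Gg <-] [h Gh <-]; exists (g * h); first exact: subgroupM.
  exact: rmorphM.
- move=> _ [g Gg <-]; exists g^-1; first exact: subgroupV.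
  by rewrite rmorphV //; exact: (subgroup_unit s).
Qed.

Variable c : nat -> 'cV[rat]_(m.+1 * m.+1).
Hypothesis c_diag : forall i, (i < n)%N -> mxvec (ulog (yQ i)) *m c i = 1%:M.
Hypothesis c_low : forall i j, (i < n)%N -> (j < i)%N -> mxvec (ulog (yQ j)) *m c i = 0.

Let uQ := unip_xF hx rat.
Let cmQ := @xF_comm _ _ _ _ hx rat.
Let upowQ := flag_upow char_rat uQ cmQ (leqnn n) c_diag c_low.

Section OneLattice.
Variables (D : set MR) (N1 : nat).
Hypothesis sD : subgroup D.
Hypothesis DG : D `<=` points G R.
Hypothesis hq : quot_card D (left_equiv (D `&` @integral_points R m G)) N1.

(** Some positive power of [g] is an integral point by finiteness of the index. The root of that
    power taken inside the rational flag is mapped to [g], since a unipotent matrix is recovered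
    from any positive power by [unipotent_pow]. *)
Lemma lattice_rational g : D g -> exists2 q, flag yQ n q & toR q = g.
Proof.
move=> Dg; have sI := subgroup_setI sD subgroup_integral.
have [M M0 [_ [h Gh eh]]] := quot_card_torsion sD sI hq Dg.
have Gq : gammaQ G (map_mx intr h) by exists h.
exists (unipotent_pow (map_mx intr h) (M%:R^-1)).
  by apply: upowQ => //; exact: (gammaQ_flag hx).
have ug : unip g by exact: points_unip (DG Dg).
have charR : [pchar R] =i pred0 := @pchar_num R.
rewrite /toR map_unipotent_pow // -/(toR _) toR_int eh -(unipotent_pow_nat charR _ ug).
rewrite -(unipotent_powM charR) // fmorphV rmorph_nat mulfV ?(unipotent_pow1 charR) //.
by rewrite pnatr_eq0 -lt0n.
Qed.

Lemma rational_part_flag : rational_part D `<=` flag yQ n.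
Proof. by move=> g /lattice_rational[q hq' /toR_inj <-]. Qed.

Lemma subgroup_rational_part : subgroup (rational_part D).
Proof.
have un g : rational_part D g -> g \is a GRing.unit.
  by move=> /rational_part_flag /(flag_unip uQ); exact: unip_unit.
split=> //; first by rewrite /rational_part /= /toR rmorph1; exact: subgroup1.
  by move=> g h Dg Dh; rewrite /rational_part /= toRM; exact: subgroupM.
move=> g Dg; rewrite /rational_part /= /toR rmorphV ?un //; exact: subgroupV.
Qed.

Lemma toR_rational_part : [set toR q | q in rational_part D] = D.
Proof.
apply/seteqP; split=> [_ [q Dq <-] //|g Dg].
by have [q _ e] := lattice_rational Dg; exists q => //; rewrite /rational_part /= e.
Qed.

Lemma quot_card_rational :
  quot_card (rational_part D) (left_equiv (rational_part D `&` gammaQ G)) N1.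
Proof.
apply: quot_card_preimage hq => [h /lattice_rational[q _ <-]|s t Ds Dt]; first by exists q.
have us : s \is a GRing.unit by exact: (subgroup_unit subgroup_rational_part Ds).
rewrite /left_equiv /=.
have -> : (toR s)^-1 * toR t = toR (s^-1 * t) by rewrite toRM /toR rmorphV.
by split=> -[h1 /integral_toR h2].
Qed.

Lemma quot_card_gamma N2 :
  quot_card (@integral_points R m G) (left_equiv (D `&` @integral_points R m G)) N2 ->
  quot_card (gammaQ G) (left_equiv (rational_part D `&` gammaQ G)) N2.
Proof.
move=> h; have e : gammaQ G = [set q | @integral_points R m G (toR q)].
  by apply/seteqP; split=> q /integral_toR.
rewrite {1}e; apply: quot_card_preimage h => [_ [h Gh <-]|s t Ds Dt].
  by exists (map_mx intr h); rewrite toR_int.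
have us : s \is a GRing.unit.
  by apply: (subgroup_unit (subgroup_gammaQ hx)); exact/integral_toR.
rewrite /left_equiv /=.
have -> : (toR s)^-1 * toR t = toR (s^-1 * t) by rewrite toRM /toR rmorphV.
by split=> -[h1 /integral_toR h2].
Qed.

End OneLattice.

Variables (p : nat) (pp : prime p).

Lemma lattice_plattice (k : nat) (D : set MR) : lattices_of_index R G (p ^ k) D ->
  [set toR q | q in rational_part D] = D /\
  exists e e', [/\ plattice p x c (rational_part D) e k,
    plattice p x c (rational_part D `&` gammaQ G) e' k &
    \sum_(i < n) (e' i *+ 2 - e i) = k%:Z].
Proof.
move=> [[sD DG _]]; rewrite /commensurability_index.
have s' := subgroup_setI sD subgroup_integral.
set a := subgroup_index R D _; set b := subgroup_index R _ _ => eab.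
have a0 : (0 <= a)%E by exact: counting_ge0.
have b0 : (0 <= b)%E by exact: counting_ge0.
have pk0 : (0 < p ^ k)%N by rewrite expn_gt0 prime_gt0.
(* The product of the two indices is p^k, finite and non-zero. An infinite factor would make it
   infinite, or zero if the other factor were 0. *)
have [afin bfin] : (a < +oo)%E /\ (b < +oo)%E.
  move: eab a0 b0; clearbody a b; case: a => [a||] //; case: b => [b||] //= eab a0 b0; try by rewrite !ltry.
  - move: eab; rewrite muleC mulr_infty; move: a0; rewrite lee_fin le_eqVlt => /orP[/eqP <-|a0].
      rewrite sgr0 mul0e => -[/eqP]; by rewrite eq_sym pnatr_eq0 -[_ == _]negbK -lt0n pk0.
    by rewrite gtr0_sg // mul1e.
  - move: eab; rewrite mulr_infty; move: b0; rewrite lee_fin le_eqVlt => /orP[/eqP <-|b0].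
      rewrite sgr0 mul0e => -[/eqP]; by rewrite eq_sym pnatr_eq0 -[_ == _]negbK -lt0n pk0.
    by rewrite gtr0_sg // mul1e.
have [N1 h1 e1] := quot_card_index sD s' (erefl a) afin.
have [N2 h2 e2] := quot_card_index subgroup_integral s' (erefl b) bfin.
have N12 : (N1 * N2 = p ^ k)%N.
  by move: eab; rewrite e1 e2 -EFinM -natrM => -[] /eqP; rewrite eqr_nat => /eqP.
split; first exact: toR_rational_part h1.
have sQ := subgroup_rational_part sD DG h1.
have fQ := rational_part_flag sD DG h1.
have [e [e' [he he' hs hD hG]]] := lattice_exponents hx c_diag c_low pp sQ fQ
  (quot_card_rational sD DG h1) (quot_card_gamma h2) N12.
have sG := subgroup_gammaQ hx.
(* The p^k-th power of an element of the lattice is integral, so the entries of the element have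
   only powers of [p] as denominators. *)
have zD g : rational_part D g -> zinvp_mx p g.
  move=> Dg; apply: (zinvp_mx_root pp (k := k)); first by move: Dg => /fQ/(flag_unip uQ).
  by have [h _ <-] := hD _ Dg; exact: zinvp_mx_int.
have pw i : rational_part D (yQ i ^+ (p ^ k)) by apply: hG; exact: y_gammaQ.
exists e, e'; split; [exact: (PLattice sQ fQ he zD pw)| |exact: hs].
split=> //; first exact: subgroup_setI.
- by move=> g [/fQ].
- by move=> g [/zD].
- by move=> i; split=> //; apply: (subgroupX _ sG); exact: y_gammaQ.
Qed.

End RealLattice.

(** * Good pairs *)

Lemma big_lower (R : comPzRingType) (n : nat) (F : bool * 'I_n * 'I_n -> R) :
  \prod_(e | lower e) F e =
  \prod_(s : bool) \prod_(i < n) \prod_(j < n | (j <= i)%N) F (s, i, j).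
Proof.
by rewrite pair_big /= pair_big_dep /=; apply: eq_big => [[[s i] j]|[[s i] j]].
Qed.

Section GoodPairs.
Variables (R : realType) (p : nat) (K : padicField R p).
Hypothesis pp : prime p.
Variables (m : nat) (G : unipotentZGroup m) (n : nat) (x : 'I_n -> 'M[int]_m.+1).
Hypothesis hx : malcev_basis G x.
Variable c : nat -> 'cV[rat]_(m.+1 * m.+1).
Hypothesis c_diag : forall i, (i < n)%N -> mxvec (ulog (xF x rat i)) *m c i = 1%:M.
Hypothesis c_low : forall i j, (i < n)%N -> (j < i)%N ->
  mxvec (ulog (xF x rat j)) *m c i = 0.
Local Notation yQ := (xF x rat).
Local Notation yK := (xF x (padic K)).
Notation abs := (@padic_abs R p K).

Let charK := char_padic K pp.
Let uK := unip_xF hx (padic K).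
Let cmK := @xF_comm _ _ _ _ hx (padic K).
Let cdK := @cK_diag R p K pp m n x c c_diag.
Let clK := @cK_low R p K pp m n x c c_low.

Lemma padic_wordE (s : bool) (i : 'I_n) (v : trigpair K n) :
  padic_word x (row i (trigval (if s then v.1 else v.2))) = word yK n (rowf s i v).
Proof.
rewrite /padic_word /word big_mkord; apply: eq_bigr => j _.
by rewrite malcev_powE rowfE mxE.
Qed.

Lemma lattice_closureE (D : set 'M[R]_m.+1) e M :
  plattice p x c (rational_part D) e M ->
  @lattice_closure R p K m G D = pclosure pp (rational_part D).
Proof.
move=> hD; rewrite /lattice_closure /padic_closure; apply: setIidr => g.
by move=> /(pclosure_flag (K := K) (pp := pp) hx c_diag c_low hD); exact: (flag_points hx charK).
Qed.

Lemma plattice_gammaQ : plattice p x c (gammaQ G) (fun=> 0) 0.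
Proof.
split.
- exact: (subgroup_gammaQ hx).
- exact: (gammaQ_flag hx).
- move=> i t hi; rewrite (flag_pi_gammaQ hx c_diag c_low) //.
  by split=> -[z ->]; exists z; rewrite expr0z mulr1.
- by move=> g [h _ <-]; exact: zinvp_mx_int.
- by move=> i; rewrite expn0 expr1; exact: y_gammaQ.
Qed.

(** The top coordinate is integral because all exponents of G(Z) are 0; the corresponding power of
    the generator then lies in the closure of G(Z) and can be stripped off the word. *)
Lemma pclosure_gamma_coord i a : (i <= n)%N -> pclosure pp (gammaQ G) (word yK i a) ->
  forall j, (j < i)%N -> abs (a j) <= 1.
Proof.
have hG := plattice_gammaQ; have sG := subgroup_pclosure K pp hx c_diag c_low hG.
elim: i => // i IH hi Gw j.
have ai : abs (a i) <= 1.
  have := pclosure_pi_le hx c_diag c_low hG hi Gw (flag_word _ _ _).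
  by rewrite oppr0 expr0z wordS (phi_mulr charK uK cmK (leqnn n) cdK clK) //; exact: flag_word.
rewrite ltnS leq_eqVlt => /orP[/eqP -> //|]; apply: IH; first exact: ltnW.
have -> : word yK i a = word yK i.+1 a * (ypow yK i (a i))^-1.
  by rewrite wordS mulrK // ypow_unit.
apply: (subgroupM sG) => //; apply: (subgroupV sG).
apply: (pclosure_upow (K := K) (pp := pp) hx c_diag c_low hG) => //.
by rewrite -(toK_y K pp x i); apply: pclosure_toK; exact: y_gammaQ.
Qed.

(** Two words with equal coordinates above [l] differ by a left factor in the closure and in
    [flag l.+1]; the possible values of [phi] on such factors form the ball p^(e l) Z_p. *)
Lemma pclosure_fibre D e M : plattice p x c D e M -> forall a l, (l < n)%N ->
  pclosure pp D (word yK n a) -> forall t,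
  (exists b, [/\ b l = t, forall j, (l < j)%N -> b j = a j & pclosure pp D (word yK n b)]) <->
  abs (t - a l) <= p%:R ^ (- e l).
Proof.
move=> hD a l ln Da t; have sD := subgroup_pclosure K pp hx c_diag c_low hD; split.
  move=> [b [<- bE Db]].
  have [h1 <-] := word_divr charK uK cmK (leqnn n) cdK clK ln (leqnn n) bE.
  apply: (pclosure_pi_le hx c_diag c_low hD) => //.
  by apply: (subgroupM sD) => //; exact: (subgroupV sD).
move=> /(pclosure_pi_ge pp hx c_diag c_low hD ln)[g [Dg fg pg]].
have [b [e1 e2 e3]] := word_mull charK uK cmK (leqnn n) cdK clK a ln (leqnn n) fg.
exists b; split=> //; first by rewrite e2 pg addrC subrK.
by rewrite -e1; exact: (subgroupM sD).
Qed.

Section OneLattice.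
Variables (D : set 'M[R]_m.+1) (e e' : nat -> int) (k M : nat).
Hypothesis hD : plattice p x c (rational_part D) e M.
Hypothesis hD' : plattice p x c (rational_part D `&` gammaQ G) e' M.
Hypothesis hk : \sum_(i < n) (e' i *+ 2 - e i) = k%:Z.

Definition rows (s : bool) : set (nat -> padic K) := [set a | pclosure pp
  (if s then rational_part D else rational_part D `&` gammaQ G) (word yK n a)].

Definition exps (s : bool) : nat -> int := if s then e else e'.

Let hs s : plattice p x c (if s then rational_part D else rational_part D `&` gammaQ G) (exps s) M.
Proof. by case: s. Qed.

Lemma good_pairs_fibred : good_pairs G x D = fibred_set rows exps :> set (trigpair K n).
Proof.
apply/seteqP; split=> v.
  move=> [_]; rewrite (lattice_closureE hD) -(pclosure_integral K pp hx c_diag c_low hD).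
  move=> g1 g2; move=> s i.
  have gb : good_basis G x (pclosure pp (if s then rational_part D else rational_part D `&` gammaQ G))
      (fun i => word yK n (rowf s i v)).
    case: s; [move: g1|move: g2]; congr good_basis; apply/funext => j.
      exact: (padic_wordE true).
    exact: (padic_wordE false).
  have up (i' : 'I_n) j : (i' < j)%N -> rowf s i' v j = 0 by exact: rowf_upper.
  have [h1 h2] := (good_basis_pclosure pp hx c_diag c_low (hs s) up).1 gb i.
  by split=> //; rewrite -h2 rowfE.
move=> hv.
have gb s : good_basis G x (pclosure pp (if s then rational_part D else rational_part D `&` gammaQ G))
      (fun i => padic_word x (row i (trigval (if s then v.1 else v.2)))).
  have -> : (fun i => padic_word x (row i (trigval (if s then v.1 else v.2)))) =
      (fun i => word yK n (rowf s i v)).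
    by apply/funext => i; exact: padic_wordE.
  have up (i' : 'I_n) j : (i' < j)%N -> rowf s i' v j = 0 by exact: rowf_upper.
  apply/(good_basis_pclosure pp hx c_diag c_low (hs s) up) => i.
  by have [h1 h2] := hv s i; rewrite rowfE.
split; first last.
- rewrite (lattice_closureE hD) -(pclosure_integral K pp hx c_diag c_low hD); exact: (gb false).
- rewrite (lattice_closureE hD); exact: (gb true).
(* Integrality of the second matrix is automatic: its rows define words in the closure of the
   intersection with G(Z), hence in that of G(Z). *)
move=> i j; have [h1 _] := hv false i.
rewrite /padic_int /= -[trigval _ _ _]/(entry (false, i, j) v) -rowfE.
apply: (pclosure_gamma_coord (leqnn n)) => //.
by apply: closureS h1 => _ [g [_ Gg] <-]; exists g.
Qed.

Lemma eopen_good_pairs : eopen (good_pairs G x D : set (trigpair K n)).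
Proof.
rewrite good_pairs_fibred; apply: eopen_fibred => // s a.
exact: (pclosure_open hx c_diag c_low (hs s)).
Qed.

Lemma abs_diag_weight (v : trigpair K n) (s : bool) : fibred_set rows exps v ->
  abs (diag_weight (if s then v.1 else v.2)) =
  \prod_(i < n) \prod_(j < n | (j <= i)%N) p%:R ^ (- exps s j).
Proof.
move=> hv; rewrite /diag_weight padic_abs_prod; apply: eq_bigr => i _.
rewrite padic_abs_prod; apply: eq_bigr => j _.
by have [_] := hv s j.
Qed.

Lemma abs_det (v : trigpair K n) (s : bool) : fibred_set rows exps v ->
  abs (\det (trigval (if s then v.1 else v.2))) = p%:R ^ (- \sum_(i < n) exps s i).
Proof.
move=> hv; rewrite det_trig ?trigvalP // padic_abs_prod.
have p0 : (0 : R) < p%:R by rewrite ltr0n prime_gt0.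
have -> : p%:R ^ (- \sum_(i < n) exps s i) = \prod_(i < n) p%:R ^ (- exps s i) :> R.
  rewrite -sumrN; elim/big_rec2: _ => [|i a b _ <-]; first by rewrite expr0z.
  by rewrite expfzDr // gt_eqF.
by apply: eq_bigr => i _; have [_] := hv s i.
Qed.

Lemma good_pairs_det (v : trigpair K n) : good_pairs G x D v ->
  abs (\det (trigval v.2) ^+ 2 / \det (trigval v.1)) = p%:R ^- k.
Proof.
rewrite good_pairs_fibred => hv.
have p0 : (0 : R) < p%:R by rewrite ltr0n prime_gt0.
rewrite padic_absM padic_absV padic_absX (abs_det false hv) (abs_det true hv) /=.
have -> : p%:R ^- k = p%:R ^ (- k%:Z) :> R by rewrite -invr_expz.
rewrite -hk sumrB opprB expfzDr ?gt_eqF //.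
rewrite mulrC; congr (_ * _); first by rewrite -invr_expz invrK.
by rewrite expr2 -expfzDr ?gt_eqF //; congr (_ ^ _); rewrite sumrMnl mulr2n opprD.
Qed.

Lemma good_pairs_haar (nu : {measure set (trigpair_borel K n) -> \bar R}) :
  normalized_haar nu -> exists w : R, [/\ 0 < w,
    nu (good_pairs G x D) = ((1 - p%:R^-1) ^+ (2 * n) * w)%:E &
    forall v, good_pairs G x D v -> abs (diag_weight v.1 * diag_weight v.2) = w].
Proof.
move=> hnu; have p0 : (0 : R) < p%:R by rewrite ltr0n prime_gt0.
pose ws s : R := \prod_(i < n) \prod_(j < n | (j <= i)%N) p%:R ^ (- exps s j).
exists (ws true * ws false); split.
- by rewrite mulr_gt0 //; apply: prodr_gt0 => i _; apply: prodr_gt0 => j _; exact: exprz_gt0.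
- rewrite good_pairs_fibred (haar_fibred pp hnu); first last.
  + move=> s; rewrite /rows /= word_zero //; apply: subgroup1.
    exact: (subgroup_pclosure K pp hx c_diag c_low (hs s)).
  + by move=> s; exact: (pclosure_fibre (hs s)).
  + by move=> s; exact: (pclosure_open hx c_diag c_low (hs s)).
  congr EFin; rewrite /radius_factor big_split /=; congr (_ * _).
    rewrite big_lower big_bool /=.
    have -> : \prod_(i < n) \prod_(j < n | (j <= i)%N) (if i == j then 1 - p%:R^-1 else 1) =
        (1 - p%:R^-1) ^+ n :> R.
      rewrite -[X in _ ^+ X]card_ord -prodr_const; apply: eq_bigr => i _.
      rewrite (bigD1 i) //= eqxx big1 ?mulr1 // => j /andP[_ /negPf].
      by rewrite eq_sym => ->.
    by rewrite mul2n -addnn exprD.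
  by rewrite big_lower big_bool.
- move=> v; rewrite good_pairs_fibred => hv.
  by rewrite padic_absM (abs_diag_weight true hv) (abs_diag_weight false hv).
Qed.

End OneLattice.

(** The first matrix alone determines the closure of the lattice, the closure determines its
    rational part, and the lattice consists of rational matrices. *)
Lemma good_pairs_disjoint D1 D2 e1 e2 M1 M2 (v : trigpair K n) :
  [set toR R q | q in rational_part D1] = D1 -> [set toR R q | q in rational_part D2] = D2 ->
  plattice p x c (rational_part D1) e1 M1 -> plattice p x c (rational_part D2) e2 M2 ->
  good_pairs G x D1 v -> good_pairs G x D2 v -> D1 = D2.
Proof.
move=> t1 t2 h1 h2 [_ + _] [_ + _].
rewrite (lattice_closureE h1) (lattice_closureE h2) => b1 b2.
have sub (D : set 'M[R]_m.+1) e M : plattice p x c (rational_part D) e M ->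
    pclosure pp (rational_part D) 1 (K := K) /\ pclosure pp (rational_part D) `<=` flag yK n.
  move=> h; split; last exact: (pclosure_flag hx c_diag c_low h).
  by apply: subgroup1; exact: (subgroup_pclosure K pp hx c_diag c_low h).
have [u1 f1] := sub _ _ _ h1; have [u2 f2] := sub _ _ _ h2.
have e12 := good_basis_inj pp hx c_diag c_low u1 u2 f1 f2 b1 b2.
rewrite -t1 -t2; congr (_ @` _); apply/seteqP; split.
  by apply: (pclosure_inj (K := K) (pp := pp) hx c_diag c_low h1 h2); rewrite e12.
by apply: (pclosure_inj (K := K) (pp := pp) hx c_diag c_low h2 h1); rewrite e12.
Qed.

End GoodPairs.

(** The index set is arbitrary, possibly uncountable. If it is finite, this is additivity; if it is
    infinite, finite subunions already have arbitrarily large integral, and both sides are [+oo]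
    since [w] is positive. *)
Lemma integral_bigcup_counting (d : measure_display) (T : measurableType d) (R : realType)
    (mu : {measure set T -> \bar R}) (I : choiceType) (L : set I) (U : I -> set T)
    (f : T -> \bar R) (w : R) :
  0 < w -> (forall i, L i -> measurable (U i)) -> measurable (\bigcup_(i in L) U i) ->
  trivIset L U -> measurable_fun (\bigcup_(i in L) U i) f ->
  (forall t, (\bigcup_(i in L) U i) t -> (0 <= f t)%E) ->
  (forall i, L i -> (\int[mu]_(t in U i) f t)%E = w%:E) ->
  (\int[mu]_(t in \bigcup_(i in L) U i) f t)%E = (counting L * w%:E)%E.
Proof.
move=> w0 mU mW tU mf f0 hU.
pose V i := if i \in L then U i else set0.
have VE i : L i -> V i = U i by move=> Li; rewrite /V mem_set.
have mV i : measurable (V i) by rewrite /V; case: ifP => [/set_mem/mU|_].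
have int_seq (s : seq I) : uniq s -> (forall i, i \in s -> L i) ->
    (\int[mu]_(t in \big[setU/set0]_(i <- s) V i) f t)%E = ((size s)%:R * w)%:E /\
    \big[setU/set0]_(i <- s) V i `<=` \bigcup_(i in L) U i.
  move=> us sL.
  have sub : \big[setU/set0]_(i <- s) V i `<=` \bigcup_(i in L) U i.
    by rewrite -bigcup_seq => t [i /= /sL Li]; rewrite VE // => Ut; exists i.
  split=> //; rewrite ge0_integral_bigsetU //.
  - rewrite big_seq (eq_bigr (fun=> w%:E)); last by move=> i /sL Li; rewrite VE // hU.
    rewrite -big_seq big_const_seq count_predT iter_addr addr0.
    by rewrite mulr_natl EFin_natmul.
  - by move=> i j /sL Li /sL Lj; rewrite !VE //; exact: tU.
  - exact: measurable_funS mf.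
  - by move=> t /sub; exact: f0.
rewrite /counting; case: ifPn => [/asboolP fL|/asboolP iL].
  have sP i : (i \in finmap.enum_fset (fset_set L)) = (i \in L) := in_fset_set fL i.
  have [] := int_seq _ (finmap.fset_uniq (fset_set L)).
    by move=> i; rewrite sP => /set_mem.
  rewrite -EFinM => <- _; congr (integral _ _ _).
  by rewrite -bigcup_seq; apply/seteqP; split=> t [i Li Ut]; exists i; rewrite /= ?sP ?mem_set ?VE //;
    move: Li; rewrite /= sP => /set_mem Li; rewrite ?VE // -VE.
rewrite gt0_mulye ?lte_fin //; apply/eqyP => A A0.
have [B BL hB] := infinite_set_fset (Num.truncn (A / w)).+1 iL.
have [e sub] := int_seq _ (finmap.fset_uniq B) BL.
apply: (@le_trans _ _ ((size (finmap.enum_fset B))%:R * w)%:E); last first.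
  rewrite -e; apply: ge0_subset_integral => //.
  by apply: bigsetU_measurable.
rewrite lee_fin -ler_pdivrMr //; apply: le_trans (ltW (truncnS_gt _)) _.
by rewrite ler_nat.
Qed.

Theorem proposition3p12 (R : realType) (p : nat) (K : padicField R p)
    (m : nat) (G : unipotentZGroup m)
    (n : nat) (x : 'I_n -> 'M[int]_m.+1)
    (nu : {measure set (trigpair_borel K n) -> \bar R}) (s : R) :
  prime p -> malcev_basis G x -> normalized_haar nu ->
  local_zeta G p s =
  (((1 - p%:R^-1) ^+ (2 * n))^-1%:E *
   \int[nu]_(AB in all_good_pairs K G x)
     ((padic_abs (diag_weight AB.1 * diag_weight AB.2))^-1 *
      padic_abs (\det (trigval AB.2) ^+ 2 / \det (trigval AB.1)) `^ s)%:E)%E.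
Proof.
move=> pp hx hnu; have [c [c_diag c_low]] := rat_functionals hx (leqnn n).
have p0 : (0 : R) < p%:R by rewrite ltr0n prime_gt0.
pose U D : set (trigpair_borel K n) := good_pairs G x D.
pose L k := lattices_of_index R G (p ^ k).
pose f0 (v : trigpair_borel K n) : R := (padic_abs (diag_weight v.1 * diag_weight v.2))^-1 *
  padic_abs (\det (trigval v.2) ^+ 2 / \det (trigval v.1)) `^ s.
pose f (v : trigpair_borel K n) : \bar R := (f0 v)%:E.
pose a : R := (1 - p%:R^-1) ^+ (2 * n).
have a0 : 0 < a by rewrite exprn_gt0 // subr_gt0 invf_lt1 // ltr1n prime_gt1.
pose b k : R := p%:R `^ (- (k%:R * s)).
have b0 k : 0 < b k by exact: powR_gt0.
have oU k D : L k D -> eopen (U D).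
  by move=> /(lattice_plattice hx c_diag c_low pp)[_ [e [e' [h1 h2 _]]]]; exact: (eopen_good_pairs pp hx c_diag c_low h1 h2).
(* On the good pairs of one lattice the integrand is constant, and the weight [w] cancels between
   this constant and the measure, so that the contribution [a * b k] depends on [k] only. *)
have cU k D : L k D -> exists2 y, (forall v, U D v -> f0 v = y) & (y%:E * nu (U D))%E = (a * b k)%:E.
  move=> /(lattice_plattice hx c_diag c_low pp)[_ [e [e' [h1 h2 hk]]]].
  have [w [w0 hw hf]] := good_pairs_haar pp hx c_diag c_low h1 h2 hnu.
  exists (w^-1 * b k).
    move=> v Uv; rewrite /f0 hf // (good_pairs_det pp hx c_diag c_low h1 h2 hk) //.
    congr (_ * _); rewrite /b -powR_mulrn ?ltW // -powRN -powRrM; congr (_ `^ _).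
    by rewrite mulNr.
  rewrite hw -EFinM; congr EFin.
  by rewrite mulrC -mulrA mulVKf // gt_eqF.
have dU k1 k2 D1 D2 v : L k1 D1 -> L k2 D2 -> U D1 v -> U D2 v -> D1 = D2.
  move=> /(lattice_plattice hx c_diag c_low pp)[t1 [e1 [_ [h1 _ _]]]].
  move=> /(lattice_plattice hx c_diag c_low pp)[t2 [e2 [_ [h2 _ _]]]].
  exact: (good_pairs_disjoint pp hx c_diag c_low t1 t2 h1 h2).
pose W k := \bigcup_(D in L k) U D.
(* An arbitrary union of open sets, so no countability of the set of lattices has to be known. *)
have oW k : eopen (W k).
  move=> v [D LD Uv]; have [eps e0 h] := oU k D LD v Uv; exists eps => // w hw.
  by exists D => //; exact: h.
have mW k : measurable (W k) by apply: eopen_measurable; exact: oW.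
have allE : all_good_pairs K G x = \bigcup_k W k.
  by [].
have f_ge0 v : (0 <= f v)%E.
  rewrite lee_fin mulr_ge0 ?invr_ge0 ?padic_abs_ge0 //; exact: powR_ge0.
(* The integrand is constant on each of the open sets [U D], hence locally constant on their union:
   the preimage of any set is open. *)
have mf : measurable_fun (\bigcup_k W k) f.
  move=> _ Y mY; apply: eopen_measurable => v [[k _ [D LD Uv]] Yv].
  have [eps e0 h] := oU k D LD v Uv; exists eps => // w hw; have Uw := h w hw.
  split; first by exists k => //; exists D.
  have [y hy _] := cU k D LD.
  by rewrite /preimage /= /f (hy _ Uw) -(hy _ Uv).
(* A common pair would come from one and the same lattice, whose commensurability index determines
   the power of [p], and thus [k]. *)
have tW : trivIset setT W.
  move=> i j _ _ [v [[D1 L1 U1] [D2 L2 U2]]].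
  have e := dU _ _ _ _ v L1 L2 U1 U2.
  have [_ i1] := L1; have [_] := L2; rewrite -e i1 => /eqP.
  by rewrite eqe eqr_nat eqn_exp2l ?prime_gt1 // => /eqP.
have intW k : (\int[nu]_(v in W k) f v)%E = (counting (L k) * (a * b k)%:E)%E.
  apply: integral_bigcup_counting => //.
  - exact: mulr_gt0.
  - by move=> D /oU; exact: eopen_measurable.
  - exact: mW.
  - by move=> D1 D2 L1 L2 [v [U1 U2]]; exact: (dU _ _ _ _ v L1 L2).
  - by apply: measurable_funS mf; [exact: bigcup_measurable|move=> v Wv; exists k].
  - move=> D LD; have [y hy <-] := cU k D LD.
    rewrite -integral_cst; last by apply: eopen_measurable; exact: (oU k).
    by apply: eq_integral => v /set_mem Uv; rewrite /f hy.
have -> : (\int[nu]_(v in all_good_pairs K G x) f v)%E =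
    (\sum_(0 <= k <oo) \int[nu]_(v in W k) f v)%E.
  by rewrite allE ge0_integral_bigcup.
rewrite /local_zeta -nneseriesZl; last by move=> k _; exact: integral_ge0.
apply: eq_eseriesr => k _; rewrite intW muleCA -EFinM mulrA mulVf ?gt_eqF //.
by rewrite mul1r.
Qed.
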